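(* Assume that $X$ is of Pareto-type with index $\alpha\in(1,2)$, or $\alpha=1$ with $\mu_1<\infty$, i.e. $1-F(x)\sim x^{-\alpha}\ell(x)$ as $x\to\infty$ with $\ell$ slowly varying, and that the counting process $\{N(t);\,t\geq 0\}$ $\mathcal{D}$-averages in time to the random variable $\Lambda$. Define $(a_t)_{t>0}$ by $\lim_{t\to\infty}t\,a_t^{-\alpha}\ell(a_t)=1$. Then $$\frac{N(t)}{a_t^2}\,C_{N(t)}\stackrel{\mathcal{D}}{\longrightarrow}\frac{1}{\mu_1}\,U_\alpha\quad\text{and}\quad\frac{N(t)}{a_t^2}\,\widehat{\mathrm{D}(X)}\stackrel{\mathcal{D}}{\longrightarrow}\frac{1}{\mu_1}\,U_\alpha\quad\text{as } t\rightarrow\infty,$$ where the distribution of $U_\alpha$ is determined by $\mathbb{E}\{e^{-rU_\alpha}\}=\mathbb{E}\{e^{-r^{\alpha/2}\Gamma(1-\alpha/2)\,\Lambda}\}$, $r\geq 0$; and also $$\frac{t}{a_t^2}\,\widehat{\mathrm{D}(X)}\stackrel{\mathcal{D}}{\longrightarrow}\frac{1}{\mu_1}\,\frac{U_\alpha}{\Lambda}\quad\text{as } t\rightarrow\infty,$$ where the joint distribution of the random vector $(U_\alpha,\mu_1\Lambda)^\prime$ is determined by $$\mathbb{E}\left\{e^{-rU_\alpha-s\mu_1\Lambda}\right\}=\mathbb{E}\left\{e^{-r^{\alpha/2}\Gamma(1-\alpha/2)\,\Lambda}\right\},\quad r>0,\ s\geq 0.$$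
   Context: $X$ is a positive random variable with distribution function $F$ and $\mu_\beta:=\mathbb{E}X^\beta\le\infty$; $X_1,X_2,\ldots$ are i.i.d. copies of $X$; $\{N(t);\,t\geq 0\}$ is a counting process (nonnegative integer-valued, nondecreasing in $t$) independent of the $X_i$'s. For fixed $t\ge0$, $C_{N(t)}:=\frac{X_1^2+\cdots+X_{N(t)}^2}{X_1+\cdots+X_{N(t)}}$ if $N(t)\ge1$ and $C_{N(t)}:=0$ otherwise. The sample dispersion based on $X_1,\ldots,X_{N(t)}$ is $\widehat{\mathrm{D}(X)}:=S^2/\overline X$, where $\overline X:=\frac{1}{N(t)}\sum_{i=1}^{N(t)}X_i$ and $S^2:=\frac{1}{N(t)}\sum_{i=1}^{N(t)}(X_i-\overline X)^2$; on $\{N(t)=0\}$ it is set to $0$. $X$ (or $F$) is of Pareto-type with index $\alpha>0$ if $1-F(x)\sim x^{-\alpha}\ell(x)$ as $x\to\infty$ for a slowly varying function $\ell$. The counting process $\mathcal{D}$-averages in time to $\Lambda$ if $N(t)/t\stackrel{\mathcal{D}}{\longrightarrow}\Lambda$ (convergence in distribution) as $t\to\infty$, where $\mathbb{P}[\Lambda>0]=1$. $\Gamma$ is the gamma function.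
   Formalization: The joint transform's right side is corrected to E{exp(-r^{α/2}Γ(1-α/2)Λ - sμ₁Λ)}, since as printed r→0 would force Λ=0 a.s.; and a_t→∞, implicit in the definition of a_t, is assumed explicitly. *)

(* Defs.v *)
From HB Require Import structures.
From mathcomp Require Import all_boot all_order all_algebra finmap.
From mathcomp Require Import all_classical all_reals all_analysis.

Set Implicit Arguments.
Unset Strict Implicit.
Unset Printing Implicit Defensive.

Import Order.TTheory GRing.Theory Num.Theory.
Import numFieldNormedType.Exports.

Local Open Scope classical_set_scope.
Local Open Scope ring_scope.

(* Euler's integral; only used at arguments z > 0, where it converges. *)
Definition gamma_fun (R : realType) (z : R) : R :=
  \int[@lebesgue_measure R]_(x in `]0, +oo[) (x `^ (z - 1) * expR (- x)).

(* ell is a measurable positive function on some neighbourhood of infinity;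
   its values elsewhere are irrelevant. *)
Definition slowly_varying (R : realType) (ell : R -> R) : Prop :=
  (exists2 A : R, measurable_fun `[A, +oo[ ell &
     forall x, A <= x -> 0 < ell x) /\
  (forall c : R, 0 < c -> ell (c * x) / ell x @[x --> +oo] --> (1 : R)).

Section random_variables.
Context {d : measure_display} {T : measurableType d} {R : realType}.
Variable P : probability T R.

(* Quantifying over measurable B matters: [distribution P Y] is a total function
   on [set R] which is unspecified on non-measurable sets. *)
Definition same_distribution {d'} {T' : measurableType d'}
    (Q : probability T' R) (Y : {RV P >-> R}) (Z : {RV Q >-> R}) : Prop :=
  forall B : set R, measurable B -> distribution P Y B = distribution Q Z B.

Definition generated_sigma_algebra {I : Type} {d'} {T' : measurableType d'}
    (D : set I) (Y : I -> T -> T') : set (set T) :=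
  <<s [set A | exists i B, [/\ D i, measurable B & A = Y i @^-1` B]] >>.

Definition independent_classes (F G : set (set T)) : Prop :=
  forall A B, F A -> G B -> P (A `&` B) = (P A * P B)%E.

Definition mutually_independent (Y : nat -> T -> R) : Prop :=
  forall (J : {fset nat}) (B : nat -> set R), (forall i, measurable (B i)) ->
  P (\bigcap_(i in [set` J]) (Y i @^-1` B i)) =
  (\prod_(i <- J) P (Y i @^-1` B i))%E.

Definition counting_process (N : R -> T -> nat) : Prop :=
  forall s t w, 0 <= s -> s <= t -> (N s w <= N t w)%N.

(* Convergence of the distribution functions of Y_t, as t -> +oo, at every
   continuity point of the distribution function of Z. *)
Definition cvg_in_distribution (Y : R -> T -> R)
    {d'} {T' : measurableType d'} (Q : probability T' R) (Z : T' -> R) : Prop :=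
  forall x : R, {for x, continuous (fun y : R => Q (Z @^-1` `]-oo, y]))} ->
  P (Y t @^-1` `]-oo, x]) @[t --> +oo] --> Q (Z @^-1` `]-oo, x]).

Definition D_averages_in_time (N : R -> T -> nat)
    {d'} {T' : measurableType d'} (Q : probability T' R) (Lam : T' -> R) : Prop :=
  Q [set w | 0 < Lam w] = 1%E /\
  cvg_in_distribution (fun t w => (N t w)%:R / t) Q Lam.

Definition pareto_type (X : {RV P >-> R}) (alpha : R) (ell : R -> R) : Prop :=
  slowly_varying ell /\
  (1 - fine (cdf X x)) / (x `^ (- alpha) * ell x) @[x --> +oo] --> (1 : R).

(* The Laplace transform of U; it determines the distribution of U. *)
Definition limit_law (alpha : R) (U : T -> R)
    {d'} {T' : measurableType d'} (Q : probability T' R) (Lam : T' -> R) : Prop :=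
  forall r : R, 0 <= r ->
  ('E_P[fun w => expR (- (r * U w))] =
   'E_Q[fun w =>
     expR (- (r `^ (alpha / 2) * gamma_fun (1 - alpha / 2) * Lam w))])%E.

(* The Laplace transform of the vector (U, mu1 Lam); it determines the joint
   distribution.  The term s mu1 Lam is needed in both exponents: if it were
   absent from the right-hand one, letting r -> 0 would yield
   E exp(- s mu1 Lam) = 1, i.e. Lam = 0 almost surely. *)
Definition joint_limit_law (alpha mu1 : R) (U Lam : T -> R) : Prop :=
  forall r s : R, 0 < r -> 0 <= s ->
  ('E_P[fun w => expR (- (r * U w) - s * (mu1 * Lam w))] =
   'E_P[fun w =>
     expR (- (r `^ (alpha / 2) * gamma_fun (1 - alpha / 2) * Lam w)
           - s * (mu1 * Lam w))])%E.

End random_variables.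

(* The observations X_1, ..., X_n are x 0, ..., x n.-1. *)
Section sample_statistics.
Context {R : realType}.
Variables (x : nat -> R) (n : nat).

Definition sample_C : R :=
  if n == 0%N then 0
  else (\sum_(i < n) x i ^+ 2) / (\sum_(i < n) x i).

Definition sample_mean : R := n%:R^-1 * \sum_(i < n) x i.

Definition sample_variance : R :=
  n%:R^-1 * \sum_(i < n) (x i - sample_mean) ^+ 2.

Definition sample_dispersion : R :=
  if n == 0%N then 0 else sample_variance / sample_mean.

End sample_statistics.

(* Main.v *)
Require Import Defs.
From HB Require Import structures.
From mathcomp Require Import all_boot all_order all_algebra finmap.
From mathcomp Require Import all_classical all_reals all_analysis.
From mathcomp Require Import measurable_realfun.
From mathcomp Require Import ring lra.

Set Implicit Arguments.
Unset Strict Implicit.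
Unset Printing Implicit Defensive.

Import Order.TTheory GRing.Theory Num.Theory.
Import numFieldNormedType.Exports.

Local Open Scope classical_set_scope.
Local Open Scope ring_scope.

(** Put b = alpha / 2 and let phi (l) = E exp (- l X^2).

    With S1 and S2 the sums of the first N(t) observations and of their squares,
    N C / a_t^2 = (N / S1) (S2 / a_t^2), and C and the sample dispersion D differ by
    the sample mean S1 / N. Since X has a finite mean, S1 / N tends to mu1 in
    probability (likely_random_mean) and t / a_t^2 tends to 0 (regular_sqr_cvgy). By
    Slutsky's theorem (slutsky) only S2 / a_t^2 matters for the first two limits, and
    (t / N) (S2 / a_t^2) for the third one.

    Regular variation of the tail G of X and Potter's bound yield
    1 - phi (r / a^2) ~ r^b Gamma (1 - b) G (a) (laplace_sqr_asymptotics), and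
    t G (a_t) tends to 1. Conditionally on N = n the Laplace transform of S2 / a_t^2 at r
    is phi (r / a_t^2) ^ n, that is about exp (- r^b Gamma (1 - b) N / t). As N / t
    tends to Lam in distribution, the transform tends to
    E exp (- r^b Gamma (1 - b) Lam). If S2 / a_t^2 is multiplied by (N / t)^(- g), then
    r becomes r (N / t)^(- g) and the exponent of Lam in the limit becomes 1 - g b; the
    third claim is the case g = 1 (laplace_random_sum_of_squares).

    Convergence of Laplace transforms on the half-line implies convergence in
    distribution because half-line indicators lie between polynomials in exp (- s x)
    up to a small error and a small shift (separating_poly, laplace_cvg_interlaced). The
    same approximation shows that the joint Laplace transform of (U, mu1 Lam)
    determines E exp (- r U) on the events Lam <= x; discretising Lam then gives the
    transform of U / Lam, which is the one found above (joint_law_quotient).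

    Existence of (U, Lam): the transforms of S2 / a_t^2 for the deterministic index
    t converge to exp (- r^b Gamma (1 - b)), which is therefore the transform of some
    S >= 0 (laplace_limit, stable_law). On a product space, S is independent of Lam and
    U = Lam^(1 / b) S has the required joint law with Lam (joint_limit_exists). *)

(** * Expectations of bounded functions *)

Section unit_interval.
Context {R : realType}.

Lemma indic01 {T : Type} (A : set T) w : 0 <= (\1_A w : R) <= 1.
Proof. by rewrite indicE; case: (_ \in _) => /=; rewrite ?lexx ?ler01. Qed.

Lemma mulr01 (x y : R) : 0 <= x <= 1 -> 0 <= y <= 1 -> 0 <= x * y <= 1.
Proof. by move=> /andP[x0 x1] /andP[y0 y1]; rewrite mulr_ge0//= mulr_ile1. Qed.

Lemma prodr01 (I : Type) (s : seq I) (Q : pred I) (F : I -> R) :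
  (forall i, 0 <= F i <= 1) -> 0 <= \prod_(i <- s | Q i) F i <= 1.
Proof.
move=> F01; elim/big_ind : _ => //; first by rewrite ler01 lexx.
exact: mulr01.
Qed.

Lemma norm01 (x : R) : 0 <= x <= 1 -> `|x| <= 1.
Proof. by move=> /andP[x0 x1]; rewrite ger0_norm. Qed.

Lemma expRN01 (x : R) : 0 <= x -> 0 <= expR (- x) <= 1.
Proof. by move=> x0; rewrite expR_ge0/= -expR0 ler_expR oppr_le0. Qed.

End unit_interval.

Lemma measurable_lt {d} {T : measurableType d} {R : realType} (f g : T -> R) :
  measurable_fun setT f -> measurable_fun setT g -> measurable [set w | f w < g w].
Proof.
move=> mf mg; have := measurable_fun_ltr mf mg.
by move=> /(_ measurableT [set true] I); rewrite setTI.
Qed.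

Lemma measurable_nonneg {d} {T : measurableType d} {R : realType} (f : T -> R) :
  measurable_fun setT f -> measurable [set w | 0 <= f w].
Proof.
move=> mf; have -> : [set w | 0 <= f w] = ~` [set w | f w < 0].
  by apply/seteqP; split => w /=; rewrite leNgt => /negP.
by apply: measurableC; exact: measurable_lt.
Qed.

Section bounded_measurable.
Context {d : measure_display} {T : measurableType d} {R : realType}.

Definition bounded_measurable (f : T -> R) : Prop :=
  measurable_fun setT f /\ exists M, forall w, `|f w| <= M.

Lemma bm_unit (f : T -> R) : measurable_fun setT f ->
  (forall w, 0 <= f w <= 1) -> bounded_measurable f.
Proof.
by move=> mf f01; split=> //; exists 1 => w; case/andP: (f01 w) => ? ?; rewrite ger0_norm.
Qed.

Lemma bm_cst (r : R) : bounded_measurable (fun=> r).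
Proof. by split => //; exists `|r|. Qed.

Lemma bmD (f g : T -> R) : bounded_measurable f -> bounded_measurable g ->
  bounded_measurable (fun w => f w + g w).
Proof.
move=> [mf [M fM]] [mg [K gK]]; split; first exact: measurable_funD.
by exists (M + K) => w; rewrite (le_trans (ler_normD _ _))// lerD.
Qed.

Lemma bmM (f g : T -> R) : bounded_measurable f -> bounded_measurable g ->
  bounded_measurable (fun w => f w * g w).
Proof.
move=> [mf [M fM]] [mg [K gK]]; split; first exact: measurable_funM.
by exists (M * K) => w; rewrite normrM ler_pM.
Qed.

Lemma bmZ (r : R) (f : T -> R) : bounded_measurable f ->
  bounded_measurable (fun w => r * f w).
Proof. by move=> bf; apply: bmM => //; exact: bm_cst. Qed.

Lemma bmB (f g : T -> R) : bounded_measurable f -> bounded_measurable g ->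
  bounded_measurable (fun w => f w - g w).
Proof.
move=> bf bg; have := bmD bf (bmZ (-1) bg).
by under eq_fun do rewrite mulN1r.
Qed.

Lemma bmX (f : T -> R) n : bounded_measurable f ->
  bounded_measurable (fun w => f w ^+ n).
Proof.
move=> bf; elim: n => [|n IH]; first exact: bm_cst.
by under eq_fun do rewrite exprS; exact: bmM.
Qed.

Lemma bm_sum (I : Type) (s : seq I) (f : I -> T -> R) :
  (forall i, bounded_measurable (f i)) ->
  bounded_measurable (fun w => \sum_(i <- s) f i w).
Proof.
move=> bf; elim: s => [|i s IH].
  by under eq_fun do rewrite big_nil; exact: bm_cst.
by under eq_fun do rewrite big_cons; exact: bmD.
Qed.

Lemma bm_prod (I : Type) (s : seq I) (Q : pred I) (f : I -> T -> R) :
  (forall i, bounded_measurable (f i)) ->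
  bounded_measurable (fun w => \prod_(i <- s | Q i) f i w).
Proof.
move=> bf; elim: s => [|i s IH].
  by under eq_fun do rewrite big_nil; exact: bm_cst.
under eq_fun do rewrite big_cons; case: (Q i) => //; exact: bmM.
Qed.

Lemma bm_indic (A : set T) : measurable A -> bounded_measurable (\1_A : T -> R).
Proof.
move=> mA; apply: bm_unit; first exact: measurable_indic.
exact: indic01.
Qed.

Lemma bm_comp_unit (f : R -> R) (Y : T -> R) : measurable_fun setT f ->
  (forall x, 0 <= f x <= 1) -> measurable_fun setT Y ->
  bounded_measurable (fun w => f (Y w)).
Proof.
by move=> mf f01 mY; apply: bm_unit => // w; exact: measurableT_comp.
Qed.

End bounded_measurable.

Section bounded_expectation.
Context {d : measure_display} {T : measurableType d} {R : realType}.
Variable P : probability T R.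
Implicit Types f g : T -> R.

Lemma bm_integrable f : bounded_measurable f -> P.-integrable setT (EFin \o f).
Proof.
move=> [mf [M fM]]; apply: measurable_bounded_integrable => //.
  by rewrite (le_lt_trans (probability_le1 _ _)) ?ltry.
exists M; split; first exact: num_real.
by move=> x Mx w _ /=; rewrite (le_trans (fM w))// ltW.
Qed.

Lemma bm_expectation f : bounded_measurable f ->
  ('E_P[f] = (\int[P]_w f w)%:E)%E.
Proof.
move=> bf; rewrite unlock /Rintegral fineK//.
exact: integrable_fin_num (bm_integrable bf).
Qed.

Lemma Ex_cst r : \int[P]_w r = r.
Proof. by rewrite /Rintegral integral_cst//= probability_setT mule1. Qed.

Lemma ExD f g : bounded_measurable f -> bounded_measurable g ->
  \int[P]_w (f w + g w) = \int[P]_w f w + \int[P]_w g w.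
Proof. by move=> bf bg; rewrite RintegralD//; exact: bm_integrable. Qed.

Lemma ExB f g : bounded_measurable f -> bounded_measurable g ->
  \int[P]_w (f w - g w) = \int[P]_w f w - \int[P]_w g w.
Proof. by move=> bf bg; rewrite RintegralB//; exact: bm_integrable. Qed.

Lemma ExZ r f : bounded_measurable f ->
  \int[P]_w (r * f w) = r * \int[P]_w f w.
Proof. by move=> bf; rewrite RintegralZl//; exact: bm_integrable. Qed.

Lemma Ex_sum (I : Type) (s : seq I) (f : I -> T -> R) :
  (forall i, bounded_measurable (f i)) ->
  \int[P]_w (\sum_(i <- s) f i w) = \sum_(i <- s) \int[P]_w f i w.
Proof.
move=> bf; elim: s => [|i s IH].
  by under eq_Rintegral do rewrite big_nil; rewrite big_nil Ex_cst.
under eq_Rintegral do rewrite big_cons.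
by rewrite big_cons ExD ?IH//; exact: bm_sum.
Qed.

Lemma Ex_le f g : bounded_measurable f -> bounded_measurable g ->
  (forall w, f w <= g w) -> \int[P]_w f w <= \int[P]_w g w.
Proof. by move=> bf bg fg; apply: le_Rintegral => //; exact: bm_integrable. Qed.

Lemma Ex_ge0 f : (forall w, 0 <= f w) -> 0 <= \int[P]_w f w.
Proof. by move=> f0; apply: Rintegral_ge0. Qed.

Lemma Ex_unit f : measurable_fun setT f -> (forall w, 0 <= f w <= 1) ->
  0 <= \int[P]_w f w <= 1.
Proof.
move=> mf f01; rewrite Ex_ge0 => [|w]; last by case/andP: (f01 w).
rewrite -[X in _ <= X]Ex_cst Ex_le//; [exact: bm_unit|exact: bm_cst|].
by move=> w; case/andP: (f01 w).
Qed.

Definition pr (A : set T) : R := fine (P A).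

Lemma prE A : measurable A -> P A = (pr A)%:E.
Proof. by move=> mA; rewrite /pr fineK// fin_num_measure. Qed.

Lemma pr_ge0 A : 0 <= pr A. Proof. by rewrite /pr fine_ge0. Qed.

Lemma pr_le1 A : measurable A -> pr A <= 1.
Proof. by move=> mA; rewrite -lee_fin -prE// probability_le1. Qed.

Lemma prT : pr setT = 1. Proof. by rewrite /pr probability_setT. Qed.

Lemma le_pr A B : measurable A -> measurable B -> A `<=` B -> pr A <= pr B.
Proof. by move=> mA mB AB; rewrite -lee_fin -!prE// le_measure// inE. Qed.

Lemma prU A B : measurable A -> measurable B -> pr (A `|` B) <= pr A + pr B.
Proof.
move=> mA mB; rewrite -lee_fin EFinD -!prE//; last exact: measurableU.
exact: measureU2.
Qed.

Lemma prC A : measurable A -> pr (~` A) = 1 - pr A.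
Proof.
by move=> mA; rewrite /pr probability_setC// fineB//= fin_num_measure.
Qed.

Lemma null_setC A : measurable A -> pr A = 1 -> P (~` A) = 0%E.
Proof.
by move=> mA A1; rewrite (prE (measurableC mA)) prC// A1 subrr.
Qed.

Lemma Ex_indic A : measurable A -> \int[P]_w (\1_A w) = pr A.
Proof. by move=> mA; rewrite /Rintegral integral_indic// setIT. Qed.

Lemma pr_seq1 A : measurable A -> P A = 1%E -> pr A = 1.
Proof. by move=> mA PA; rewrite /pr PA. Qed.

Lemma pr_eq_on G A B : measurable G -> measurable A -> measurable B ->
  pr G = 1 -> (forall w, G w -> A w <-> B w) -> pr A = pr B.
Proof.
move=> mG mA mB G1 AB.
suff H A' B' : measurable A' -> measurable B' ->
    (forall w, G w -> A' w -> B' w) -> pr A' <= pr B'.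
  by apply/eqP; rewrite eq_le !H// => w Gw; case: (AB w Gw).
move=> mA' mB' h; apply: (@le_trans _ _ (pr (B' `|` ~` G))).
  apply: le_pr => //; first by apply: measurableU => //; exact: measurableC.
  by move=> w Aw; have [/h|] := pselect (G w); [left; auto|right].
by rewrite (le_trans (prU _ _))//; [exact: measurableC|rewrite prC// G1 subrr addr0].
Qed.

Lemma pr_pred1I A G : measurable A -> measurable G -> pr G = 1 ->
  pr (A `&` G) = pr A.
Proof.
move=> mA mG G1; apply: (@pr_eq_on G) => //; first exact: measurableI.
by move=> w Gw; split => [[]|].
Qed.

Lemma Ex_dct (f_ : nat -> T -> R) f (M : R) G :
  (forall n, measurable_fun setT (f_ n)) -> measurable_fun setT f ->
  measurable G -> pr G = 1 ->
  (forall n w, `|f_ n w| <= M) -> (forall w, G w -> f_ ^~ w @ \oo --> f w) ->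
  \int[P]_w f_ n w @[n --> \oo] --> \int[P]_w f w.
Proof.
move=> mf_ mf mG G1 fM fcvg.
have gM := bm_integrable (@bm_cst _ T _ M).
have mfe : measurable_fun setT (EFin \o f) by exact/measurable_EFinP.
have := @dominated_convergence _ _ _ P setT measurableT
  (fun n w => (f_ n w)%:E) (EFin \o f) (cst M%:E)
  (fun n => measurableT_comp (@EFin_measurable _ setT) (mf_ n)) mfe.
case=> //.
- exists (~` G); split; first exact: measurableC.
    exact: null_setC.
  move=> w /= h Gw; apply: h => _; apply: cvg_EFin; first exact: nearW.
  exact: fcvg.
- by apply: aeW => w n _ /=; rewrite lee_fin.
- move=> fint _ h; apply: (@fine_cvg R _ \oo _ (fun n => \int[P]_w (f_ n w)%:E)%E).
  by rewrite fineK; [exact: h|exact: integrable_fin_num].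
Qed.

End bounded_expectation.

Lemma Ex_same_distribution {R : realType}
  {d} {T : measurableType d} (P : probability T R) (Y : {RV P >-> R})
  {d'} {T' : measurableType d'} (Q : probability T' R) (Z : {RV Q >-> R})
  (f : R -> R) : same_distribution Y Z -> measurable_fun setT f ->
  (forall x, 0 <= f x) -> \int[P]_w f (Y w) = \int[Q]_w f (Z w).
Proof.
move=> YZ mf f0; rewrite /Rintegral; congr fine.
have mfe : measurable_fun setT (EFin \o f) by exact/measurable_EFinP.
have fe0 y : (0 <= (EFin \o f) y)%E by rewrite lee_fin.
rewrite -(ge0_integral_distribution Y mfe fe0).
rewrite -(ge0_integral_distribution Z mfe fe0).
by apply: eq_measure_integral => A mA _; exact: YZ.
Qed.

(** * Convergence in distribution *)

Section interlacing.
Context {R : realType}.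
Implicit Types (F : R -> R -> R) (G : R -> R).

(** For distribution functions this is convergence at the continuity points of G. It
    can be used and proved at arbitrary points x < y, whether or not G is continuous
    there. *)
Definition interlaced F G : Prop := forall x y e, x < y -> 0 < e ->
  \forall t \near +oo, F t x <= G y + e /\ G x <= F t y + e.

(** A monotone function has countably many discontinuities. *)
Lemma continuity_point_dense G a b : a < b -> {homo G : x y / x <= y} ->
  exists c, [/\ a < c, c < b & {for c, continuous G}].
Proof.
move=> ab ndG.
have ndab : {in `[a, b] &, nondecreasing_fun G} by move=> x y _ _ /ndG.
have [c [cab cd]] : exists c : R, (c \in `]a, b[%R) /\ ~ discontinuity G c.
  apply: contrapT => h.
  suff /countable_lebesgue_measure0 : countable (`]a, b[%classic : set R).
    rewrite lebesgue_measure_itv/= lte_fin ab -EFinD => -[] /eqP.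
    by rewrite subr_eq0 gt_eqF.
  have := discontinuity_countable ndab; apply: sub_countable; apply: subset_card_le.
  move=> c /= cab; split => //; apply: contrapT => cd; apply: h; exists c.
  by split.
move: (cab); rewrite in_itv/= => /andP[ac cb].
exists c; split => //.
have cl : cvg (G x @[x --> c^'-]) by
  apply: nondecreasing_at_left_is_cvgr; apply: nearW => x; [move=> ? ? _ _ /ndG|
    exists (G c) => _/= [y + <-]; rewrite in_itv/= => /andP[_ /ltW/ndG]].
have cr : cvg (G x @[x --> c^'+]) by
  apply: nondecreasing_at_right_is_cvgr; apply: nearW => x; [move=> ? ? _ _ /ndG|
    exists (G c) => _/= [y + <-]; rewrite in_itv/= => /andP[/ltW/ndG]].
have lr : lim (G x @[x --> c^'-]) = lim (G x @[x --> c^'+]).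
  by apply: contrapT => /eqP lr; apply: cd; split.
have lG : lim (G x @[x --> c^'-]) <= G c.
  apply: limr_le => //; near=> x; apply: ndG.
  by near: x; exact: nbhs_left_le.
have rG : G c <= lim (G x @[x --> c^'+]).
  apply: limr_ge => //; near=> x; apply: ndG.
  by near: x; exact: nbhs_right_ge.
have lE : lim (G x @[x --> c^'-]) = G c by apply/eqP; rewrite eq_le lG lr rG.
apply/left_right_continuousP; split; first by rewrite -[X in _ --> X]lE.
by rewrite -[X in _ --> X]lE lr.
Unshelve. all: by end_near. Qed.

Section random_elements.
Context {d : measure_display} {T : measurableType d} (P : probability T R).
Context {d' : measure_display} {T' : measurableType d'} (Q : probability T' R).
Variables (Y : R -> T -> R) (Z : T' -> R).
Hypothesis mY : forall t, measurable_fun setT (Y t).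
Hypothesis mZ : measurable_fun setT Z.

Lemma measurable_le {d2} {T2 : measurableType d2} (f : T2 -> R) x :
  measurable_fun setT f -> measurable (f @^-1` `]-oo, x]).
Proof. by move=> mf; rewrite -[X in measurable X]setTI; exact: mf. Qed.

Lemma le_cdf {d2} {T2 : measurableType d2} (P2 : probability T2 R) (f : T2 -> R) :
  measurable_fun setT f -> {homo (fun x => pr P2 (f @^-1` `]-oo, x])) : x y / x <= y}.
Proof.
move=> mf x y xy; apply: le_pr; [exact: measurable_le|exact: measurable_le|].
by move=> w /=; rewrite !in_itv/= => /le_trans; exact.
Qed.

(** Monotonicity compares the values at x and at y with those at a continuity point
    between x and y. *)
Lemma cvg_in_distribution_interlaced : cvg_in_distribution P Y Q Z ->
  interlaced (fun t x => pr P (Y t @^-1` `]-oo, x])) (fun x => pr Q (Z @^-1` `]-oo, x])).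
Proof.
move=> YZ x y e xy e0.
have [c [xc cy cc]] := continuity_point_dense xy (le_cdf Q mZ).
have /YZ : {for c, continuous (fun y : R => Q (Z @^-1` `]-oo, y]))}.
  have -> : (fun y : R => Q (Z @^-1` `]-oo, y])) =
      (fun y : R => (pr Q (Z @^-1` `]-oo, y]))%:E).
    by apply/funext => z; rewrite prE//; exact: measurable_le.
  by apply: cvg_EFin => //; exact: nearW.
rewrite prE; last exact: measurable_le.
move=> /fine_cvgP[_ /cvgrPdist_lt /(_ _ e0)]; apply: filterS => t /=.
rewrite -/(pr P (Y t @^-1` `]-oo, c])) ltr_distlC => /andP[h1 h2].
have := le_cdf P (mY t) (ltW xc); have := le_cdf P (mY t) (ltW cy).
have := le_cdf Q mZ (ltW xc); have := le_cdf Q mZ (ltW cy).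
by rewrite /=; split; lra.
Qed.

Lemma interlaced_cvg_in_distribution :
  interlaced (fun t x => pr P (Y t @^-1` `]-oo, x])) (fun x => pr Q (Z @^-1` `]-oo, x])) ->
  cvg_in_distribution P Y Q Z.
Proof.
move=> YZ x cx; rewrite prE; last exact: measurable_le.
apply/fine_cvgP; split.
  by apply: nearW => t; rewrite prE//; exact: measurable_le.
have {}cx : {for x, continuous (fun y : R => pr Q (Z @^-1` `]-oo, y]))}.
  by apply: (@fine_cvg R R (nbhs x)); rewrite -prE//; exact: measurable_le.
apply/cvgrPdist_le => e e0.
have e20 : 0 < e / 2 by rewrite divr_gt0.
move/cvgrPdist_le : (cx) => /(_ _ e20) /nbhs_ballP[r /= r0 xr].
have r20 : 0 < r / 2 by rewrite divr_gt0.
have h1 : ball x r (x + r / 2).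
  by rewrite /ball/= opprD addNKr normrN gtr0_norm// ltr_pdivrMr// ltr_pMr// ltr1n.
have h2 : ball x r (x - r / 2).
  by rewrite /ball/= opprB addrCA subrr addr0 gtr0_norm// ltr_pdivrMr// ltr_pMr// ltr1n.
have {h1} := xr _ h1; have {h2} := xr _ h2.
rewrite !ler_distlC => /andP[h1 h2] /andP[h3 h4].
have := YZ x (x + r / 2) _ _ e20; rewrite ltrDl => /(_ r20).
have := YZ (x - r / 2) x _ _ e20; rewrite gtrBl => /(_ r20).
apply: filterS2 => t [h5 h6] [h7 h8] /=.
rewrite -/(pr P (Y t @^-1` `]-oo, x])) ler_distlC.
by apply/andP; split; lra.
Qed.

End random_elements.
End interlacing.

(** * Expectations of decreasing functions under convergence in distribution *)

Section levels.
Context {R : realType}.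

Lemma count_levels (z : R) m : 0 <= z ->
  let c := \sum_(1 <= j < m.+1) (nat_of_bool (j%:R <= z)%R)%:R in
  c <= z /\ (z <= m.+1%:R -> z <= c + 1).
Proof.
move=> z0 /=.
suff : (m%:R <= z /\ \sum_(1 <= j < m.+1) (nat_of_bool (j%:R <= z)%R)%:R = m%:R :> R) \/
    [/\ z < m%:R, \sum_(1 <= j < m.+1) (nat_of_bool (j%:R <= z)%R)%:R <= z &
        z <= \sum_(1 <= j < m.+1) (nat_of_bool (j%:R <= z)%R)%:R + 1].
  by case=> [[mz ->]|[]] //; split => //; rewrite natr1.
elim: m => [|m IH]; first by left; rewrite big_nil.
rewrite big_nat_recr//=.
have [mz|zm] := leP m.+1%:R z.
  left; split=> //; case: IH => [[_ ->]|[]]; first by rewrite natr1.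
  move=> zm _ _; suff : z < z by rewrite ltxx.
  by apply: lt_le_trans zm (le_trans _ mz); rewrite ler_nat.
right; rewrite addr0; split=> //.
  by case: IH => [[mz ->]|[]].
by case: IH => [[mz ->]|[]]//; rewrite natr1 ltW.
Qed.

Lemma step_approx (x : R) k : 0 <= x <= 1 ->
  k.+1%:R^-1 * \sum_(1 <= j < k.+1) (nat_of_bool (j%:R / k.+1%:R <= x)%R)%:R <= x <=
  k.+1%:R^-1 * \sum_(1 <= j < k.+1) (nat_of_bool (j%:R / k.+1%:R <= x)%R)%:R + k.+1%:R^-1.
Proof.
move=> /andP[x0 x1]; have k0 : 0 < k.+1%:R :> R by rewrite ltr0n.
have [] := @count_levels (x * k.+1%:R) k; first by rewrite mulr_ge0.
rewrite (eq_bigr (fun j : nat => (nat_of_bool (j%:R / k.+1%:R <= x)%R)%:R)); last first.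
  by move=> j _; rewrite ler_pdivrMr.
move=> h1 h2; rewrite ler_pdivrMl// mulrC h1/=.
by rewrite -[X in _ + X]mulr1 -mulrDr ler_pdivlMl// mulrC h2// ler_piMl// ltW.
Qed.

Context {d : measure_display} {T : measurableType d} (P : probability T R).

(** A function with values in [0, 1] is within 1/k of the average of the
    indicators of its superlevel sets at heights j/k, so its expectation is
    controlled by the distribution function when these sets are half-lines. *)
Lemma Ex_levels (h : R -> R) (Y : T -> R) (k : nat) (x : nat -> R) :
  measurable_fun setT h -> (forall y, 0 <= h y <= 1) ->
  measurable_fun setT Y ->
  (forall j, (0 < j < k.+1)%N -> forall y, (j%:R / k.+1%:R <= h y) = (y <= x j)) ->
  k.+1%:R^-1 * \sum_(1 <= j < k.+1) pr P (Y @^-1` `]-oo, x j]) <=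
  \int[P]_w h (Y w) <=
  k.+1%:R^-1 * \sum_(1 <= j < k.+1) pr P (Y @^-1` `]-oo, x j]) + k.+1%:R^-1.
Proof.
move=> mh h01 mY hx; set S := _ * \sum_(1 <= j < k.+1) _.
have k0 : 0 < k.+1%:R :> R by rewrite ltr0n.
pose g w := k.+1%:R^-1 * \sum_(1 <= j < k.+1) (\1_(Y @^-1` `]-oo, x j]) w : R).
have bi j : bounded_measurable (\1_(Y @^-1` `]-oo, x j]) : T -> R).
  by apply: bm_indic; exact: measurable_le.
have bg : bounded_measurable g by apply: bmZ; exact: bm_sum.
have bh : bounded_measurable (fun w => h (Y w)) by exact: bm_comp_unit.
have SE : S = \int[P]_w g w.
  rewrite /g ExZ; last exact: bm_sum.
  rewrite Ex_sum// /S; congr (_ * _); apply: eq_bigr => j _.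
  by rewrite Ex_indic//; exact: measurable_le.
have gh w : g w <= h (Y w) <= g w + k.+1%:R^-1.
  suff -> : g w = k.+1%:R^-1 * \sum_(1 <= j < k.+1) (j%:R / k.+1%:R <= h (Y w))%R%:R.
    exact: step_approx.
  congr (_ * _); rewrite !big_nat; apply: eq_bigr => j jk.
  rewrite indicE hx//.
  by congr ((nat_of_bool _)%:R); apply/idP/idP; rewrite inE/= in_itv.
have bk := @bm_cst _ T R k.+1%:R^-1.
rewrite SE -[X in _ + X](Ex_cst P) -ExD// !Ex_le//.
- by move=> w; case/andP: (gh w).
- exact: bmD.
- by move=> w; case/andP: (gh w).
Qed.
End levels.

Section levels_comparison.
Context {R : realType} {d : measure_display} {T : measurableType d} (P : probability T R).
Context {d' : measure_display} {T' : measurableType d'} (Q : probability T' R).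

(** Level j+1 of Y is compared with level j of Z; the shift of the index costs one
    more 1/k. *)
Lemma Ex_levels_le (h : R -> R) (Y : T -> R) (Z : T' -> R) (k : nat) (x : nat -> R) (e : R) :
  measurable_fun setT h -> (forall y, 0 <= h y <= 1) ->
  measurable_fun setT Y -> measurable_fun setT Z -> 0 <= e ->
  (forall j, (0 < j < k.+1)%N -> forall y, (j%:R / k.+1%:R <= h y) = (y <= x j)) ->
  (forall j, (0 < j < k)%N ->
    pr P (Y @^-1` `]-oo, x j.+1]) <= pr Q (Z @^-1` `]-oo, x j]) + e) ->
  \int[P]_w h (Y w) <= \int[Q]_w h (Z w) + 2 / k.+1%:R + e.
Proof.
move=> mh h01 mY mZ e0 hx YZ.
have k0 : 0 < k.+1%:R :> R by rewrite ltr0n.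
have /andP[_ /le_trans] := Ex_levels P mh h01 mY hx; apply.
have /andP[+ _] := Ex_levels Q mh h01 mZ hx.
set A := \sum_(1 <= j < k.+1) _; set B := \sum_(1 <= j < k.+1) _.
suff AB : B <= 1 + A + k.+1%:R * e.
  move=> h1; have : k.+1%:R^-1 * B <= k.+1%:R^-1 * (1 + A + k.+1%:R * e).
    by rewrite ler_pM2l ?invr_gt0.
  rewrite !mulrDr mulr1 mulKf ?gt_eqF//.
  rewrite (_ : 2 / k.+1%:R = k.+1%:R^-1 + k.+1%:R^-1); last first.
    by rewrite mulrDl mul1r.
  by move: h1; move: (k.+1%:R^-1 * A) (k.+1%:R^-1 * B) (k.+1%:R^-1) => ? ? ?; lra.
rewrite /A /B; case: k {A B} k0 hx YZ => [|k] k0 hx YZ.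
  by rewrite !big_nil addr0 mul1r addr_ge0.
rewrite big_nat_recl//= [in X in _ <= X]big_nat_recr//=.
have h1 : pr P (Y @^-1` `]-oo, x 1%N]) <= 1 by apply: pr_le1; exact: measurable_le.
have h2 : \sum_(1 <= i < k.+1) pr P (Y @^-1` `]-oo, x i.+1]) <=
    \sum_(1 <= i < k.+1) pr Q (Z @^-1` `]-oo, x i]) + k%:R * e.
  rewrite (_ : k%:R * e = \sum_(1 <= i < k.+1) e).
    rewrite -big_split/= !big_nat; apply: ler_sum => j jk; exact: YZ.
  by rewrite sumr_const_nat subn1/= mulr_natl.
have h3 := pr_ge0 Q (Z @^-1` `]-oo, x k.+1]).
have h4 : k%:R * e <= k.+2%:R * e by rewrite ler_wpM2r// ler_nat ltnW// ltnW.
by lra.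
Qed.

End levels_comparison.

(** Shared by continuous functions that decrease strictly from 1 to 0 on [0, +oo[ and
    are extended by 1 to the left; the level sets are then half-lines, whose
    probabilities are values of a distribution function. *)
Definition half_line_levels {R : realType} (h : R -> R) := forall u, 0 < u < 1 ->
  exists2 x, h x = u & forall y, (u <= h y) = (y <= x).

Lemma half_line_levels_mono {R : realType} (h : R -> R) u v x y :
  (forall z, (u <= h z) = (z <= x)) -> (forall z, (v <= h z) = (z <= y)) ->
  u < v -> h x = u -> y < x.
Proof.
move=> hu hv uv hx; rewrite lt_neqAle -hu (le_trans (ltW uv)) ?hv// andbT.
by apply/eqP => yx; move: (hv x); rewrite hx yx lexx leNgt uv.
Qed.

Lemma near_ltn {T : Type} (F : set_system T) (FF : Filter F) (Q : nat -> T -> Prop) m :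
  (forall j, (j < m)%N -> \forall t \near F, Q j t) ->
  \forall t \near F, forall j, (j < m)%N -> Q j t.
Proof.
elim: m => [|m IH] h; first exact: nearW.
have := IH (fun j jm => h j (ltnW jm)); have := h m (ltnSn m).
apply: filterS2 => t hm hj j; rewrite ltnS leq_eqVlt => /predU1P[->|]//.
exact: hj.
Qed.

Section cdf_limits.
Context {R : realType} {d : measure_display} {T : measurableType d} (Q : probability T R).

Lemma cdf_right_small (e : R) (Z : T -> R) : 0 < e -> measurable_fun setT Z ->
  pr Q (Z @^-1` `]-oo, 0]) = 0 ->
  exists2 a, 0 < a & pr Q (Z @^-1` `]-oo, a]) <= e.
Proof.
move=> e0 mZ Z0.
pose Zr : {RV Q >-> R} := HB.pack Z (@isMeasurableFun.Build _ _ _ _ Z mZ).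
have := @cdf_right_continuous _ _ _ Q Zr 0.
rewrite [X in _ --> X -> _](prE Q (measurable_le 0 mZ)) Z0.
move=> /fine_cvgP[_ /cvgrPdist_le/(_ _ e0)] h.
near (0:R)^'+ => a; exists a => //.
have : `|0 - (fine \o cdf Zr) a| <= e by near: a.
by rewrite sub0r normrN ger0_norm//=; exact: pr_ge0.
Unshelve. all: by end_near. Qed.

Lemma cdf_left_large (e : R) (Z : T -> R) : 0 < e -> measurable_fun setT Z ->
  exists b, 1 - e <= pr Q (Z @^-1` `]-oo, b]).
Proof.
move=> e0 mZ.
pose Zr : {RV Q >-> R} := HB.pack Z (@isMeasurableFun.Build _ _ _ _ Z mZ).
have /cvgrPdist_le/(_ _ e0) h : (fine \o cdf Zr) x @[x --> +oo] --> (1:R)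
  by exact: fine_cvg (cvg_cdfy1 Zr).
near (pinfty_nbhs R) => b; exists b.
have : `|1 - (fine \o cdf Zr) b| <= e by near: b.
by rewrite ler_norml => /andP[_]; rewrite lerBlDr addrC -lerBlDr.
Unshelve. all: by end_near. Qed.
End cdf_limits.

Section interlaced_expectation.
Context {R : realType} {d : measure_display} {T : measurableType d} (P : probability T R).
Context {d' : measure_display} {T' : measurableType d'} (Q : probability T' R).
Variables (Y : R -> T -> R) (Z : T' -> R).
Hypothesis mY : forall t, measurable_fun setT (Y t).
Hypothesis mZ : measurable_fun setT Z.
Hypothesis YZ : interlaced (fun t x => pr P (Y t @^-1` `]-oo, x]))
                           (fun x => pr Q (Z @^-1` `]-oo, x])).

(** The level sets of h at the heights j/k are half-lines with endpoints that decrease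
    strictly with j, so that interlacing can be applied at consecutive endpoints. *)
Lemma interlaced_Ex (h : R -> R) :
  measurable_fun setT h -> (forall y, 0 <= h y <= 1) -> half_line_levels h ->
  \int[P]_w h (Y t w) @[t --> +oo] --> \int[Q]_w h (Z w).
Proof.
move=> mh h01 hlev; apply/cvgrPdist_le => e e0.
have e20 : 0 < e / 2 by rewrite divr_gt0.
pose k := Num.truncn (4 / e).
have k0 : 0 < k.+1%:R :> R by rewrite ltr0n.
have ke : 2 / k.+1%:R <= e / 2.
  rewrite ler_pdivrMr// mulrAC ler_pdivlMr// -ler_pdivrMl// mulrC -natrM.
  by rewrite ltW// truncnS_gt.
have /choice[x hx] : forall j, exists x : R, (0 < j < k.+1)%N ->
    h x = j%:R / k.+1%:R /\ forall y, (j%:R / k.+1%:R <= h y) = (y <= x).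
  move=> j.
  have [jk|_] := boolP (0 < j < k.+1)%N; last by exists 0.
  have [|x hx1 hx2] := hlev (j%:R / k.+1%:R); last by exists x.
  case/andP: jk => j0 jk.
  by rewrite divr_gt0 ?ltr0n//= ltr_pdivrMr// mul1r ltr_nat.
have xx j : (0 < j < k)%N -> x j.+1 < x j.
  move=> /andP[j0 jk]; have [] := hx j; first by rewrite j0 ltnW.
  have [] := hx j.+1; first by rewrite /= ltnS.
  move=> _ h2 h3 h1; apply: half_line_levels_mono h1 h2 _ h3.
  by rewrite ltr_pM2r ?invr_gt0// ltr_nat.
have : \forall t \near +oo, forall j, (j < k)%N -> (0 < j)%N ->
    pr P (Y t @^-1` `]-oo, x j.+1]) <= pr Q (Z @^-1` `]-oo, x j]) + e / 2 /\
    pr Q (Z @^-1` `]-oo, x j.+1]) <= pr P (Y t @^-1` `]-oo, x j]) + e / 2.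
  apply: near_ltn => j jk; have [j0|j0] := ltnP 0 j.
    have jk' : (0 < j < k)%N by rewrite j0.
    by have := @YZ (x j.+1) (x j) (e / 2) (xx j jk') e20; apply: filterS.
  by apply: nearW.
apply: filterS => t ht.
have := Ex_levels_le mh h01 (mY t) mZ (ltW e20) (fun j jk => (hx j jk).2).
have := Ex_levels_le mh h01 mZ (mY t) (ltW e20) (fun j jk => (hx j jk).2).
move=> /(_ Q P) h1 /(_ P Q) h2.
have {}h1 := h1 (fun j jk => (ht j (proj2 (andP jk)) (proj1 (andP jk))).2).
have {}h2 := h2 (fun j jk => (ht j (proj2 (andP jk)) (proj1 (andP jk))).1).
move: ke h1 h2; rewrite ler_distlC; move: (2 / k.+1%:R) => a ke h1 h2.
by apply/andP; split; lra.
Qed.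

(** Only the values of h_t on compact subintervals of the open half-line matter,
    because the limit gives no mass to the non-positive reals. *)
Lemma interlaced_Ex_locally_uniform (h_ : R -> R -> R) (h : R -> R) :
  pr Q (Z @^-1` `]-oo, 0]) = 0 ->
  (forall t, measurable_fun setT (h_ t)) -> (forall t y, 0 <= h_ t y <= 1) ->
  measurable_fun setT h -> (forall y, 0 <= h y <= 1) -> half_line_levels h ->
  (forall a b e, 0 < a -> 0 < e -> \forall t \near +oo, forall y, a <= y <= b ->
    `|h_ t y - h y| <= e) ->
  \int[P]_w h_ t (Y t w) @[t --> +oo] --> \int[Q]_w h (Z w).
Proof.
move=> Z0 mh_ h_01 mh h01 hlev hcvg; apply/cvgrPdist_le => e e0.
have e60 : 0 < e / 6 by rewrite divr_gt0.
have [a a0 Za] := cdf_right_small e60 mZ Z0.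
have [b Zb] := cdf_left_large Q e60 mZ.
have a20 : 0 < a / 2 by rewrite divr_gt0.
have lo : \forall t \near +oo, pr P (Y t @^-1` `]-oo, a / 2]) <= 2 * (e / 6).
  have := @YZ (a / 2) a (e / 6); rewrite gtr_pMr// invf_lt1// ltr1n.
  move=> /(_ isT e60); apply: filterS => t [] h1 _; rewrite (le_trans h1)//.
  by rewrite mulr_natl mulr2n lerD2r.
have hi : \forall t \near +oo, 1 - 2 * (e / 6) <= pr P (Y t @^-1` `]-oo, b + 1]).
  have := @YZ b (b + 1) (e / 6); rewrite ltrDl ltr01.
  by move=> /(_ isT e60); apply: filterS => t [] _ h1; lra.
have mid := hcvg (a / 2) (b + 1) _ a20 e60.
have /cvgrPdist_le/(_ _ e60) lim := interlaced_Ex mh h01 hlev.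
near=> t.
pose A := (Y t @^-1` `]-oo, a / 2]) `|` ~` (Y t @^-1` `]-oo, b + 1]).
have mA : measurable A.
  by apply: measurableU; [|apply: measurableC]; exact: measurable_le.
have PA : pr P A <= 4 * (e / 6).
  apply: (le_trans (prU _ _ _)); [exact: measurable_le|apply: measurableC; exact: measurable_le|].
  rewrite prC; last exact: measurable_le.
  have h1 : pr P (Y t @^-1` `]-oo, a / 2]) <= 2 * (e / 6) by near: t.
  have h2 : 1 - 2 * (e / 6) <= pr P (Y t @^-1` `]-oo, b + 1]) by near: t.
  by lra.
have bh_ : bounded_measurable (fun w => h_ t (Y t w)) by exact: bm_comp_unit.
have bh : bounded_measurable (fun w => h (Y t w)) by exact: bm_comp_unit.
have be := @bm_cst _ T R (e / 6).
have bA := @bm_indic _ T R _ mA.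
have hmid : forall y, a / 2 <= y <= b + 1 -> `|h_ t y - h y| <= e / 6 by near: t.
have hh w : `|h_ t (Y t w) - h (Y t w)| <= e / 6 + \1_A w.
  rewrite indicE; case: (boolP (w \in A)) => wA /=.
    rewrite ler_norml; have /andP[? ?] := h_01 t (Y t w); have /andP[? ?] := h01 (Y t w).
    by apply/andP; split; lra.
  rewrite addr0 hmid//; move: wA; rewrite notin_setE /A/= !in_itv/= => wA.
  apply/andP; split; first by rewrite leNgt; apply/negP => /ltW ?; apply: wA; left.
  by apply: contrapT => ?; apply: wA; right.
have d1 : \int[P]_w h_ t (Y t w) <= \int[P]_w h (Y t w) + (e / 6 + pr P A).
  rewrite -(Ex_indic P mA) -{1}(Ex_cst P (e / 6)) -!ExD//; last exact: bmD.
  apply: Ex_le => //; first by apply: bmD => //; exact: bmD.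
  by move=> w; have := hh w; rewrite ler_norml => /andP[_]; lra.
have d2 : \int[P]_w h (Y t w) <= \int[P]_w h_ t (Y t w) + (e / 6 + pr P A).
  rewrite -(Ex_indic P mA) -{1}(Ex_cst P (e / 6)) -!ExD//; last exact: bmD.
  apply: Ex_le => //; first by apply: bmD => //; exact: bmD.
  by move=> w; have := hh w; rewrite ler_norml => /andP[+ _]; lra.
have d3 : `|\int[Q]_w h (Z w) - \int[P]_w h (Y t w)| <= e / 6 by near: t.
move: d3; rewrite !ler_norml => /andP[? ?]; apply/andP; split; lra.
Unshelve. all: by end_near. Qed.

End interlaced_expectation.

(** * Laplace transforms *)

Section separating_polynomial.
Context {R : realType}.

Lemma bernoulli_inequality (x : R) n : -1 <= x -> 1 + n%:R * x <= (1 + x) ^+ n.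
Proof.
move=> x1; elim: n => [|n IH]; first by rewrite mul0r addr0 expr0.
rewrite exprS; apply: (@le_trans _ _ ((1 + x) * (1 + n%:R * x))).
  rewrite -subr_ge0 (_ : _ - _ = n%:R * x ^+ 2); last by rewrite -natr1; ring.
  by rewrite mulr_ge0// sqr_ge0.
by rewrite ler_wpM2l//; lra.
Qed.

Lemma expr_1B_le (x : R) n : 0 <= x <= 1 -> (1 - x) ^+ n <= (1 + n%:R * x)^-1.
Proof.
move=> /andP[x0 x1].
have nx : 0 < 1 + n%:R * x by rewrite ltr_pwDl// mulr_ge0.
rewrite -[leRHS]mul1r ler_pdivlMr//.
apply: (@le_trans _ _ ((1 - x) ^+ n * (1 + x) ^+ n)).
  rewrite ler_wpM2l//; first by rewrite exprn_ge0// subr_ge0.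
  by apply: bernoulli_inequality; lra.
rewrite -exprMn exprn_ile1//; nra.
Qed.

(** With v = 2 ^ (- w / z), the polynomial 1 - (1 - v ^ m) ^ (2 ^ m) tends to 1
    when v > 1/2, that is w < z, and to 0 when v < 1/2, that is w > z. *)
Lemma separating_poly (y x e : R) : y < x -> 0 < x -> 0 < e ->
  exists (p : {poly R}) (s : R), 0 < s /\ forall w, 0 <= w ->
    (w <= y)%R%:R - e <= p.[expR (- (s * w))] <= (w <= x)%R%:R + e.
Proof.
move=> yx x0 e0.
pose z := (Num.max y 0 + x) / 2.
have yz : y < z.
  by rewrite /z; case: (leP y 0) => ?; lra.
have zx : z < x.
  by rewrite /z; case: (leP y 0) => ?; lra.
have z0 : 0 < z.
  by rewrite /z; case: (leP y 0) => ?; lra.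
pose s := ln 2 / z.
have ln20 : 0 < ln 2 :> R by rewrite ln_gt0// ltr1n.
have s0 : 0 < s by rewrite divr_gt0.
pose c := Num.min (s * (z - y)) (s * (x - z)).
have c0 : 0 < c by rewrite lt_min; apply/andP; split; rewrite mulr_gt0// subr_gt0.
pose m := (Num.truncn (c * e)^-1).+1.
have me : (1 + m%:R * c)^-1 <= e.
  rewrite invf_ple ?posrE//; last by rewrite ltr_pwDl// mulr_ge0// ltW.
  rewrite -lerBlDl (@le_trans _ _ e^-1)//; first by rewrite gerBl.
  by rewrite -ler_pdivrMr// -invfM mulrC ltW// truncnS_gt.
exists (1 - (1 - 'X^m) ^+ (2 ^ m)), s; split => // w w0.
rewrite !hornerE /=.
set v := expR _.
have v0 : 0 <= v ^+ m by rewrite exprn_ge0// expR_ge0.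
have v1 : v ^+ m <= 1.
  by rewrite exprn_ile1 ?expR_ge0// -expR0 ler_expR oppr_le0 mulr_ge0// ltW.
have vE : (2 ^ m)%:R * v ^+ m = expR (m%:R * (s * (z - w))).
  rewrite natrX -exprMn expRM_natl; congr (_ ^+ _).
  rewrite /v -{1}(@lnK R 2) ?posrE// -expRD; congr expR.
  by rewrite mulrBr /s divfK ?gt_eqF.
have st0 : 0 <= (1 - v ^+ m) ^+ (2 ^ m) <= 1.
  rewrite exprn_ge0 ?subr_ge0//=.
  by rewrite exprn_ile1// ?subr_ge0// gerBl.
have wy : w <= y -> (1 - v ^+ m) ^+ (2 ^ m) <= e.
  move=> wy; apply: (le_trans (expr_1B_le _ _)); first by rewrite v0.
  apply: le_trans me; rewrite lef_pV2 ?posrE ?ltr_pwDl ?mulr_ge0 ?(ltW c0)//.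
  rewrite lerD2l vE; apply: le_trans (expR_ge1Dx _).
  rewrite -[leLHS]add0r lerD// ler_wpM2l//.
  by apply: (@le_trans _ _ (s * (z - y))); rewrite ?ge_min ?lexx// ler_pM2l// lerB.
have xw : x < w -> 1 - (1 - v ^+ m) ^+ (2 ^ m) <= e.
  move=> xw; apply: (@le_trans _ _ ((2 ^ m)%:R * v ^+ m)).
    rewrite lerBlDr -lerBlDl; have := @bernoulli_inequality (- v ^+ m) (2 ^ m).
    by rewrite mulrN; apply; rewrite lerN2.
  apply: le_trans me; rewrite vE -[leLHS]invrK lef_pV2 ?posrE ?invr_gt0 ?expR_gt0//; last first.
    by rewrite ltr_pwDl// mulr_ge0// ltW.
  rewrite -expRN; apply: le_trans (expR_ge1Dx _).
  rewrite lerD2l -mulrN ler_wpM2l//.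
  apply: (@le_trans _ _ (s * (x - z))); first by rewrite ge_min lexx orbT.
  have -> : - (s * (z - w)) = s * (w - z) by ring.
  by rewrite ler_pM2l// lerB// ltW.
move: (1 - v ^+ m) wy xw st0 => q wy xw st0; move: (q ^+ (2 ^ m)) wy xw st0.
move=> {}q wy xw /andP[q0 q1]; clear -wy xw q0 q1 e0 yx.
have [wy'|wy'] := leP w y; have [xw'|xw'] := leP w x => /=; try lra.
Qed.

End separating_polynomial.

Section laplace.
Context {R : realType} {d : measure_display} {T : measurableType d} (P : probability T R).

Lemma measurable_laplace (W : T -> R) r : measurable_fun setT W ->
  measurable_fun setT (fun w => expR (- (r * W w))).
Proof.
move=> mW; apply: measurableT_comp => //.
by apply: measurableT_comp => //; exact: measurable_funM.
Qed.

Lemma bm_laplace (W : T -> R) r : measurable_fun setT W -> (forall w, 0 <= W w) ->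
  0 <= r -> bounded_measurable (fun w => expR (- (r * W w))).
Proof.
move=> mW W0 r0; apply: bm_unit => [|w]; first exact: measurable_laplace.
by rewrite expRN01// mulr_ge0.
Qed.

(** The weight V serves to compare joint laws; V = 1 gives distribution functions. *)
Lemma Ex_horner (V W : T -> R) (p : {poly R}) s :
  bounded_measurable V -> measurable_fun setT W -> (forall w, 0 <= W w) -> 0 < s ->
  \int[P]_w (V w * p.[expR (- (s * W w))]) =
  \sum_(i < size p) p`_i * \int[P]_w (V w * expR (- (i%:R * s * W w))).
Proof.
move=> bV mW W0 s0.
have b i : bounded_measurable (fun w => V w * expR (- (i%:R * s * W w))).
  by apply: bmM => //; apply: bm_laplace => //; rewrite mulr_ge0// ltW.
transitivity (\int[P]_w
    (\sum_(i < size p) p`_i * (V w * expR (- (i%:R * s * W w))))).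
  apply: eq_Rintegral => w _; rewrite horner_coef mulr_sumr.
  apply: eq_bigr => i _; rewrite mulrCA -expRM_natl.
  by congr (_ * (_ * expR _)); rewrite mulrN mulrA.
rewrite Ex_sum => [|i]; last exact: bmZ.
by apply: eq_bigr => i _; rewrite ExZ.
Qed.

Lemma bm_horner (W : T -> R) (p : {poly R}) s : measurable_fun setT W ->
  (forall w, 0 <= W w) -> 0 < s ->
  bounded_measurable (fun w => p.[expR (- (s * W w))]).
Proof.
move=> mW W0 s0; under eq_fun do rewrite horner_coef.
by apply: bm_sum => i; apply: bmZ; apply: bmX; apply: bm_laplace => //; exact: ltW.
Qed.

Lemma indic_leE (W : T -> R) x w : \1_(W @^-1` `]-oo, x]) w = (W w <= x)%R%:R :> R.
Proof.
by rewrite indicE; congr ((nat_of_bool _)%:R); apply/idP/idP; rewrite inE/= in_itv.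
Qed.

Lemma Ex_horner_sandwich (V W : T -> R) (p : {poly R}) (s y x e : R) :
  measurable_fun setT V -> (forall w, 0 <= V w <= 1) ->
  measurable_fun setT W -> (forall w, 0 <= W w) -> 0 < s -> 0 <= e ->
  (forall w, 0 <= w -> (w <= y)%R%:R - e <= p.[expR (- (s * w))] <= (w <= x)%R%:R + e) ->
  \int[P]_w (V w * \1_(W @^-1` `]-oo, y]) w) - e <=
  \int[P]_w (V w * p.[expR (- (s * W w))]) <=
  \int[P]_w (V w * \1_(W @^-1` `]-oo, x]) w) + e.
Proof.
move=> mV V01 mW W0 s0 e0 hp.
have bV : bounded_measurable V by exact: bm_unit.
have b1 z : bounded_measurable (fun w => V w * \1_(W @^-1` `]-oo, z]) w).
  by apply: bmM => //; apply: bm_indic; exact: measurable_le.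
have be := @bm_cst _ T R e.
have bp : bounded_measurable (fun w => V w * p.[expR (- (s * W w))]).
  by apply: bmM => //; exact: bm_horner.
rewrite -{1 2}(Ex_cst P e) -ExB// -ExD// !Ex_le//=.
- by apply: bmB.
- move=> w; rewrite indic_leE; have /andP[v0 v1] := V01 w.
  have /andP[h1 _] := hp _ (W0 w).
  apply: le_trans (ler_wpM2l v0 h1); rewrite mulrBr lerB//.
  by rewrite ler_piMl.
- by apply: bmD.
- move=> w; rewrite indic_leE; have /andP[v0 v1] := V01 w.
  have /andP[_ h1] := hp _ (W0 w).
  apply: (le_trans (ler_wpM2l v0 h1)); rewrite mulrDr lerD//.
  by rewrite ler_piMl.
Qed.

Lemma cdf_horner_sandwich (W : T -> R) (p : {poly R}) (s y x e : R) :
  measurable_fun setT W -> (forall w, 0 <= W w) -> 0 < s -> 0 <= e ->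
  (forall w, 0 <= w -> (w <= y)%R%:R - e <= p.[expR (- (s * w))] <= (w <= x)%R%:R + e) ->
  pr P (W @^-1` `]-oo, y]) - e <= \int[P]_w p.[expR (- (s * W w))] <=
  pr P (W @^-1` `]-oo, x]) + e.
Proof.
move=> mW W0 s0 e0 /(@Ex_horner_sandwich (fun=> 1) W p s y x e).
rewrite -!Ex_indic; [|exact: measurable_le|exact: measurable_le].
have E1 (f : T -> R) : \int[P]_w (1 * f w) = \int[P]_w f w.
  by apply: eq_Rintegral => ? _; rewrite mul1r.
rewrite !E1.
by apply => //; move=> w; rewrite ler01 lexx.
Qed.

Lemma Ex_horner1 (W : T -> R) (p : {poly R}) s :
  measurable_fun setT W -> (forall w, 0 <= W w) -> 0 < s ->
  \int[P]_w p.[expR (- (s * W w))] =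
  \sum_(i < size p) p`_i * \int[P]_w expR (- (i%:R * s * W w)).
Proof.
move=> mW W0 s0; have := @Ex_horner (fun=> 1) W p s (bm_cst 1) mW W0 s0.
under eq_Rintegral do rewrite mul1r.
by move=> ->; apply: eq_bigr => i _; under eq_Rintegral do rewrite mul1r.
Qed.

Lemma cvg_Ex_horner (W : R -> T -> R) (L : R -> R) (p : {poly R}) s :
  (forall t, measurable_fun setT (W t)) -> (forall t w, 0 <= W t w) ->
  (forall r, 0 <= r -> \int[P]_w expR (- (r * W t w)) @[t --> +oo] --> L r) ->
  0 < s ->
  \int[P]_w p.[expR (- (s * W t w))] @[t --> +oo] -->
    \sum_(i < size p) p`_i * L (i%:R * s).
Proof.
move=> mW W0 WL s0.
under eq_fun do rewrite Ex_horner1//.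
apply: cvg_big => [|i _]; first exact: add_continuous.
by apply: cvgMr; apply: WL; rewrite mulr_ge0// ltW.
Qed.

Lemma pr_lt0 (W : T -> R) y : (forall w, 0 <= W w) -> y < 0 ->
  pr P (W @^-1` `]-oo, y]) = 0.
Proof.
move=> W0 y0; rewrite (_ : _ @^-1` _ = set0) ?/pr ?measure0//.
by apply/seteqP; split => // w /=; rewrite in_itv/= leNgt (lt_le_trans y0).
Qed.

(** The constant c is the limit of the expectation of a separating polynomial in
    exp (- s W_t), a linear combination of the numbers L (i s); it lies between the
    distribution functions at y and at x up to e. *)
Lemma laplace_cvg_cdf (W : R -> T -> R) (L : R -> R) :
  (forall t, measurable_fun setT (W t)) -> (forall t w, 0 <= W t w) ->
  (forall r, 0 <= r -> \int[P]_w expR (- (r * W t w)) @[t --> +oo] --> L r) ->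
  forall y x e, y < x -> 0 < e -> exists c, \forall t \near +oo,
    pr P (W t @^-1` `]-oo, y]) <= c + e /\ c - e <= pr P (W t @^-1` `]-oo, x]).
Proof.
move=> mW W0 WL y x e yx e0; have [x0|x0] := leP x 0.
  exists 0; apply: nearW => t; rewrite pr_lt0 ?(lt_le_trans yx)// add0r sub0r.
  by split; [exact: ltW|rewrite (@le_trans _ _ 0) ?pr_ge0// oppr_le0 ltW].
have e20 : 0 < e / 2 by rewrite divr_gt0.
have [p [s [s0 hp]]] := separating_poly yx x0 e20.
exists (\sum_(i < size p) p`_i * L (i%:R * s)).
have /cvgrPdist_le/(_ _ e20) := @cvg_Ex_horner W L p s mW W0 WL s0.
apply: filterS => t; rewrite ler_distlC => /andP[h1 h2].
have /andP[h3 h4] := cdf_horner_sandwich (mW t) (W0 t) s0 (ltW e20) hp.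
by split; lra.
Qed.

End laplace.

Section laplace_continuity.
Context {R : realType} {d : measure_display} {T : measurableType d} (P : probability T R).
Context {d' : measure_display} {T' : measurableType d'} (Q : probability T' R).

Lemma laplace_cvg_interlaced (W : R -> T -> R) (V : T' -> R) :
  (forall t, measurable_fun setT (W t)) -> (forall t w, 0 <= W t w) ->
  measurable_fun setT V -> (forall w, 0 <= V w) ->
  (forall r, 0 < r -> \int[P]_w expR (- (r * W t w)) @[t --> +oo] -->
                       \int[Q]_w expR (- (r * V w))) ->
  interlaced (fun t x => pr P (W t @^-1` `]-oo, x])) (fun x => pr Q (V @^-1` `]-oo, x])).
Proof.
move=> mW W0 mV V0 WV y x e yx e0; have [x0|x0] := leP x 0.
  have y0 := lt_le_trans yx x0.
  apply: nearW => t; rewrite !(pr_lt0 _ _ y0)//.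
  by split; rewrite addr_ge0 ?pr_ge0// ltW.
have e30 : 0 < e / 3 by rewrite divr_gt0.
have [p [s [s0 hp]]] := separating_poly yx x0 e30.
have WL r : 0 <= r -> \int[P]_w expR (- (r * W t w)) @[t --> +oo] -->
                       \int[Q]_w expR (- (r * V w)).
  rewrite le_eqVlt => /predU1P[<-|]; last exact: WV.
  rewrite (_ : (fun t => \int[P]_w expR (- (0 * W t w))) = fun=> 1); last first.
    apply/funext => t; rewrite -[RHS](Ex_cst P 1).
    by apply: eq_Rintegral => w _; rewrite mul0r oppr0 expR0.
  rewrite [X in _ --> X](_ : _ = 1); first exact: cvg_cst.
  rewrite -[RHS](Ex_cst Q 1).
  by apply: eq_Rintegral => w _; rewrite mul0r oppr0 expR0.
have /cvgrPdist_le/(_ _ e30) := @cvg_Ex_horner _ _ _ P W _ p s mW W0 WL s0.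
rewrite -Ex_horner1//.
apply: filterS => t; rewrite ler_distlC => /andP[h1 h2].
have /andP[h3 h4] := cdf_horner_sandwich P (mW t) (W0 t) s0 (ltW e30) hp.
have /andP[h5 h6] := cdf_horner_sandwich Q mV V0 s0 (ltW e30) hp.
by split; lra.
Qed.

End laplace_continuity.

Section laplace_uniqueness.
Context {R : realType} {d : measure_display} {T : measurableType d} (P : probability T R).

(** The indicator of W <= x is replaced by a polynomial in exp (- s W), whose weighted
    expectations agree; the threshold x + 1/n that this introduces tends to x. *)
Lemma weighted_laplace_le (V V' W : T -> R) x :
  measurable_fun setT V -> (forall w, 0 <= V w <= 1) ->
  measurable_fun setT V' -> (forall w, 0 <= V' w <= 1) ->
  measurable_fun setT W -> (forall w, 0 <= W w) ->
  (forall s, 0 <= s -> \int[P]_w (V w * expR (- (s * W w))) =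
                       \int[P]_w (V' w * expR (- (s * W w)))) ->
  \int[P]_w (V w * \1_(W @^-1` `]-oo, x]) w) <= \int[P]_w (V' w * \1_(W @^-1` `]-oo, x]) w).
Proof.
move=> mV V01 mV' V'01 mW W0 VV'.
have [x0|x0] := ltP x 0.
  suff z (f : T -> R) : \int[P]_w (f w * \1_(W @^-1` `]-oo, x]) w) = 0 by rewrite !z.
  rewrite -[RHS](Ex_cst P 0); apply: eq_Rintegral => w _.
  by rewrite indic_leE leNgt (lt_le_trans x0)// mulr0.
pose u n := x + n.+1%:R^-1.
have u1 n : \int[P]_w (V w * \1_(W @^-1` `]-oo, x]) w) <=
    \int[P]_w (V' w * \1_(W @^-1` `]-oo, u n]) w) + 2 * n.+1%:R^-1.
  have n0 : 0 < n.+1%:R^-1 :> R by rewrite invr_gt0.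
  have xu : x < u n by rewrite ltrDl.
  have [p [s [s0 hp]]] := separating_poly xu (le_lt_trans x0 xu) n0.
  have /andP[+ _] := Ex_horner_sandwich P mV V01 mW W0 s0 (ltW n0) hp.
  have /andP[_ +] := Ex_horner_sandwich P mV' V'01 mW W0 s0 (ltW n0) hp.
  rewrite !Ex_horner//; [|exact: bm_unit|exact: bm_unit].
  have -> : \sum_(i < size p) p`_i * \int[P]_w (V w * expR (- (i%:R * s * W w))) =
      \sum_(i < size p) p`_i * \int[P]_w (V' w * expR (- (i%:R * s * W w))).
    by apply: eq_bigr => i _; rewrite VV'// mulr_ge0// ltW.
  move: (\sum_(_ < _) _) => S; move: n.+1%:R^-1 => e; lra.
suff : \int[P]_w (V' w * \1_(W @^-1` `]-oo, u n]) w) + 2 * n.+1%:R^-1 @[n --> \oo] -->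
    \int[P]_w (V' w * \1_(W @^-1` `]-oo, x]) w) + 2 * 0.
  rewrite mulr0 addr0 => h.
  rewrite -(cvg_lim _ h)//; apply: limr_ge; first by apply/cvg_ex; eexists; exact: h.
  exact: nearW.
apply: cvgD; last by apply: cvgMr; exact: cvg_harmonic.
apply: (@Ex_dct _ _ _ P _ _ 1 setT) => //.
- by move=> n; apply: measurable_funM => //; apply: measurable_indic; exact: measurable_le.
- by apply: measurable_funM => //; apply: measurable_indic; exact: measurable_le.
- exact: prT.
- by move=> n w; apply: norm01; apply: mulr01; [exact: V'01|exact: indic01].
move=> w _; apply: cvgMr.
have [Wx|xW] := leP (W w) x.
  apply: cvg_near_cst; apply: nearW => n.
  by rewrite !indic_leE Wx (le_trans Wx)// lerDl.
apply: cvg_near_cst; have Wx : 0 < W w - x by rewrite subr_gt0.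
near=> n; rewrite !indic_leE !leNgt xW/= (_ : u n < W w)//.
rewrite /u -ltrBrDl; near: n.
have /cvgrPdist_lt/(_ _ Wx) := @cvg_harmonic R.
by apply: filterS => n /=; rewrite sub0r normrN ger0_norm ?invr_ge0 ?ler0n.
Unshelve. all: by end_near. Qed.

Lemma weighted_laplace_eq (V V' W : T -> R) x :
  measurable_fun setT V -> (forall w, 0 <= V w <= 1) ->
  measurable_fun setT V' -> (forall w, 0 <= V' w <= 1) ->
  measurable_fun setT W -> (forall w, 0 <= W w) ->
  (forall s, 0 <= s -> \int[P]_w (V w * expR (- (s * W w))) =
                       \int[P]_w (V' w * expR (- (s * W w)))) ->
  \int[P]_w (V w * \1_(W @^-1` `]-oo, x]) w) = \int[P]_w (V' w * \1_(W @^-1` `]-oo, x]) w).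
Proof.
move=> mV V01 mV' V'01 mW W0 VV'; apply/eqP; rewrite eq_le.
by rewrite !weighted_laplace_le// => s s0; rewrite VV'.
Qed.

End laplace_uniqueness.

(** * Independence *)

Section independent_product.
Context {R : realType} {d : measure_display} {T : measurableType d} (P : probability T R).

(** A product rule known for the indicators of the events Y \in B extends to
    the expectations of g(Y), since g is a uniform limit of averages of such
    indicators. *)
Lemma Ex_product_rule (V Y : T -> R) (g : R -> R) (K : R) :
  measurable_fun setT V -> (forall w, 0 <= V w <= 1) -> measurable_fun setT Y ->
  measurable_fun setT g -> (forall y, 0 <= g y <= 1) -> 0 <= K ->
  (forall B, measurable B ->
    \int[P]_w (V w * \1_B (Y w)) = K * \int[P]_w \1_B (Y w)) ->
  \int[P]_w (V w * g (Y w)) = K * \int[P]_w g (Y w).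
Proof.
move=> mV V01 mY mg g01 K0 VB.
have bV : bounded_measurable V by exact: bm_unit.
have bg : bounded_measurable (fun w => g (Y w)) by exact: bm_comp_unit.
pose B (k j : nat) : set R := g @^-1` `[j%:R / k.+1%:R, +oo[.
have mB k j : measurable (B k j) by rewrite -[B k j]setTI; exact: mg.
have BE k j y : \1_(B k j) y = (nat_of_bool (j%:R / k.+1%:R <= g y)%R)%:R :> R.
  by rewrite indicE; congr ((nat_of_bool _)%:R); apply/idP/idP; rewrite inE /B/= in_itv/= andbT.
pose gk k y : R := k.+1%:R^-1 * \sum_(1 <= j < k.+1) \1_(B k j) y.
have gkP k y : gk k y <= g y <= gk k y + k.+1%:R^-1.
  rewrite /gk (eq_bigr (fun j => (nat_of_bool (j%:R / k.+1%:R <= g y)%R)%:R)) => [|j _].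
    exact: step_approx.
  exact: BE.
have bB k j : bounded_measurable (fun w => \1_(B k j) (Y w) : R).
  apply: (@bm_comp_unit _ _ _ \1_(B k j)) => //.
  by move=> y; exact: indic01.
have bgk k : bounded_measurable (fun w => gk k (Y w)).
  by apply: bmZ; apply: bm_sum => j.
have Egk k : \int[P]_w (V w * gk k (Y w)) = K * \int[P]_w gk k (Y w).
  transitivity (\int[P]_w (k.+1%:R^-1 * \sum_(1 <= j < k.+1) (V w * \1_(B k j) (Y w)))).
    by apply: eq_Rintegral => w _; rewrite /gk mulrCA mulr_sumr.
  have bVB j : bounded_measurable (fun w => V w * \1_(B k j) (Y w)) by exact: bmM.
  rewrite ExZ; last exact: bm_sum.
  rewrite Ex_sum// /gk ExZ; last exact: bm_sum.
  rewrite Ex_sum// mulrCA; congr (_ * _); rewrite mulr_sumr.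
  by apply: eq_bigr => j _; exact: VB.
have close k : `|\int[P]_w (V w * g (Y w)) - K * \int[P]_w g (Y w)| <= (1 + K) * k.+1%:R^-1.
  have bc := @bm_cst _ T R k.+1%:R^-1.
  have h1 : \int[P]_w (V w * g (Y w)) <= \int[P]_w (V w * gk k (Y w)) + k.+1%:R^-1.
    rewrite -[X in _ + X](Ex_cst P) -ExD//; last exact: bmM.
    apply: Ex_le; [exact: bmM|by apply: bmD => //; exact: bmM|move=> w].
    have /andP[_ h] := gkP k (Y w); have /andP[v0 v1] := V01 w.
    by apply: (le_trans (ler_wpM2l v0 h)); rewrite mulrDr lerD2l ler_piMl.
  have h2 : \int[P]_w (V w * gk k (Y w)) <= \int[P]_w (V w * g (Y w)).
    apply: Ex_le; [exact: bmM|exact: bmM|move=> w].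
    have /andP[h _] := gkP k (Y w); have /andP[v0 v1] := V01 w.
    by rewrite ler_wpM2l.
  have h3 : \int[P]_w g (Y w) <= \int[P]_w gk k (Y w) + k.+1%:R^-1.
    rewrite -[X in _ + X](Ex_cst P) -ExD//.
    by apply: Ex_le => //; [exact: bmD|move=> w; have /andP[]:= gkP k (Y w)].
  have h4 : \int[P]_w gk k (Y w) <= \int[P]_w g (Y w).
    by apply: Ex_le => // w; have /andP[]:= gkP k (Y w).
  have := ler_wpM2l K0 h3; have := ler_wpM2l K0 h4.
  rewrite mulrDr -Egk mulrDl mul1r ler_norml => h5 h6.
  have k0 : 0 <= k.+1%:R^-1 :> R by rewrite invr_ge0.
  have Kk := mulr_ge0 K0 k0.
  move: h1 h2 h5 h6 k0 Kk; move: (K * k.+1%:R^-1) (k.+1%:R^-1) => ? ? *.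
  by apply/andP; split; lra.
apply/eqP; rewrite -subr_eq0 -normr_le0.
have : (1 + K) * k.+1%:R^-1 @[k --> \oo] --> (1 + K) * 0.
  by apply: cvgMr; exact: cvg_harmonic.
rewrite mulr0 => h; rewrite -(cvg_lim _ h)//.
by apply: limr_ge; [apply/cvg_ex; eexists; exact: h|exact: nearW].
Qed.

(** The indicators are exchanged for the functions g one factor at a time, with the
    remaining factors collected in the weight of Ex_product_rule. *)
Lemma Ex_prod_independent (V : T -> R) (X : nat -> T -> R) (g : nat -> R -> R) m :
  measurable_fun setT V -> (forall w, 0 <= V w <= 1) ->
  (forall i, measurable_fun setT (X i)) ->
  (forall i, measurable_fun setT (g i)) -> (forall i y, 0 <= g i y <= 1) ->
  (forall B : nat -> set R, (forall i, measurable (B i)) ->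
    \int[P]_w (V w * \prod_(i < m) \1_(B i) (X i w)) =
    \int[P]_w V w * \prod_(i < m) \int[P]_w \1_(B i) (X i w)) ->
  \int[P]_w (V w * \prod_(i < m) g i (X i w)) =
  \int[P]_w V w * \prod_(i < m) \int[P]_w g i (X i w).
Proof.
move=> mV V01 mX mg g01 VB.
pose G n (B : nat -> set R) i : R -> R := if (i < n)%N then g i else \1_(B i).
have G01 n B i y : 0 <= G n B i y <= 1.
  by rewrite /G; case: ifP => // _; exact: indic01.
have mG n B i : (forall i, measurable (B i)) -> measurable_fun setT (G n B i).
  by move=> mB; rewrite /G; case: ifP => // _; exact: measurable_indic.
suff H n : (n <= m)%N -> forall B : nat -> set R, (forall i, measurable (B i)) ->
    \int[P]_w (V w * \prod_(i < m) G n B i (X i w)) =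
    \int[P]_w V w * \prod_(i < m) \int[P]_w G n B i (X i w).
  have := H m (leqnn m) (fun=> setT) (fun=> measurableT).
  have GE (i : 'I_m) : G m (fun=> setT) i = g i by rewrite /G ltn_ord.
  under eq_Rintegral => w _ do under eq_bigr => i _ do rewrite GE.
  by move=> ->; congr (_ * _); apply: eq_bigr => i _; rewrite GE.
elim: n => [|n IH] nm B mB; first exact: VB.
pose o := Ordinal nm.
have GE i : i != n -> forall C, G n.+1 B i = G n (fun j => if j == n then C else B j) i.
  move=> ni C; rewrite /G ltnS leq_eqVlt (negbTE ni)/=.
  by case: ifP => // _.
pose V' w := V w * \prod_(i < m | i != o) G n.+1 B i (X i w).
have V'01 w : 0 <= V' w <= 1.
  by apply: mulr01 => //; apply: prodr01 => i; exact: G01.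
have bG i : bounded_measurable (fun w => G n.+1 B i (X i w)).
  by apply: bm_comp_unit => //; exact: mG.
have mV' : measurable_fun setT V'.
  have bV' : bounded_measurable V'.
    by apply: bmM; [exact: bm_unit|apply: bm_prod => i; exact: bG].
  by case: bV'.
have GK i : 0 <= \int[P]_w G n.+1 B i (X i w).
  by apply: Ex_ge0 => w; case/andP: (G01 n.+1 B i (X i w)).
pose K := \int[P]_w V w * \prod_(i < m | i != o) \int[P]_w G n.+1 B i (X i w).
transitivity (\int[P]_w (V' w * G n.+1 B o (X o w))).
  by apply: eq_Rintegral => w _; rewrite (bigD1 o)//= [X in V w * X]mulrC mulrA.
rewrite (Ex_product_rule (K := K)) //.
- by rewrite [in RHS](bigD1 o)//= /K [in RHS]mulrCA mulrC.
- exact: mG.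
- by rewrite mulr_ge0//; [apply: Ex_ge0 => w; case/andP: (V01 w)|apply: prodr_ge0].
move=> C mC; pose B' j := if j == n then C else B j.
have mB' j : measurable (B' j) by rewrite /B'; case: ifP.
have := IH (ltnW nm) B' mB'.
rewrite (bigD1 o)//= [G n B' n](_ : _ = \1_C); last by rewrite /G /B' ltnn eqxx.
have Go (i : 'I_m) : i != o -> G n B' i = G n.+1 B i.
  by move=> io; rewrite (GE i _ C)//.
rewrite (eq_bigr (fun i : 'I_m => \int[P]_w G n.+1 B i (X i w))) => [|i io]; last by rewrite Go.
rewrite mulrCA [X in _ = X -> _]mulrC -/K => <-.
apply: eq_Rintegral => w _; rewrite (bigD1 o)//= [G n B' n](_ : _ = \1_C); last by rewrite /G /B' ltnn eqxx.
rewrite (eq_bigr (fun i : 'I_m => G n.+1 B i (X i w))) => [|i io]; last by rewrite Go.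
by rewrite /V' -mulrA; congr (_ * _); rewrite mulrC.
Qed.

(** * A random index *)

Variable N : T -> nat.
Hypothesis mN : forall n, measurable (N @^-1` [set n]).

Lemma measurable_random_index {d'} {T' : measurableType d'} (F : nat -> T -> T') :
  (forall n, measurable_fun setT (F n)) -> measurable_fun setT (fun w => F (N w) w).
Proof.
move=> mF _ B mB; rewrite setTI.
rewrite (_ : _ @^-1` _ = \bigcup_n (N @^-1` [set n] `&` (F n @^-1` B))); last first.
  by apply/seteqP; split => [w Bw|w [n _ [/= <-]]] //; exists (N w).
apply: bigcup_measurable => n _; apply: measurableI => //.
by rewrite -[X in measurable X]setTI; exact: mF.
Qed.

Lemma Ex_partition (Z Z' : T -> R) :
  measurable_fun setT Z -> (forall w, 0 <= Z w <= 1) ->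
  measurable_fun setT Z' -> (forall w, 0 <= Z' w <= 1) ->
  (forall n, \int[P]_w (\1_(N @^-1` [set n]) w * Z w) =
             \int[P]_w (\1_(N @^-1` [set n]) w * Z' w)) ->
  \int[P]_w Z w = \int[P]_w Z' w.
Proof.
move=> mZ Z01 mZ' Z'01 ZZ'.
suff H (Y : T -> R) : measurable_fun setT Y -> (forall w, 0 <= Y w <= 1) ->
    \sum_(0 <= n < m) \int[P]_w (\1_(N @^-1` [set n]) w * Y w) @[m --> \oo] --> \int[P]_w Y w.
  have := H Z' mZ' Z'01; under eq_fun do under eq_bigr do rewrite -ZZ'.
  by move=> h; rewrite -(cvg_lim _ (H Z mZ Z01))// -(cvg_lim _ h).
move=> mY Y01; have bY : bounded_measurable Y by exact: bm_unit.
pose f m w := \sum_(0 <= n < m) (\1_(N @^-1` [set n]) w * Y w).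
have bi n : bounded_measurable (fun w => \1_(N @^-1` [set n]) w * Y w).
  by apply: bmM => //; exact: bm_indic.
rewrite (_ : (fun m => _) = fun m => \int[P]_w f m w); last first.
  by apply/funext => m; rewrite /f Ex_sum.
have fE m w : f m w = (nat_of_bool (N w < m)%N)%:R * Y w.
  rewrite /f -mulr_suml; congr (_ * _).
  rewrite (eq_bigr (fun n => (nat_of_bool (n == N w))%:R)) => [|n _]; last first.
    rewrite indicE; congr ((nat_of_bool _)%:R); apply/idP/idP; rewrite inE/=; first by move=> ->.
    by move=> /eqP.
  rewrite -natr_sum -big_mkcond/= sum1_count; congr (_%:R).
  by rewrite (eq_count (a2 := pred1 (N w)))// count_uniq_mem ?iota_uniq// mem_index_iota.
apply: (@Ex_dct _ _ _ P _ _ 1 setT) => //.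
- by move=> m; have [] := bm_sum (index_iota 0 m) bi.
- exact: prT.
- move=> m w; rewrite fE; apply: norm01; apply: mulr01 => //.
  by case: (_ < _)%N => /=; rewrite ?lexx ?ler01.
move=> w _; apply: cvg_near_cst; exists (N w).+1 => // m /= Nm.
by rewrite fE Nm mul1r.
Qed.

End independent_product.

Section random_sample.
Context {R : realType} {d : measure_display} {T : measurableType d} (P : probability T R).
Variables (Xs : nat -> {RV P >-> R}) (N : {RV P >-> nat}).
Hypothesis Xs_indep : mutually_independent P Xs.
Hypothesis XN_indep : forall A n, generated_sigma_algebra [set: nat] Xs A ->
  P (A `&` N @^-1` [set n]) = (P A * P (N @^-1` [set n]))%E.

Lemma measurable_RV_nat n : measurable (N @^-1` [set n]).
Proof. by rewrite -[X in measurable X]setTI; exact: measurable_funP. Qed.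

Lemma measurable_RV_preimage (Y : {RV P >-> R}) (B : set R) : measurable B ->
  measurable (Y @^-1` B).
Proof. by move=> mB; rewrite -[X in measurable X]setTI; exact: measurable_funP. Qed.

Lemma prod_independent_events (B : nat -> set R) m n : (forall i, measurable (B i)) ->
  \int[P]_w (\1_(N @^-1` [set n]) w * \prod_(i < m) \1_(B i) (Xs i w)) =
  \int[P]_w (\1_(N @^-1` [set n]) w) * \prod_(i < m) \int[P]_w \1_(B i) (Xs i w).
Proof.
move=> mB; pose J := [fset i in iota 0 m]%fset.
have JE i : (i \in J) = (i < m)%N by rewrite !inE/= mem_iota.
pose A := \bigcap_(i in [set` J]) (Xs i @^-1` B i).
have mA : measurable A.
  by apply: bigcap_measurableType => i _; exact: measurable_RV_preimage.
have sA : generated_sigma_algebra [set: nat] Xs A.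
  apply: (@bigcap_measurableType _ (g_sigma_algebraType _)) => i _.
  by apply: sub_sigma_algebra; exists i, (B i); split.
have AE w : \prod_(i < m) \1_(B i) (Xs i w) = \1_A w :> R.
  rewrite [RHS]indicE; have [wA|wA] := boolP (w \in A).
    rewrite big1// => i _; rewrite indicE mem_set//.
    by move/set_mem : wA; apply; rewrite /= JE.
  have [i [im wi]] : exists i, (i < m)%N /\ ~ B i (Xs i w).
    apply: contrapT => h; move/negP: wA; apply; rewrite inE => i /=.
    by rewrite JE => im; apply: contrapT => ?; apply: h; exists i.
  by rewrite (bigD1 (Ordinal im))//= indicE memNset// mul0r.
have -> : \int[P]_w (\1_(N @^-1` [set n]) w * \prod_(i < m) \1_(B i) (Xs i w)) =
    pr P (A `&` N @^-1` [set n]).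
  rewrite -Ex_indic; last by apply: measurableI => //; exact: measurable_RV_nat.
  by apply: eq_Rintegral => w _; rewrite AE setIC indicI.
rewrite /pr XN_indep// fineM ?fin_num_measure//; last exact: measurable_RV_nat.
rewrite mulrC Ex_indic//; last exact: measurable_RV_nat.
congr (_ * _); rewrite /A Xs_indep//.
rewrite (perm_big (iota 0 m))/=; last first.
  by apply: uniq_perm; rewrite ?fset_uniq ?iota_uniq// => i; rewrite JE mem_iota.
rewrite -(big_mkord xpredT (fun i => \int[P]_w \1_(B i) (Xs i w))) /index_iota subn0.
elim: (iota 0 m) => [|i s IH]; first by rewrite !big_nil.
rewrite !big_cons fineM ?IH//.
- by congr (_ * _); rewrite -/(pr P _) -Ex_indic//; exact: measurable_RV_preimage.
- by rewrite fin_num_measure//; exact: measurable_RV_preimage.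
by apply: prode_fin_num => j _; rewrite fin_num_measure//; exact: measurable_RV_preimage.
Qed.

Variable X : {RV P >-> R}.
Hypothesis XsX : forall i, same_distribution (Xs i) X.

(** On the event N = n the product has n factors, which are independent of that event
    and of each other. *)
Lemma Ex_random_product (f : nat -> R -> R) :
  (forall n, measurable_fun setT (f n)) -> (forall n y, 0 <= f n y <= 1) ->
  \int[P]_w \prod_(i < N w) f (N w) (Xs i w) =
  \int[P]_w ((\int[P]_v f (N w) (X v)) ^+ N w).
Proof.
move=> mf f01.
have fX n i : \int[P]_v f n (Xs i v) = \int[P]_v f n (X v).
  by apply: Ex_same_distribution => // y; case/andP: (f01 n y).
have b n i : bounded_measurable (fun w => f n (Xs i w)) by exact: bm_comp_unit.
have e01 n : 0 <= \int[P]_v f n (X v) <= 1.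
  by apply: Ex_unit => //; exact: measurableT_comp.
apply: (Ex_partition measurable_RV_nat).
- apply: (measurable_random_index measurable_RV_nat
    (F := fun n w => \prod_(i < n) f n (Xs i w))) => n.
  by have [] := bm_prod (index_enum 'I_n) xpredT (fun i : 'I_n => b n i).
- by move=> w; apply: prodr01 => i; exact: f01.
- by apply: (measurable_random_index measurable_RV_nat
    (F := fun n w => (\int[P]_v f n (X v)) ^+ n)).
- by move=> w; have /andP[? ?] := e01 (N w); rewrite exprn_ge0//= exprn_ile1.
move=> n; have mNn := measurable_RV_nat n.
transitivity (\int[P]_w (\1_(N @^-1` [set n]) w * \prod_(i < n) f n (Xs i w))).
  apply: eq_Rintegral => w _; rewrite indicE.
  by case: (boolP (w \in _)) => [/set_mem/= ->|_] //; rewrite !mul0r.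
have -> := @Ex_prod_independent R d T P (\1_(N @^-1` [set n])) (fun i => Xs i) (fun=> f n) n
  (measurable_indic mNn) (indic01 _) (fun i => measurable_funP _) (fun=> mf n)
  (fun=> f01 n) (fun B mB => prod_independent_events n n mB).
rewrite (eq_bigr (fun=> \int[P]_v f n (X v))) => [|i _]; last by rewrite fX.
rewrite prodr_const card_ord.
transitivity (\int[P]_w ((\int[P]_v f n (X v)) ^+ n * \1_(N @^-1` [set n]) w)).
  by rewrite ExZ 1?mulrC//; exact: bm_indic.
apply: eq_Rintegral => w _; rewrite indicE mulrC.
by case: (boolP (w \in _)) => [/set_mem/= ->|_] //; rewrite !mul0r.
Qed.

End random_sample.

(** * Regularly varying tails *)

Section regular_variation.
Context {R : realType}.

Lemma dyadic_bracket (z : R) : 1 <= z -> exists k, z <= 2 ^+ k < 2 * z.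
Proof.
move=> z1; have ex : exists k, z <= 2 ^+ k.
  exists (Num.truncn z).+1; apply: (le_trans (ltW (truncnS_gt z))).
  by rewrite -natrX ler_nat ltnW// ltn_expl.
case: (ex_minnP ex) => k zk kmin; exists k; rewrite zk/=.
case: k zk kmin => [|k] _ kmin; first by rewrite expr0; lra.
rewrite exprS ltr_pM2l// ltNge; apply/negP => /kmin.
by rewrite ltnn.
Qed.

Variables (G : R -> R) (alpha : R).
Hypothesis G_noninc : {homo G : x y /~ x <= y}.
Hypothesis G_gt0 : forall x, 0 < G x.
Hypothesis G_le1 : forall x, G x <= 1.
Hypothesis G_rv : forall c, 0 < c -> G (c * x) / G x @[x --> +oo] --> c `^ (- alpha).

Lemma regular_doubling_ge rho : alpha < rho ->
  exists2 x0, 0 < x0 & forall x, x0 <= x -> 2 `^ (- rho) * G x <= G (2 * x).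
Proof.
move=> ar.
have h : 2 `^ (- rho) < 2 `^ (- alpha) :> R.
  by rewrite /powR pnatr_eq0/= ltr_expR ltr_pM2r ?ltrN2// ln_gt0// ltr1n.
have e0 : 0 < 2 `^ (- alpha) - 2 `^ (- rho) :> R by rewrite subr_gt0.
have /cvgrPdist_le/(_ _ e0)[M [_ hM]] := G_rv (ltr0n R 2).
exists (Num.max 1 (M + 1)); first by rewrite lt_max ltr01.
move=> x; rewrite ge_max => /andP[_ Mx].
have Mx' : M < x by rewrite (lt_le_trans _ Mx)// ltrDl.
have := hM x Mx' => /=.
rewrite ler_norml => /andP[_]; rewrite lerD2l lerN2.
by rewrite ler_pdivlMr.
Qed.

Lemma regular_doubling_le rho : rho < alpha ->
  exists2 x0, 0 < x0 & forall x, x0 <= x -> G (2 * x) <= 2 `^ (- rho) * G x.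
Proof.
move=> ar.
have h : 2 `^ (- alpha) < 2 `^ (- rho) :> R.
  by rewrite /powR pnatr_eq0/= ltr_expR ltr_pM2r ?ltrN2// ln_gt0// ltr1n.
have e0 : 0 < 2 `^ (- rho) - 2 `^ (- alpha) :> R by rewrite subr_gt0.
have /cvgrPdist_le/(_ _ e0)[M [_ hM]] := G_rv (ltr0n R 2).
exists (Num.max 1 (M + 1)); first by rewrite lt_max ltr01.
move=> x; rewrite ge_max => /andP[_ Mx].
have Mx' : M < x by rewrite (lt_le_trans _ Mx)// ltrDl.
have := hM x Mx' => /=.
rewrite ler_norml => /andP[+ _].
rewrite -ler_pdivrMr// opprB => ?; lra.
Qed.

(** Iterated doubling reaches a from y in about log2 (a / y) steps; the factor 2 and
    monotonicity absorb the last, incomplete step. *)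
Lemma potter_ge rho : 0 < rho -> alpha < rho ->
  exists2 x0, 0 < x0 & forall y a, x0 <= y -> y <= a ->
    G y <= (2 * (a / y)) `^ rho * G a.
Proof.
move=> rho0 /regular_doubling_ge[x0 x00 dbl]; exists x0 => // y a x0y ya.
have y0 : 0 < y := lt_le_trans x00 x0y.
have ay : 1 <= a / y by rewrite ler_pdivlMr// mul1r.
have [k /andP[k1 /ltW k2]] := dyadic_bracket ay.
have iter n : (2 `^ (- rho)) ^+ n * G y <= G (2 ^+ n * y).
  elim: n => [|n IH]; first by rewrite !expr0 !mul1r.
  rewrite !exprS -!mulrA; apply: le_trans (dbl (2 ^+ n * y) _).
    by rewrite ler_wpM2l// powR_ge0.
  by rewrite (le_trans x0y)// ler_peMl ?(ltW y0)// exprn_ege1// ler1n.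
have /G_noninc h : a <= 2 ^+ k * y by rewrite -ler_pdivrMr.
have {iter}h := le_trans (iter k) h.
have t0 : 0 < (2 * (a / y)) `^ rho by rewrite powR_gt0// mulr_gt0// (lt_le_trans ltr01).
rewrite -ler_pdivrMl//; apply: le_trans h.
have -> : (2 `^ (- rho)) ^+ k = ((2 ^+ k) `^ rho)^-1.
  rewrite powRN exprVn; congr (_^-1).
  by rewrite -powR_mulrn ?powR_ge0// -powRrM mulrC powRrM powR_mulrn.
rewrite ler_pM2r// lef_pV2 ?posrE ?powR_gt0//.
  by rewrite ge0_ler_powR ?nnegrE ?exprn_ge0// ?ltW// mulr_gt0// (lt_le_trans ltr01).
by rewrite mulr_gt0// (lt_le_trans ltr01).
Qed.

(** Potter's bound. When a u falls below the range of potter_ge, G (a u) is bounded by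
    1, which costs the factor 1 / G x0 in the constant. *)
Lemma potter_bound rho : 0 < rho -> alpha < rho ->
  exists x0 C : R, 0 < x0 /\ 0 < C /\ forall a u, x0 <= a -> 0 < u -> u <= 1 ->
    G (a * u) / G a <= C * u `^ (- rho).
Proof.
move=> rho0 /(potter_ge rho0)[x0 x00 pot].
exists x0, (2 `^ rho / G x0); split=> //; split; first by rewrite divr_gt0// powR_gt0.
move=> a u x0a u0 u1; have a0 := lt_le_trans x00 x0a.
have powE z : 0 <= z -> 2 `^ rho * z `^ (- rho) = (2 * z^-1) `^ rho.
  by move=> z0; rewrite powRM ?invr_ge0// powRN -[in RHS]powR_inv1// -powRrM mulN1r powRN.
rewrite mulrAC powE ?(ltW u0)// ler_pdivrMr// mulrAC ler_pdivlMr//.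
have [x0au|aux0] := leP x0 (a * u).
  have := pot _ a x0au; rewrite ler_piMr ?(ltW a0)// => /(_ isT).
  have -> : a / (a * u) = u^-1 by field; rewrite !gt_eqF.
  by apply: le_trans; rewrite ler_piMr// ltW.
apply: (@le_trans _ _ (G x0)); first by rewrite ler_piMl// ltW.
apply: (le_trans (pot _ _ (lexx x0) x0a)); rewrite ler_pM2r//.
rewrite ge0_ler_powR ?nnegrE ?ltW// ?mulr_gt0 ?divr_gt0 ?invr_gt0//.
by rewrite ltr_pM2l// ltr_pdivrMr// ltr_pdivlMl// mulrC.
Qed.

(** Potter's bound with an exponent rho between alpha and 2 gives x^2 G (x) >= c
    x^(2 - rho). *)
Lemma regular_sqr_cvgy : 0 < alpha -> alpha < 2 -> x ^+ 2 * G x @[x --> +oo] --> +oo.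
Proof.
move=> a0 a2; pose rho := (alpha + 2) / 2.
have ar : alpha < rho by rewrite /rho; lra.
have r2 : rho < 2 by rewrite /rho; lra.
have rho0 : 0 < rho by rewrite (lt_trans a0).
have [x0 x00 pot] := potter_ge rho0 ar.
pose c := (2 / x0) `^ (- rho) * G x0.
have c0 : 0 < c by rewrite mulr_gt0// powR_gt0// divr_gt0.
have lb : \forall x \near +oo, c * x `^ (2 - rho) <= x ^+ 2 * G x.
  near=> x.
  have x0x : x0 <= x by near: x; apply: nbhs_pinfty_ge; rewrite num_real.
  have xp : 0 < x := lt_le_trans x00 x0x.
  have := pot _ _ (lexx x0) x0x.
  rewrite (_ : 2 * (x / x0) = 2 / x0 * x); last by ring.
  have dx0 : 0 < 2 / x0 by rewrite divr_gt0.
  rewrite powRM ?(ltW dx0) ?(ltW xp)// -mulrA -ler_pdivrMl ?powR_gt0//.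
  rewrite -powRN -/c -ler_pdivrMl ?powR_gt0// => h.
  rewrite powRB ?gt_eqF ?implybT// powR_mulrn ?(ltW xp)//.
  by rewrite mulrCA ler_pM2l ?exprn_gt0// mulrC.
apply: (ger_cvgy lb).
apply: gt0_cvgMry => //.
have p0 : 0 < 2 - rho by rewrite subr_gt0.
apply/cvgryPge => A; near=> x.
have xp : 0 < x by near: x; apply: nbhs_pinfty_gt; rewrite num_real.
apply: (le_trans (ler_norm A)).
have -> : `|A| = (`|A| `^ (2 - rho)^-1) `^ (2 - rho).
  by rewrite -powRrM mulVf ?gt_eqF// powRr1.
rewrite ge0_ler_powR ?nnegrE ?powR_ge0 ?(ltW p0) ?(ltW xp)//.
Unshelve. all: by end_near. Qed.

End regular_variation.

(** * The integral defining the gamma function *)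

Section gamma_integral.
Context {R : realType}.
Local Notation mu := (@lebesgue_measure R).

Lemma continuous_powR (p x : R) : 0 < x -> {for x, continuous (@powR R ^~ p)}.
Proof.
move=> x0; apply: differentiable_continuous; apply/derivable1_diffP.
by apply: derivable_powR; rewrite in_itv/= andbT.
Qed.

Lemma integral_powRN_lty (q : R) : q < 1 ->
  (\int[mu]_(y in `]0%R, 1%R]) (y `^ (- q))%:E < +oo)%E.
Proof.
move=> q1; have q10 : 0 < 1 - q by rewrite subr_gt0.
pose I n : set R := `[n.+2%:R^-1, 1%R]%classic.
have I0 n : 0 < n.+2%:R^-1 :> R by rewrite invr_gt0.
have -> : `]0%R, 1%R]%classic = \bigcup_n I n.
  apply/seteqP; split => [y|y [n _]] /=; rewrite in_itv/= ; last first.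
    by rewrite /I/= in_itv/= => /andP[y0 ->]; rewrite (lt_le_trans (I0 n) y0).
  move=> /andP[y0 y1].
  exists (Num.truncn y^-1) => //; rewrite /I/= in_itv/= y1 andbT.
  rewrite invf_ple ?posrE// (le_trans (ltW (truncnS_gt _)))// ler_nat.
  by rewrite ltnW.
have cvgI := @ge0_nondecreasing_set_cvg_integral _ (measurableTypeR R) R I
  (fun y : R => (y `^ (- q))%:E) mu.
apply: (@le_lt_trans _ _ ((1 - q)^-1)%:E); last exact: ltry.
have {}cvgI : (\int[mu]_(x in I i) (x `^ (- q))%:E @[i --> \oo] -->
    \int[mu]_(x in \bigcup_i I i) (x `^ (- q))%:E)%E.
  apply: cvgI => //.
  - apply/nondecreasing_seqP => n; rewrite subsetEset => y; rewrite /I/= !in_itv/=.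
    move=> /andP[h ->]; rewrite andbT (le_trans _ h)//.
    by rewrite lef_pV2 ?posrE// ler_nat.
  - by move=> n; exact: measurable_itv.
  - move=> n; suff h : measurable_fun (I n : set R) (fun y : R => (y `^ (- q))%:E) by exact: h.
    by apply/measurable_EFinP; apply: measurable_funTS; exact: measurable_powR.
  - by move=> n y _; rewrite lee_fin powR_ge0.
rewrite -(cvg_lim _ cvgI)//; apply: lime_le; first by apply/cvg_ex; eexists; exact: cvgI.
apply: nearW => n.
have in0 x : n.+2%:R^-1 <= x -> 0 < x by exact: lt_le_trans.
have an1 : n.+2%:R^-1 < 1 :> R by rewrite invf_lt1// ltr1n.
rewrite (@continuous_FTC2 _ _ (fun y : R => (1 - q)^-1 * y `^ (1 - q)) _ _ an1).
- rewrite powR1 mulr1 -EFinB lee_fin gerBl mulr_ge0// ?powR_ge0// invr_ge0 ltW//.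
- apply: derivable_within_continuous => x; rewrite in_itv/= => /andP[/in0 x0 _].
  by apply: derivable_powR; rewrite in_itv/= andbT.
- have cF (x : R) : 0 < x -> {for x, continuous (fun y : R => (1 - q)^-1 * y `^ (1 - q))}.
    by move=> x0; apply: cvgMr; exact: continuous_powR.
  split.
  + move=> x; rewrite in_itv/= => /andP[/ltW/in0 x0 _].
    by apply: derivableM => //; apply: derivable_powR; rewrite in_itv/= andbT.
  + by apply: cvg_at_right_filter; exact: cF.
  + by apply: cvg_at_left_filter; exact: cF.
move=> x; rewrite in_itv/= => /andP[/ltW/in0 x0 _].
rewrite derive1Ml; last by apply: derivable_powR; rewrite in_itv/= andbT.
rewrite powR_derive1 ?in_itv/= ?andbT// mulrA mulVf ?gt_eqF// mul1r.
by congr (_ `^ _); ring.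
Qed.

Lemma ge0_integral_split01 (f : R -> \bar R) : measurable_fun (`]0%R, +oo[ : set R) f ->
  (forall x, 0 <= f x)%E ->
  (\int[mu]_(y in `]0%R, +oo[) f y =
   \int[mu]_(y in `]0%R, 1%R]) f y + \int[mu]_(y in `]1%R, +oo[) f y)%E.
Proof.
move=> mf f0; rewrite (@itv_bndbnd_setU _ _ _ (BRight 1%R))//; last first.
  by rewrite bnd_simp.
rewrite ge0_integral_setU//=.
- have -> : (`]0%R, 1%R] `|` `]1%R, +oo[)%classic = (`]0%R, +oo[)%classic :> set R.
    by rewrite -itv_bndbnd_setU// bnd_simp.
  exact: mf.
- apply/disj_setPS => y [] /=; rewrite !in_itv/= andbT => /andP[_ y1].
  by rewrite ltNge y1.
Qed.

Lemma integral_expRN_setT_lty :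
  (\int[mu]_(y in `]1%R, +oo[) (expR (- y))%:E < +oo)%E.
Proof.
have := @integral_exponential_pdf R 1 ltr01 => h.
rewrite [ltLHS](_ : _ = \int[mu]_(y in `]1%R, +oo[) (exponential_pdf 1 y)%:E)%E; last first.
  apply: eq_integral => y; rewrite inE/= in_itv/= andbT => y1.
  rewrite exponential_pdfE ?(le_trans ler01 (ltW y1))//.
  by rewrite mul1r mulN1r.
apply: (@le_lt_trans _ _ 1%E); last exact: ltry.
rewrite -h; apply: ge0_subset_integral => //=.
  by apply/measurable_EFinP; exact: measurable_exponential_pdf.
by move=> y _; rewrite lee_fin exponential_pdf_ge0.
Qed.

(** An integrable majorant on the positive half-line for the functions met
    below. *)
Lemma integrable_gamma_majorant (K q : R) : 0 <= K -> 0 <= q < 1 ->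
  mu.-integrable `]0, +oo[ (fun y => (expR (- y) * (1 + K * y `^ (- q)))%:E).
Proof.
move=> K0 /andP[q0 q1].
have me : measurable_fun setT (fun y : R => expR (- y)) by exact: measurableT_comp.
have mq : measurable_fun setT (fun y : R => K * y `^ (- q)).
  by apply: measurable_funM => //; exact: measurable_powR.
have mq1 : measurable_fun setT (fun y : R => 1 + K * y `^ (- q)) by exact: measurable_funD.
have mE (f : R -> R) (D : set R) : measurable_fun setT f -> measurable_fun D (EFin \o f).
  by move=> mf; apply/measurable_EFinP; exact: measurable_funTS.
have mDe (D : set R) := mE _ D (measurable_funM me mq1).
have Kq0 y : 0 <= K * y `^ (- q) by rewrite mulr_ge0// powR_ge0.
have D0 y : 0 <= expR (- y) * (1 + K * y `^ (- q)).
  by rewrite mulr_ge0 ?expR_ge0// addr_ge0.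
apply/integrableP; split; first exact: mDe.
under eq_integral do rewrite gee0_abs ?lee_fin//.
rewrite ge0_integral_split01//.
apply: lte_add_pinfty.
  apply: (@le_lt_trans _ _ (\int[mu]_(y in `]0%R, 1%R]) (1 + K * y `^ (- q))%:E)%E).
    apply: ge0_le_integral => //=.
    - by move=> *; rewrite lee_fin.
    - exact: mDe.
    - exact: mE.
    - move=> y; rewrite /= in_itv/= => /andP[y0 y1]; rewrite lee_fin.
      rewrite ler_piMl ?addr_ge0//.
      by rewrite -expR0 ler_expR oppr_le0 ltW.
  under eq_integral do rewrite EFinD.
  rewrite ge0_integralD//=; last 2 first.
  - by move=> *; rewrite lee_fin.
  - exact: mE mq.
  apply: lte_add_pinfty.
    rewrite integral_cst//= mul1e lebesgue_measure_itv/= lte_fin ltr01 sube0.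
    exact: ltry.
  under eq_integral do rewrite EFinM.
  rewrite ge0_integralZl_EFin//.
  - exact: lte_mul_pinfty (integral_powRN_lty q1).
  - by move=> *; rewrite lee_fin powR_ge0.
  - exact: mE _ _ (measurable_powR _).
apply: (@le_lt_trans _ _ (\int[mu]_(y in `]1%R, +oo[) ((1 + K)%:E * (expR (- y))%:E))%E).
  apply: ge0_le_integral => //=.
  - by move=> *; rewrite lee_fin.
  - exact: mDe.
  - by apply: emeasurable_funM => //; exact: mE me.
  - move=> y; rewrite /= in_itv/= andbT => y1; rewrite -EFinM lee_fin mulrC.
    rewrite ler_wpM2r ?expR_ge0// lerD2l ler_piMr//.
    by rewrite powRN invf_le1 ?powR_gt0 ?(lt_trans ltr01)// -(powRr0 y) ler_powR// ltW.
rewrite ge0_integralZl_EFin//.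
- by rewrite lte_mul_pinfty// ?lee_fin ?addr_ge0//; exact: integral_expRN_setT_lty.
- exact: mE me.
- by rewrite addr_ge0.
Qed.

Lemma integral_expRN_below (z : R) : 0 <= z ->
  (\int[mu]_y (if (0 < y) && (y < z) then expR (- y) else 0)%:E = (1 - expR (- z))%:E)%E.
Proof.
move=> z0.
rewrite [LHS](_ : _ = \int[mu]_(y in `]0%R, z[) (expR (- y))%:E)%E; last first.
  rewrite [RHS]integral_mkcond; apply: eq_integral => y _; rewrite patchE.
  by rewrite mem_setE in_itv/=; case: ifP.
have me : measurable_fun (`]0%R, z[ : set R) (fun y : R => (expR (- y))%:E).
  by apply/measurable_EFinP; apply: measurable_funTS; exact: measurableT_comp.
move: z0; rewrite le_eqVlt => /predU1P[<-|z0].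
  by rewrite set_itv_ge ?integral_set0 ?oppr0 ?expR0 ?subrr// bnd_simp ltxx.
rewrite -(@integral_itv_bndoo _ _ _ _ true false)//.
have := exponential_prob_itv0c 1 z0; rewrite /exponential_prob mulN1r -EFinB => <-.
apply: eq_integral => y; rewrite inE/= in_itv/= => /andP[y0 _].
by rewrite exponential_pdfE// mul1r mulN1r.
Qed.

End gamma_integral.

(** * Laplace transform of a squared regularly varying variable *)

Section abelian.
Context {R : realType} {d : measure_display} {T : measurableType d} (P : probability T R).
Local Notation mu := (@lebesgue_measure R).
Variable X : T -> R.
Hypothesis mX : measurable_fun setT X.
Let G (x : R) : R := pr P [set w | x < `|X w|].

Lemma measurable_gt_norm x : measurable [set w | x < `|X w|].
Proof.
by apply: measurable_lt => //; exact: measurableT_comp.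
Qed.

Lemma tail_noninc : {homo G : x y /~ x <= y}.
Proof.
move=> x y xy; apply: le_pr; [exact: measurable_gt_norm|exact: measurable_gt_norm|].
by move=> w /=; exact: le_lt_trans.
Qed.

Lemma tail_le1 x : G x <= 1. Proof. by apply: pr_le1; exact: measurable_gt_norm. Qed.

(** Write 1 - exp (- l X^2) as the integral of exp (- y) over 0 < y < l X^2 and exchange
    the integrals. *)
Lemma laplace_sqr_tail (l : R) : 0 < l ->
  ((1 - \int[P]_w expR (- (l * X w ^+ 2)))%:E =
   \int[mu]_(y in `]0%R, +oo[) (expR (- y) * G ((y / l) `^ 2^-1))%:E)%E.
Proof.
move=> l0.
pose f (z : T * measurableTypeR R) : \bar R :=
  (if (0 < z.2)%R && (z.2 < l * X z.1 ^+ 2)%R then expR (- (z.2 : R)) else 0)%:E.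
have m2 : measurable_fun setT (fun z : T * measurableTypeR R => z.2 : R).
  exact: measurable_snd.
have m1 : measurable_fun setT (fun z : T * measurableTypeR R => l * X z.1 ^+ 2).
  apply: measurable_funM => //; apply: measurable_funX.
  exact: measurableT_comp measurable_fst.
have mf : measurable_fun setT f.
  apply/measurable_EFinP; apply: measurable_fun_ifT => //.
    by apply: measurable_and; apply: measurable_fun_ltr.
  by apply: measurableT_comp => //; exact: measurableT_comp.
have f0 z : (0 <= f z)%E by rewrite /f lee_fin; case: ifP => // _; exact: expR_ge0.
have mQ : measurable_fun setT (fun w => l * X w ^+ 2).
  by apply: measurable_funM => //; exact: measurable_funX.
have bL : bounded_measurable (fun w => expR (- (l * X w ^+ 2))).
  apply: bm_laplace => //; last exact: ltW.
  - exact: measurable_funX.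
  - by move=> w; exact: sqr_ge0.
have := @fubini_tonelli _ _ T (measurableTypeR R) R P mu f mf f0.
rewrite (eq_integral (fun w => (1 - expR (- (l * X w ^+ 2)))%:E)); last first.
  by move=> w _; rewrite /f/= integral_expRN_below// mulr_ge0 ?sqr_ge0// ltW.
have -> : (\int[P]_w (1 - expR (- (l * X w ^+ 2)))%:E =
    (1 - \int[P]_w expR (- (l * X w ^+ 2)))%:E)%E.
  rewrite -[in RHS](Ex_cst P 1) -ExB//; last exact: bm_cst.
  by rewrite -bm_expectation ?unlock//; apply: bmB => //; exact: bm_cst.
move=> ->; rewrite [RHS]integral_mkcond; apply: eq_integral => y _.
rewrite patchE mem_setE in_itv/= andbT; case: ifPn => [y0|y0]; last first.
  by rewrite integral0_eq// => w _; rewrite /f/= (negbTE y0).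
have GE : G ((y / l) `^ 2^-1) = pr P [set w | y < l * X w ^+ 2].
  rewrite /G; congr (pr P _); apply/seteqP.
  have h w : ((y / l) `^ 2^-1 < `|X w|) = (y < l * X w ^+ 2).
    have yl : 0 <= y / l by rewrite divr_ge0 ?ltW.
    rewrite powR12_sqrt// -(@ltr_pXn2r _ 2) ?nnegrE ?sqrtr_ge0//.
    by rewrite sqr_sqrtr// real_normK ?num_real// ltr_pdivrMr// mulrC.
  by split => w /=; rewrite h.
have mA : measurable [set w | y < l * X w ^+ 2] by exact: measurable_lt.
rewrite GE -Ex_indic// -ExZ; last exact: bm_indic.
rewrite -bm_expectation; last by apply: bmZ; exact: bm_indic.
rewrite unlock; apply: eq_integral => w _; rewrite /f/= y0/= indicE.
by case: ifPn => h; [rewrite mem_set ?mulr1|rewrite memNset ?mulr0//=; exact/negP].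
Qed.

Variable alpha : R.
Hypothesis alpha_bnd : 0 < alpha < 2.
Hypothesis G_gt0 : forall x, 0 < G x.
Hypothesis G_rv : forall c, 0 < c -> G (c * x) / G x @[x --> +oo] --> c `^ (- alpha).

(** After division by G b the integrand of laplace_sqr_tail converges pointwise by
    regular variation. Potter's bound dominates it by
    exp (- y) (1 + K y^(- rho / 2)) with a constant K, integrable for rho < 2. *)
Lemma laplace_sqr_asymptotics (r : R) : 0 < r ->
  (1 - \int[P]_w expR (- (r / b ^+ 2 * X w ^+ 2))) / G b @[b --> +oo] -->
  r `^ (alpha / 2) * gamma_fun (1 - alpha / 2).
Proof.
move=> r0; case/andP: alpha_bnd => a0 a2.
pose rho := (alpha + 2) / 2.
have ar : alpha < rho by rewrite /rho; lra.
have r2 : rho < 2 by rewrite /rho; lra.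
have rho0 : 0 < rho by rewrite (lt_trans a0).
have [x0 [C [x00 [C0 pot]]]] := potter_bound tail_noninc G_gt0 tail_le1 G_rv rho0 ar.
set K := fun b => _ / G b; set L := _ * gamma_fun _.
suff KL : K (Num.max x0 b) @[b --> +oo] --> L.
  apply: cvg_trans KL; apply: near_eq_cvg; near=> b.
  rewrite max_r//; near: b; apply: nbhs_pinfty_ge; exact: num_real.
apply/cvg_pinftyP => v vy; pose b n := Num.max x0 (v n).
have bx n : x0 <= b n by rewrite le_max lexx.
have b0 n : 0 < b n by rewrite (lt_le_trans x00).
have by' : b n @[n --> \oo] --> +oo.
  by apply: ger_cvgy vy; apply: nearW => n; rewrite /b le_max lexx orbT.
pose u y : R := (y / r) `^ 2^-1.
have mG : measurable_fun setT G.
  by apply: nonincreasing_measurable => // x y /tail_noninc.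
have mroot : measurable_fun setT (@powR R ^~ 2^-1) by exact: measurable_powR.
pose f_ n (y : measurableTypeR R) : \bar R := (expR (- (y : R)) * (G (b n * u y) / G (b n)))%:E.
pose f (y : measurableTypeR R) : \bar R :=
  (r `^ (alpha / 2) * ((y : R) `^ (1 - alpha / 2 - 1) * expR (- (y : R))))%:E.
have KE n : (K (b n))%:E = (\int[mu]_(y in `]0%R, +oo[) f_ n y)%E.
  have rb : 0 < r / b n ^+ 2 by rewrite divr_gt0// exprn_gt0.
  rewrite /K mulrC EFinM (laplace_sqr_tail rb).
  have mGu (D : set R) : measurable_fun D
      (fun y : R => (expR (- y) * G ((y / (r / b n ^+ 2)) `^ 2^-1))%:E).
    apply/measurable_EFinP; apply: measurable_funTS; apply: measurable_funM.
      exact: measurableT_comp.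
    apply: (measurableT_comp mG); apply: (measurableT_comp mroot).
    exact: measurable_funM.
  rewrite -ge0_integralZl_EFin//; last 3 first.
  - by move=> y _; rewrite lee_fin mulr_ge0 ?expR_ge0// ltW.
  - exact: mGu.
  - by rewrite invr_ge0 ltW.
  apply: eq_integral => y; rewrite inE/= in_itv/= andbT => y0.
  rewrite /f_ -EFinM; congr EFin; rewrite mulrC -mulrA; congr (_ * (G _ / _)).
  rewrite invfM invrK mulrA powRM ?divr_ge0 ?sqr_ge0 ?ltW//.
  by rewrite mulrC; congr (_ * _); rewrite powR12_sqrt ?sqr_ge0// sqrtr_sqr ger0_norm ?ltW.
have u_gt0 y : 0 < y -> 0 < u y by move=> y0; rewrite powR_gt0// divr_gt0.
have mf_ n : measurable_fun (`]0%R, +oo[ : set R) (f_ n).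
  apply/measurable_EFinP; apply: measurable_funTS; apply: measurable_funM.
    exact: measurableT_comp.
  apply: measurable_funM => //.
  apply: (measurableT_comp mG); apply: measurable_funM => //.
  apply: (measurableT_comp mroot).
  exact: measurable_funM.
have mf : measurable_fun (`]0%R, +oo[ : set R) f.
  apply/measurable_EFinP; apply: measurable_funTS; apply: measurable_funM => //.
  by apply: measurable_funM; [exact: measurable_powR|exact: measurableT_comp].
have q1 : 0 <= rho / 2 < 1 by apply/andP; split; lra.
have C'0 : 0 <= C * r `^ (rho / 2) by rewrite mulr_ge0 ?powR_ge0 ?ltW.
have ig := integrable_gamma_majorant C'0 q1.
have uE p y : 0 < y -> u y `^ (- p) = r `^ (p / 2) * y `^ (- (p / 2)).
  move=> y0; rewrite /u -powRrM powRM ?invr_ge0 ?ltW// mulrC; congr (_ * _).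
    by rewrite -[r^-1]powR_inv1 ?ltW// -powRrM; congr (_ `^ _); field.
  by congr (_ `^ _); field.
have := @dominated_convergence _ (measurableTypeR R) R mu `]0%R, +oo[%classic
  (measurable_itv _) f_ f _ mf_ mf _ ig _.
case.
- apply: aeW => y; rewrite /= in_itv/= andbT => y0.
  apply: cvg_EFin; first exact: nearW.
  have -> : r `^ (alpha / 2) * (y `^ (1 - alpha / 2 - 1) * expR (- y)) =
      expR (- y) * u y `^ (- alpha).
    rewrite uE// mulrA mulrC; congr (_ * (_ * _ `^ _)); ring.
  apply: cvgMr; have := (cvg_pinftyP _ _).1 (G_rv (u_gt0 y y0)) b by'.
  by apply: cvg_trans; apply: near_eq_cvg; apply: nearW => n; rewrite [u y * _]mulrC.
- apply: aeW => y n; rewrite /= in_itv/= andbT => y0; rewrite lee_fin.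
  have Gr : 0 <= G (b n * u y) / G (b n) by rewrite divr_ge0// ltW.
  rewrite ger0_norm; last by rewrite mulr_ge0// expR_ge0.
  rewrite ler_wpM2l ?expR_ge0//.
  have [u1|u1] := leP (u y) 1.
    apply: (le_trans (pot _ _ (bx n) (u_gt0 y y0) u1)).
    by rewrite uE// mulrA lerDr.
  apply: (@le_trans _ _ 1); last by rewrite lerDl mulr_ge0// powR_ge0.
  rewrite ler_pdivrMr// mul1r; apply: tail_noninc.
  by rewrite ler_peMr ?ltW.
move=> fint _ cf.
pose g (y : measurableTypeR R) : R := (y : R) `^ (1 - alpha / 2 - 1) * expR (- (y : R)).
have k0 : r `^ (alpha / 2) != 0 by rewrite gt_eqF// powR_gt0.
have gint : mu.-integrable `]0%R, +oo[ (EFin \o g).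
  have mI : @measurable _ (measurableTypeR R) `]0%R, +oo[ := measurable_itv _.
  have := integrableZl mI (r `^ (alpha / 2))^-1 fint.
  apply: eq_integrable => // y _; rewrite /f -EFinM; congr EFin.
  by rewrite mulKf.
have intL : (\int[mu]_(y in `]0%R, +oo[) f y = L%:E)%E.
  rewrite -[LHS]fineK; last exact: integrable_fin_num.
  by congr EFin; rewrite /L /gamma_fun -RintegralZl.
move: cf; rewrite intL => /fine_cvg; apply: cvg_trans.
by apply: near_eq_cvg; apply: nearW => n /=; rewrite -KE.
Unshelve. all: by end_near. Qed.

End abelian.

(** * Limits of powers *)

Section powers.
Context {R : realType}.

Lemma negln_bounds (p : R) : 0 <= p < 1 -> p <= - ln (1 - p) <= p / (1 - p).
Proof.
move=> /andP[p0 p1]; have q0 : 0 < 1 - p by rewrite subr_gt0.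
apply/andP; split.
  by rewrite lerNr; apply: le_ln1Dx; rewrite ltrN2.
have -> : - ln (1 - p) = ln (1 + p / (1 - p)).
  by rewrite -lnV ?posrE//; congr ln; field; rewrite gt_eqF.
by apply: le_ln1Dx; rewrite (@lt_le_trans _ _ 0)// ?ltrN10// divr_ge0// ltW.
Qed.

(** - ln (1 - p) is equivalent to p as p tends to 0. *)
Lemma cvg_negln {I : Type} {F : set_system I} {FF : ProperFilter F}
    (c p : I -> R) (k : R) :
  (\forall t \near F, 0 <= c t) -> (\forall t \near F, 0 <= p t < 1) ->
  p t @[t --> F] --> 0 -> c t * p t @[t --> F] --> k ->
  c t * - ln (1 - p t) @[t --> F] --> k.
Proof.
move=> c0 p01 p0 cpk.
apply: (@squeeze_cvgr _ _ _ _ (fun t => c t * p t) (fun t => c t * p t / (1 - p t))) => //.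
  apply: filterS2 c0 p01 => t ct0 pt01.
  have /andP[h1 h2] := negln_bounds pt01.
  by rewrite -mulrA !ler_wpM2l.
rewrite -[X in _ --> X]divr1 -[X in _ / X](subr0 1).
apply: cvgM => //; apply: cvgV; first by rewrite subr0 oner_eq0.
by apply: cvgB => //; exact: cvg_cst.
Qed.

Lemma cvg_1Bexpn (p : nat -> R) (k : R) : (forall n, 0 <= p n <= 1) ->
  n%:R * p n @[n --> \oo] --> k -> (1 - p n) ^+ n @[n --> \oo] --> expR (- k).
Proof.
move=> p01 npk.
have p0 : p n @[n --> \oo] --> 0.
  have : n.+1%:R^-1 * n.+1%:R * p n.+1 @[n --> \oo] --> (0 * k : R).
    under eq_fun do rewrite -mulrA.
    apply: cvgM; first exact: cvg_harmonic.
    by move: npk; rewrite -(cvg_shiftS (fun n => n%:R * p n)).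
  rewrite mul0r => h; rewrite -(cvg_shiftS p); apply: cvg_trans h.
  by apply: near_eq_cvg; apply: nearW => n; rewrite mulVf ?mul1r.
have p1 : \forall n \near \oo, 0 <= p n < 1.
  have /cvgrPdist_lt/(_ 1 ltr01) := p0; apply: filterS => n.
  by rewrite sub0r normrN; have /andP[pn0 _] := p01 n; rewrite ger0_norm ?pn0.
have npl : n%:R * - ln (1 - p n) @[n --> \oo] --> k.
  by apply: cvg_negln => //; exact: nearW.
have : expR (- (n%:R * - ln (1 - p n))) @[n --> \oo] --> expR (- k).
  exact: (cvg_comp _ _ (cvgN npl) (@continuous_expR R (- k))).
apply: cvg_trans; apply: near_eq_cvg; apply: filterS p1 => n /andP[_ pn1].
by rewrite mulrN opprK expRM_natl lnK// posrE subr_gt0.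
Qed.

Lemma cvg_1BexpR (c : R) : 0 <= c ->
  n.+1%:R * (1 - expR (- (n.+1%:R^-1 * c))) @[n --> \oo] --> c.
Proof.
move=> c0.
apply: (@squeeze_cvgr _ _ _ _ (fun n => c / (1 + n.+1%:R^-1 * c)) (fun=> c)); last 2 first.
- rewrite -[X in _ --> X]divr1 -[X in _ / X](addr0 1) -(mul0r c).
  apply: cvgM; first exact: cvg_cst.
  apply: cvgV; first by rewrite mul0r addr0 oner_eq0.
  apply: cvgD; first exact: cvg_cst.
  by apply: cvgM; [exact: cvg_harmonic|exact: cvg_cst].
- exact: cvg_cst.
apply: nearW => n; have n0 : 0 < n.+1%:R :> R by rewrite ltr0n.
set x := _^-1 * c; have x0 : 0 <= x by rewrite mulr_ge0// invr_ge0 ltW.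
have cE : c = n.+1%:R * x by rewrite /x mulVKf ?gt_eqF.
have x1 : 0 < 1 + x by rewrite ltr_pwDl.
apply/andP; split.
  rewrite {1}cE.
  rewrite -mulrA ler_pM2l// (_ : x / (1 + x) = 1 - (1 + x)^-1).
    by rewrite lerD2l lerN2 expRN lef_pV2 ?posrE ?expR_gt0// expR_ge1Dx.
  by field; rewrite gt_eqF.
rewrite [leRHS]cE ler_pM2l// lerBlDl -lerBlDr.
by have := expR_ge1Dx (- x).
Qed.

Lemma expRN_lipschitz (u v : R) : 0 <= u -> 0 <= v ->
  `|expR (- u) - expR (- v)| <= `|u - v|.
Proof.
suff H (a b : R) : 0 <= a -> a <= b -> expR (- a) - expR (- b) <= b - a /\ expR (- b) <= expR (- a).
  move=> u0 v0; have [uv|/ltW vu] := leP u v.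
    have [h1 h2] := H u v u0 uv.
    by rewrite ger0_norm ?subr_ge0// distrC ger0_norm ?subr_ge0.
  have [h1 h2] := H v u v0 vu.
  by rewrite distrC ger0_norm ?subr_ge0// ger0_norm ?subr_ge0.
move=> a0 ab; split; last by rewrite ler_expR lerN2.
have -> : expR (- a) - expR (- b) = expR (- a) * (1 - expR (- (b - a))).
  by rewrite mulrBr mulr1 -expRD; congr (_ - expR _); ring.
rewrite -[leRHS]mul1r ler_pM ?expR_ge0//.
- by rewrite subr_ge0 -expR0 ler_expR oppr_le0 subr_ge0.
- by rewrite -expR0 ler_expR oppr_le0.
- by have := expR_ge1Dx (- (b - a)); lra.
Qed.

(** Near x, monotonicity encloses f_t between its values at the two points x - dl and
    x + dl, where it is close to f, and f varies little; compactness of [a, b] makes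
    this uniform. *)
Lemma monotone_cvg_locally_uniform (f_ : R -> R -> R) (f : R -> R) :
  (\forall t \near +oo, forall x y, 0 < x -> x <= y -> f_ t y <= f_ t x) ->
  (forall x, 0 < x -> f_ t x @[t --> +oo] --> f x) ->
  (forall x, 0 < x -> {for x, continuous f}) ->
  forall a b e, 0 < a -> 0 < e -> \forall t \near +oo, forall x, a <= x <= b ->
    `|f_ t x - f x| <= e.
Proof.
move=> mono fcvg cf a b e a0 e0.
have /compact_near_coveringP/(_ _ (nbhs +oo) (fun t x => `|f_ t x - f x| <= e)) :=
  @segment_compact R a b.
move=> H; have := H _; case.
  move=> x /=; rewrite in_itv/= => /andP[ax _].
  have x0 : 0 < x := lt_le_trans a0 ax.
  have e40 : 0 < e / 4 by rewrite divr_gt0.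
  have /cvgrPdist_le/(_ _ e40)/nbhs_ballP[r /= r0 hr] := cf x x0.
  pose dl := Num.min (r / 2) (x / 2).
  have dl0 : 0 < dl by rewrite lt_min !divr_gt0.
  have dlr : dl < r by rewrite gt_min ltr_pdivrMr// ltr_pMr// ltr1n.
  have dlx : dl < x by rewrite gt_min [X in _ || X]ltr_pdivrMr// ltr_pMr// ltr1n orbT.
  have x10 : 0 < x - dl by rewrite subr_gt0.
  have x20 : 0 < x + dl by rewrite addr_gt0.
  have near_x y : `|x - y| <= dl -> `|f x - f y| <= e / 4.
    by move=> xy; apply: hr; rewrite /ball/=; exact: le_lt_trans xy dlr.
  have h1 : `|f x - f (x - dl)| <= e / 4.
    by apply: near_x; rewrite opprB addrCA subrr addr0 ger0_norm// ltW.
  have h2 : `|f x - f (x + dl)| <= e / 4.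
    by apply: near_x; rewrite opprD addNKr normrN ger0_norm// ltW.
  have /cvgrPdist_le/(_ _ e40) c1 := fcvg _ x10.
  have /cvgrPdist_le/(_ _ e40) c2 := fcvg _ x20.
  exists (ball x dl, [set t | [/\ `|f (x - dl) - f_ t (x - dl)| <= e / 4,
      `|f (x + dl) - f_ t (x + dl)| <= e / 4 &
      forall x y, 0 < x -> x <= y -> f_ t y <= f_ t x]]).
    split; first by apply: nbhsx_ballx.
    by apply: filterS3 c1 c2 mono => t.
  move=> [y t] /= [xy [c1t c2t mt]].
  have {}xy : `|x - y| < dl := xy.
  have h3 := near_x _ (ltW xy).
  move: xy; rewrite ltr_norml => /andP[y1 y2].
  have l1 : f_ t y <= f_ t (x - dl) by apply: mt => //; lra.
  have l2 : f_ t (x + dl) <= f_ t y by apply: mt; lra.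
  move: h1 h2 h3 c1t c2t; rewrite !ler_norml.
  move=> /andP[? ?] /andP[? ?] /andP[? ?] /andP[? ?] /andP[? ?].
  by apply/andP; split; lra.
move=> M [MR hM]; exists M; split => // t /hM h x axb; apply: h.
Qed.

End powers.

(** * Events of probability close to one *)

Section likely.
Context {R : realType} {d : measure_display} {T : measurableType d} (P : probability T R).
Implicit Types p q : R -> T -> Prop.

(** p t holds with probability tending to one as t tends to infinity; inner
    approximation by measurable events makes this meaningful for all p. *)
Definition likely p : Prop := forall e, 0 < e -> \forall t \near +oo,
  exists A, [/\ measurable A, 1 - e <= pr P A & forall w, A w -> p t w].

Lemma likely_imp p q : likely p -> (\forall t \near +oo, forall w, p t w -> q t w) ->
  likely q.
Proof.
move=> lp pq e e0; apply: filterS2 pq (lp e e0) => t pqt [A [mA PA Ap]].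
by exists A; split => // w /Ap/pqt.
Qed.

Lemma likely_and p q : likely p -> likely q -> likely (fun t w => p t w /\ q t w).
Proof.
move=> lp lq e e0; have e20 : 0 < e / 2 by rewrite divr_gt0.
apply: filterS2 (lp _ e20) (lq _ e20) => t [A [mA PA Ap]] [B [mB PB Bq]].
exists (A `&` B); split; [exact: measurableI| |by move=> w [/Ap ? /Bq]].
have mC := measurableC.
have := prU P (mC _ _ _ mA) (mC _ _ _ mB).
rewrite -setCI !prC//; last exact: measurableI.
by lra.
Qed.

Lemma likely_sure (A : set T) p : measurable A -> pr P A = 1 ->
  (\forall t \near +oo, forall w, A w -> p t w) -> likely p.
Proof.
move=> mA PA Ap e e0; apply: filterS Ap => t Apt; exists A; split => //.
by rewrite PA gerBl ltW.
Qed.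

Lemma likely_Ex (Z : R -> T -> R) (l : R) :
  (forall t, measurable_fun setT (Z t)) -> (forall t w, 0 <= Z t w <= 1) -> 0 <= l <= 1 ->
  (forall e, 0 < e -> likely (fun t w => `|Z t w - l| <= e)) ->
  \int[P]_w Z t w @[t --> +oo] --> l.
Proof.
move=> mZ Z01 /andP[l0 l1] lZ; apply/cvgrPdist_le => e e0.
have e20 : 0 < e / 2 by rewrite divr_gt0.
apply: filterS (lZ _ e20 _ e20) => t [A [mA PA At]].
have bZ : bounded_measurable (Z t) by exact: bm_unit.
have bl := @bm_cst _ T R l; have be := @bm_cst _ T R (e / 2).
have mC := measurableC mA; have bC := @bm_indic _ T R _ mC.
have {}PA : pr P (~` A) <= e / 2 by rewrite prC//; lra.
have hw w : `|Z t w - l| <= e / 2 + \1_(~` A) w.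
  rewrite indicE; have [/set_mem wA|wA] := boolP (w \in ~` A) => /=.
    have /andP[? ?] := Z01 t w; rewrite ler_norml; apply/andP; split; lra.
  by rewrite addr0; apply: At; apply: contrapT => nA; move/negP: wA; apply; rewrite inE.
have h1 : \int[P]_w Z t w <= l + (e / 2 + pr P (~` A)).
  rewrite -(Ex_indic P mC) -{1}(Ex_cst P l) -{1}(Ex_cst P (e / 2)) -!ExD//; last exact: bmD.
  apply: Ex_le => //; first by apply: bmD => //; exact: bmD.
  by move=> w; have := hw w; rewrite ler_norml => /andP[_]; lra.
have h2 : l <= \int[P]_w Z t w + (e / 2 + pr P (~` A)).
  rewrite -(Ex_indic P mC) -{1}(Ex_cst P l) -{1}(Ex_cst P (e / 2)) -!ExD//; last exact: bmD.
  apply: Ex_le => //; first by apply: bmD => //; exact: bmD.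
  by move=> w; have := hw w; rewrite ler_norml => /andP[+ _]; lra.
by rewrite ler_norml; apply/andP; split; lra.
Qed.

(** Chebyshev's inequality. *)
Lemma likely_quadratic (Z : R -> T -> R) (c e : R) :
  (forall t, bounded_measurable (Z t)) -> 0 < e ->
  \int[P]_w ((Z t w - c) ^+ 2) @[t --> +oo] --> 0 ->
  likely (fun t w => `|Z t w - c| < e).
Proof.
move=> bZ e0 h eta eta0.
have ee : 0 < eta * e ^+ 2 by rewrite mulr_gt0// exprn_gt0.
have /cvgrPdist_le/(_ _ ee) := h; apply: filterS => t.
rewrite sub0r normrN => ht.
have bq : bounded_measurable (fun w => (Z t w - c) ^+ 2).
  by apply: bmX; apply: bmB => //; exact: bm_cst.
have mE : measurable_fun setT (fun w => `|Z t w - c|).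
  by apply: measurableT_comp => //; apply: measurable_funB => //; have [] := bZ t.
have mA : measurable [set w | `|Z t w - c| < e] by exact: measurable_lt.
exists [set w | `|Z t w - c| < e]; split => //.
suff : pr P (~` [set w | `|Z t w - c| < e]) <= eta by rewrite prC//; lra.
have mC := measurableC mA.
rewrite -(ler_pM2r (_ : 0 < e ^+ 2)) ?exprn_gt0//.
apply: le_trans ht; apply: le_trans (ler_norm _).
rewrite mulrC -Ex_indic// -ExZ; last exact: bm_indic.
apply: Ex_le => //; first by apply: bmZ; exact: bm_indic.
move=> w; rewrite indicE; have [/set_mem/= /negP|_] := boolP (w \in _); last first.
  by rewrite mulr0 sqr_ge0.
rewrite -leNgt mulr1 => he; rewrite -[leRHS]real_normK ?num_real//.
by rewrite ler_pXn2r ?nnegrE// ltW.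
Qed.

End likely.

(** * Finite mean *)

Section finite_mean.
Context {R : realType} {d : measure_display} {T : measurableType d} (P : probability T R).
Variable X : T -> R.
Hypothesis mX : measurable_fun setT X.
Let G (x : R) : R := pr P [set w | x < `|X w|].
Variable alpha : R.
Hypothesis alpha_gt1 : 1 < alpha.
Hypothesis G_gt0 : forall x, 0 < G x.
Hypothesis G_rv : forall c, 0 < c -> G (c * x) / G x @[x --> +oo] --> c `^ (- alpha).

Lemma sum_geometric_le (q : R) n : 0 <= q < 1 -> \sum_(0 <= k < n) q ^+ k <= (1 - q)^-1.
Proof.
move=> /andP[q0 q1]; have q10 : 0 < 1 - q by rewrite subr_gt0.
rewrite -[leRHS]mulr1 ler_pdivlMl//.
suff -> : (1 - q) * \sum_(0 <= k < n) q ^+ k = 1 - q ^+ n by rewrite gerBl exprn_ge0.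
elim: n => [|n IH]; first by rewrite big_nil mulr0 expr0 subrr.
by rewrite big_nat_recr//= mulrDr IH exprS; ring.
Qed.

(** Summation over dyadic scales: |X| is at most x0 plus the sum of 2^(k + 1) x0 over the k
    with |X| > 2^k x0, and G (2^k x0) decays like 2^(- rho k) with 1 < rho < alpha. *)
Lemma regular_integrable : (\int[P]_w `|X w|%:E < +oo)%E.
Proof.
pose rho := (1 + alpha) / 2.
have a1 : 1 < alpha := alpha_gt1.
have r1 : 1 < rho by rewrite /rho; lra.
have ra : rho < alpha by rewrite /rho; lra.
have [x0 x00 dbl] := regular_doubling_le G_gt0 G_rv ra.
pose q : R := 2 * 2 `^ (- rho).
have q0 : 0 <= q by rewrite mulr_ge0// powR_ge0.
have q1 : q < 1.
  rewrite /q -{1}(@powRr1 R 2)// -powRD ?pnatr_eq0 ?implybT//.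
  by rewrite /powR pnatr_eq0/= expR_lt1 pmulr_llt0 ?ln_gt0 ?ltr1n//; lra.
have Gk k : G (2 ^+ k * x0) <= (2 `^ (- rho)) ^+ k.
  elim: k => [|k IH]; first by rewrite !expr0 mul1r; exact: tail_le1.
  rewrite !exprS -mulrA; apply: (le_trans (dbl _ _)).
    by rewrite ler_peMl ?(ltW x00)// exprn_ege1// ler1n.
  by rewrite ler_wpM2l// powR_ge0.
pose A k := [set w | 2 ^+ k * x0 < `|X w|].
have mA k : measurable (A k) by exact: measurable_gt_norm.
pose f k w : \bar R := (2 ^+ k.+1 * x0 * \1_(A k) w)%:E.
have c0 k : 0 <= 2 ^+ k.+1 * x0 by rewrite mulr_ge0 ?exprn_ge0// ltW.
have f0 k w : (0 <= f k w)%E.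
  by rewrite lee_fin mulr_ge0//; have /andP[] := @indic01 R _ (A k) w.
have mf k : measurable_fun setT (f k).
  by apply/measurable_EFinP; apply: measurable_funM.
have mXe : measurable_fun setT (fun w => `|X w|%:E).
  by apply/measurable_EFinP; exact: measurableT_comp.
have mS : measurable_fun setT (fun w => \sum_(k <oo) f k w)%E.
  by apply: ge0_emeasurable_sum.
apply: (@le_lt_trans _ _ (\int[P]_w (x0%:E + \sum_(k <oo) f k w))%E).
  apply: ge0_le_integral => //.
  - exact: emeasurable_funD.
  move=> w _; have [Xw|Xw] := leP `|X w| x0.
    by apply: (@le_trans _ _ x0%:E); rewrite ?lee_fin// leeDl//; exact: nneseries_ge0.
  have z1 : 1 <= `|X w| / x0 by rewrite ler_pdivlMr// mul1r ltW.
  have [[|k] /andP[]] := dyadic_bracket z1.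
    by rewrite expr0 ler_pdivrMr// mul1r leNgt Xw.
  rewrite ler_pdivrMr// => h1; rewrite exprS ltr_pM2l// ltr_pdivlMr// => h2.
  apply: (@le_trans _ _ (f k w)).
    by rewrite /f lee_fin indicE mem_set ?mulr1.
  apply: (@le_trans _ _ (\sum_(k <oo) f k w)%E); last first.
    by rewrite leeDr// lee_fin ltW.
  apply: le_trans (nneseries_lim_ge k.+1 _); last by move=> *.
  by rewrite big_nat_recr//= leeDr// sume_ge0.
rewrite ge0_integralD//; last 2 first.
- by move=> w _; rewrite lee_fin ltW.
- by move=> w _; exact: nneseries_ge0.
apply: lte_add_pinfty.
  by rewrite integral_cst//= probability_setT mule1 ltry.
rewrite integral_nneseries//.
apply: (@le_lt_trans _ _ (2 * x0 * (1 - q)^-1)%:E); last exact: ltry.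
apply: lime_le; first by apply: is_cvg_nneseries => k _ _; exact: integral_ge0.
apply: nearW => n.
apply: (@le_trans _ _ (\sum_(0 <= k < n) (2 * x0 * q ^+ k)%:E)%E).
  apply: lee_sum => k _.
  have -> : (\int[P]_w f k w = (2 ^+ k.+1 * x0 * G (2 ^+ k * x0))%:E)%E.
    have := bm_expectation P (bmZ (2 ^+ k.+1 * x0) (@bm_indic _ _ R _ (mA k))).
    by rewrite unlock => ->; rewrite ExZ ?Ex_indic//; exact: bm_indic.
  rewrite lee_fin; apply: (le_trans (ler_wpM2l (c0 k) (Gk k))).
  by rewrite /q exprMn exprS mulrACA mulrA lexx.
rewrite sumEFin lee_fin -mulr_sumr ler_wpM2l//; last by rewrite sum_geometric_le// q0.
by rewrite mulr_ge0// ltW.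
Qed.

End finite_mean.

(** * The random number of observations *)

Section averages_in_time.
Context {R : realType} {d : measure_display} {T : measurableType d} (P : probability T R).
Context {d' : measure_display} {T' : measurableType d'} (Q : probability T' R).
Variables (N : R -> {RV P >-> nat}) (Lam : {RV Q >-> R}).
Hypothesis Lam_gt0 : Q [set w | 0 < Lam w] = 1%E.
Hypothesis N_Lam : cvg_in_distribution P (fun t w => (N t w)%:R / t) Q Lam.

Lemma measurable_natr (n : {RV P >-> nat}) (f : nat -> R) : measurable_fun setT (fun w => f (n w)).
Proof.
exact: (measurable_random_index (measurable_RV_nat n) (F := fun k _ => f k)).
Qed.

Lemma measurable_RV {d2} {T2 : measurableType d2} (P2 : probability T2 R) (Y : {RV P2 >-> R}) :
  measurable_fun setT Y.
Proof. exact: measurable_funP. Qed.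

Lemma pr_Lam_le0 : pr Q (Lam @^-1` `]-oo, 0]) = 0.
Proof.
have mL : measurable [set w | 0 < Lam w].
  by apply: measurable_lt => //; exact: measurable_RV.
have -> : Lam @^-1` `]-oo, 0] = ~` [set w | 0 < Lam w].
  by apply/seteqP; split => w /=; rewrite in_itv/= leNgt => /negP.
by rewrite prC// (pr_seq1 mL)// subrr.
Qed.

Lemma N_interlaced : interlaced (fun t x => pr P ((fun w => (N t w)%:R / t) @^-1` `]-oo, x]))
  (fun x => pr Q (Lam @^-1` `]-oo, x])).
Proof.
apply: cvg_in_distribution_interlaced => // t.
by apply: measurable_funM => //; exact: measurable_natr.
Qed.

(** N / t stays above some a > 0 with high probability, since Lam > 0 almost
    surely. *)
Lemma likely_N_ge (m : R) : likely P (fun t w => m <= (N t w)%:R).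
Proof.
move=> e e0; have e20 : 0 < e / 2 by rewrite divr_gt0.
have [a a0 La] := cdf_right_small e20 (measurable_RV Lam) pr_Lam_le0.
have aa : a / 2 < a by rewrite gtr_pMr// invf_lt1// ltr1n.
have := N_interlaced aa e20.
have mt : \forall t \near +oo, 0 < t :> R by apply: nbhs_pinfty_gt; exact: num_real.
have mt2 : \forall t \near +oo, m / (a / 2) <= t by apply: nbhs_pinfty_ge; exact: num_real.
apply: filterS3 mt mt2 => t t0 tm [h _].
have mB : measurable ((fun w => (N t w)%:R / t) @^-1` `]-oo, a / 2]).
  by apply: measurable_le; apply: measurable_funM => //; exact: measurable_natr.
exists (~` ((fun w => (N t w)%:R / t) @^-1` `]-oo, a / 2])); split.
- exact: measurableC.
- by rewrite prC//; lra.
move=> w /=; rewrite in_itv/= => /negP; rewrite -ltNge ltr_pdivlMr// => /ltW.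
by apply: le_trans; rewrite mulrC -ler_pdivrMr// divr_gt0.
Qed.

Lemma likely_N_small (c : R -> R) (e : R) : c t @[t --> +oo] --> 0 -> 0 < e ->
  likely P (fun t w => `|(N t w)%:R / t * c t| <= e).
Proof.
move=> c0 e0 eta eta0; have e20 : 0 < eta / 2 by rewrite divr_gt0.
have [b Lb] := cdf_left_large Q e20 (measurable_RV Lam).
have bb : b < b + 1 by rewrite ltrDl.
have := N_interlaced bb e20.
have b0 : 0 < `|b| + 1 by rewrite ltr_wpDl.
have eb : 0 < e / (`|b| + 1) by rewrite divr_gt0.
have mt : \forall t \near +oo, 0 < t :> R by apply: nbhs_pinfty_gt; exact: num_real.
have /cvgrPdist_le/(_ _ eb) := c0.
apply: filterS3 mt => t t0; rewrite sub0r normrN => ct [_ h].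
have mB : measurable ((fun w => (N t w)%:R / t) @^-1` `]-oo, b + 1]).
  by apply: measurable_le; apply: measurable_funM => //; exact: measurable_natr.
exists ((fun w => (N t w)%:R / t) @^-1` `]-oo, b + 1]); split => //; first by lra.
move=> w /=; rewrite in_itv/= => Nb.
rewrite normrM ger0_norm; last by rewrite divr_ge0// ltW.
rewrite [leRHS](_ : e = (`|b| + 1) * (e / (`|b| + 1))); last first.
  by rewrite mulrCA divff ?mulr1// gt_eqF.
rewrite ler_pM// ?divr_ge0 ?(ltW t0)//.
by rewrite (le_trans Nb)// lerD2r ler_norm.
Qed.

End averages_in_time.

(** * Law of large numbers *)

Section law_of_large_numbers.
Context {R : realType} {d : measure_display} {T : measurableType d} (P : probability T R).
Variables (X : {RV P >-> R}).
Hypothesis X_int : (\int[P]_w `|X w|%:E < +oo)%E.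

Lemma integrable_scaled_norm (s : R) : P.-integrable setT (fun w => (s * `|X w|)%:E).
Proof.
have iX : P.-integrable setT (fun w => `|X w|%:E).
  apply/integrableP; split.
    by apply/measurable_EFinP; apply: measurableT_comp => //; exact: measurable_funP.
  by under eq_integral do rewrite /= normr_id.
by under eq_fun do rewrite EFinM; exact: integrableZl.
Qed.

(** The weak law of large numbers in terms of transforms: by dominated convergence
    n (1 - E exp (- s |X| / n)) tends to s E |X|. *)
Lemma mean_laplace_cvg (s : R) : 0 <= s ->
  (\int[P]_w expR (- (s / n%:R * `|X w|))) ^+ n @[n --> \oo] -->
  expR (- (s * \int[P]_w `|X w|)).
Proof.
move=> s0; have mX : measurable_fun setT (fun w => `|X w|).
  by apply: measurableT_comp => //; exact: measurable_funP.
have sn0 n : 0 <= s / n%:R by rewrite divr_ge0.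
have bL n : bounded_measurable (fun w => expR (- (s / n%:R * `|X w|))) by exact: bm_laplace.
pose p n := 1 - \int[P]_w expR (- (s / n%:R * `|X w|)).
have p01 n : 0 <= p n <= 1.
  have /andP[h0 h1] : 0 <= \int[P]_w expR (- (s / n%:R * `|X w|)) <= 1.
    apply: Ex_unit; first by have [] := bL n.
    by move=> w; rewrite expRN01// mulr_ge0.
  by rewrite /p subr_ge0 h1 gerBl.
suff np : n%:R * p n @[n --> \oo] --> s * \int[P]_w `|X w|.
  have := cvg_1Bexpn p01 np; apply: cvg_trans; apply: near_eq_cvg.
  by apply: nearW => n; rewrite /p opprB addrCA subrr addr0.
have h1 : P.-integrable setT (EFin \o (fun w => `|X w|)).
  by have := integrable_scaled_norm 1; apply: eq_integrable => // w _ /=; rewrite mul1r.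
rewrite -RintegralZl// -(cvg_shiftS (fun n => n%:R * p n)).
pose f_ n w : \bar R := (n.+1%:R * (1 - expR (- (n.+1%:R^-1 * (s * `|X w|)))))%:E.
have mf_ n : measurable_fun setT (f_ n).
  apply/measurable_EFinP; apply: measurable_funM => //; apply: measurable_funB => //.
  apply: measurable_laplace; exact: measurable_funM.
have mf : measurable_fun setT (fun w => (s * `|X w|)%:E).
  by apply/measurable_EFinP; exact: measurable_funM.
have sX w : 0 <= s * `|X w| by rewrite mulr_ge0.
have := @dominated_convergence _ T R P setT measurableT f_ _ _ mf_ mf _ (integrable_scaled_norm s) _.
case.
- by apply: aeW => w _; apply: cvg_EFin; [exact: nearW|exact: cvg_1BexpR].
- apply: aeW => w n _; rewrite lee_fin ger0_norm.
    rewrite -ler_pdivlMl// lerBlDl -lerBlDr.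
    by have := expR_ge1Dx (- (n.+1%:R^-1 * (s * `|X w|))).
  by rewrite mulr_ge0// subr_ge0 -expR0 ler_expR oppr_le0 mulr_ge0 ?invr_ge0.
move=> _ _ h.
have {}h : (\int[P]_w f_ n w)%E @[n --> \oo] --> (\int[P]_w (s * `|X w|))%:E.
  by rewrite /Rintegral fineK//; exact: (integrable_fin_num _ (integrable_scaled_norm s)).
move/fine_cvg : h; apply: cvg_trans; apply: near_eq_cvg; apply: nearW => n /=.
have b1 := @bm_cst _ T R 1.
have -> : p n.+1 = \int[P]_w (1 - expR (- (s / n.+1%:R * `|X w|))).
  by rewrite ExB// Ex_cst.
rewrite -ExZ; last exact: bmB.
rewrite /f_ /Rintegral; congr fine; apply: eq_integral => w _.
by congr (_ * (_ - expR (- _)))%:E; rewrite mulrA (mulrC s).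
Qed.

Context {d' : measure_display} {T' : measurableType d'} (Q : probability T' R).
Variables (Xs : nat -> {RV P >-> R}) (N : R -> {RV P >-> nat}) (Lam : {RV Q >-> R}).
Hypothesis Xs_indep : mutually_independent P Xs.
Hypothesis XsX : forall i, same_distribution (Xs i) X.
Hypothesis XN_indep : forall t A n, 0 <= t -> generated_sigma_algebra [set: nat] Xs A ->
  P (A `&` N t @^-1` [set n]) = (P A * P (N t @^-1` [set n]))%E.
Hypothesis Lam_gt0 : Q [set w | 0 < Lam w] = 1%E.
Hypothesis N_Lam : cvg_in_distribution P (fun t w => (N t w)%:R / t) Q Lam.

(** Conditionally on N = n the transform of the sample mean is the n-th term of the
    sequence in mean_laplace_cvg, and N tends to infinity in probability. *)
Lemma laplace_random_mean (s : R) : 0 <= s ->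
  \int[P]_w expR (- (s * ((\sum_(i < N t w) `|Xs i w|) / (N t w)%:R))) @[t --> +oo] -->
  expR (- (s * \int[P]_w `|X w|)).
Proof.
move=> s0; have mX : measurable_fun setT (fun w => `|X w|).
  by apply: measurableT_comp => //; exact: measurable_funP.
pose phi n := (\int[P]_w expR (- (s / n%:R * `|X w|))) ^+ n.
have fn01 n (y : R) : 0 <= expR (- (s / n%:R * `|y|)) <= 1.
  by rewrite expRN01// !mulr_ge0// invr_ge0.
have mfn (n : nat) : measurable_fun setT (fun y : R => expR (- (s / n%:R * `|y|))).
  by apply: measurable_laplace; exact: normr_measurable.
have phi01 n : 0 <= phi n <= 1.
  have /andP[h0 h1] : 0 <= \int[P]_w expR (- (s / n%:R * `|X w|)) <= 1.
    apply: Ex_unit => [|w]; last exact: fn01.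
    by apply: (measurableT_comp (mfn n)); exact: measurable_funP.
  by rewrite exprn_ge0//= exprn_ile1.
have muX : 0 <= \int[P]_w `|X w| by exact: Ex_ge0.
suff : \int[P]_w phi (N t w) @[t --> +oo] --> expR (- (s * \int[P]_w `|X w|)).
  apply: cvg_trans; apply: near_eq_cvg; near=> t.
  have t0 : 0 <= t by near: t; apply: nbhs_pinfty_ge; exact: num_real.
  rewrite /phi -(Ex_random_product Xs_indep (fun A n => XN_indep n t0 (A:=A)) XsX mfn fn01).
  apply: eq_Rintegral => w _; rewrite -expR_sum sumrN; congr (expR (- _)).
  by rewrite -mulr_sumr mulrA mulrAC.
apply: likely_Ex => [t|t w| |e e0].
- exact: measurable_natr.
- exact: phi01.
- by rewrite expRN01// mulr_ge0.
have /cvgrPdist_le/(_ _ e0)[n _ hn] := mean_laplace_cvg s0.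
apply: likely_imp (likely_N_ge Lam_gt0 N_Lam n%:R) _; apply: nearW => t w.
by rewrite ler_nat distrC => /hn.
Unshelve. all: by end_near. Qed.

(** The Laplace transforms at 1 and 2 show that exp(-Z) converges to its limit in
    mean square, where Z is the sample mean. *)
Lemma likely_random_mean (e : R) : 0 < e ->
  likely P (fun t w =>
    `|(\sum_(i < N t w) `|Xs i w|) / (N t w)%:R - \int[P]_w `|X w| | < e).
Proof.
move=> e0; set m := \int[P]_w `|X w|.
pose Z t w := (\sum_(i < N t w) `|Xs i w|) / (N t w)%:R.
have mZ t : measurable_fun setT (Z t).
  apply: (measurable_random_index (measurable_RV_nat (N t))
    (F := fun n w => (\sum_(i < n) `|Xs i w|) / n%:R)) => n.
  apply: measurable_funM => //; apply: measurable_sum => i.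
  by apply: measurableT_comp => //; exact: measurable_funP.
have Z0 t w : 0 <= Z t w by rewrite divr_ge0// sumr_ge0.
have bE s t : 0 <= s -> bounded_measurable (fun w => expR (- (s * Z t w))).
  by move=> s0; exact: bm_laplace.
have b1 t : bounded_measurable (fun w => expR (- Z t w)).
  by have := bE 1 t ler01; under eq_fun do rewrite mul1r.
pose dl := Num.min (expR (- m) - expR (- (m + e))) (expR (- (m - e)) - expR (- m)).
have dl0 : 0 < dl.
  by rewrite lt_min !subr_gt0 !ltr_expR !ltrN2 ltrDl gtrBl e0.
have : likely P (fun t w => `|expR (- Z t w) - expR (- m)| < dl).
  apply: likely_quadratic => //.
  have E t : \int[P]_w ((expR (- Z t w) - expR (- m)) ^+ 2) =
      \int[P]_w expR (- (2 * Z t w)) - 2 * expR (- m) * \int[P]_w expR (- (1 * Z t w))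
      + expR (- m) ^+ 2.
    rewrite -[X in _ + X](Ex_cst P) -ExZ; last exact: bE.
    have bk := @bm_cst _ T R (expR (- m) ^+ 2).
    have bz := bmZ (2 * expR (- m)) (bE 1 t ler01).
    have b2 := bE 2 t (ler0n _ _).
    rewrite -ExB// -ExD//; last exact: bmB.
    apply: eq_Rintegral => w _; rewrite mul1r sqrrB; congr (_ - _ + _).
      by rewrite -expRM_natl mulrN.
    by rewrite -mulr_natl mulrAC mulrA.
  under eq_fun do rewrite E.
  have -> : 0 = expR (- (2 * m)) - 2 * expR (- m) * expR (- (1 * m)) + expR (- m) ^+ 2 :> R.
    by rewrite mul1r -mulrN expRM_natl; ring.
  apply: cvgD; last exact: cvg_cst.
  apply: cvgB; first exact: laplace_random_mean.
  by apply: cvgMr; exact: laplace_random_mean.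
move=> h; apply: likely_imp h _; apply: nearW => t w; rewrite -/(Z t w).
rewrite lt_min => /andP[h1 h2]; rewrite ltNge; apply/negP => he.
have [mz|zm] := leP m (Z t w).
  move: he; rewrite ger0_norm ?subr_ge0// lerBrDl => he.
  move: h1; rewrite distrC ger0_norm ?subr_ge0 ?ler_expR ?lerN2//.
  by rewrite ltrD2l ltrN2 ltr_expR ltrN2 ltNge he.
move: he; rewrite distrC ger0_norm ?subr_ge0 ?(ltW zm)// lerBrDr -lerBrDl => he.
move: h2; rewrite ger0_norm ?subr_ge0 ?ler_expR ?lerN2 ?(ltW zm)//.
by rewrite ltrD2r ltr_expR ltrN2 ltNge; have -> : Z t w <= m - e by lra.
Qed.

End law_of_large_numbers.

(** * Random sums of squares *)

Section slutsky.
Context {R : realType} {d : measure_display} {T : measurableType d} (P : probability T R).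
Context {d' : measure_display} {T' : measurableType d'} (Q : probability T' R).

(** Slutsky's theorem: on the likely event where A is close to c and B to 0, Y <= x implies
    that W is at most x / c up to a small shift, and conversely. *)
Lemma slutsky (W A B Y : R -> T -> R) (V : T' -> R) (c : R) :
  (forall t, measurable_fun setT (W t)) -> (forall t w, 0 <= W t w) ->
  (forall t, measurable_fun setT (Y t)) -> measurable_fun setT V ->
  interlaced (fun t x => pr P (W t @^-1` `]-oo, x])) (fun x => pr Q (V @^-1` `]-oo, x])) ->
  0 < c ->
  (forall e, 0 < e -> likely P (fun t w => `|A t w - c| <= e)) ->
  (forall e, 0 < e -> likely P (fun t w => `|B t w| <= e)) ->
  (\forall t \near +oo, forall w, Y t w = A t w * W t w - B t w) ->
  cvg_in_distribution P Y Q (fun w => c * V w).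
Proof.
move=> mW W0 mY mV WV c0 Ac B0 YE.
apply: interlaced_cvg_in_distribution => //; first exact: measurable_funM.
have pre x : (fun w => c * V w) @^-1` `]-oo, x] = V @^-1` `]-oo, x / c].
  by apply/seteqP; split => w /=; rewrite !in_itv/= ler_pdivlMr// mulrC.
move=> x y e xy e0; rewrite !pre.
have e20 : 0 < e / 2 by rewrite divr_gt0.
(* In each of the two inequalities the errors in A and B take up two thirds of the
   room between x / c and y / c, and interlacing the remaining third. *)
have [eta [eta0 etac h1 h2]] : exists eta, [/\ 0 < eta, eta < c,
    (x + eta) / (c - eta) <= (x / c + 2 * (y / c)) / 3 &
    (c + eta) * ((2 * (x / c) + y / c) / 3) + eta <= y].
  have xyc : x / c < y / c by rewrite ltr_pM2r ?invr_gt0.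
  have l1 : (x + eta) / (c - eta) @[eta --> 0^'+] --> (x + 0) / (c - 0).
    apply: cvg_at_right_filter; apply: cvgM.
      by apply: cvgD; [exact: cvg_cst|exact: cvg_id].
    apply: cvgV; first by rewrite subr0 gt_eqF.
    by apply: cvgB; [exact: cvg_cst|exact: cvg_id].
  have l2 : (c + eta) * ((2 * (x / c) + y / c) / 3) + eta @[eta --> 0^'+] -->
      (c + 0) * ((2 * (x / c) + y / c) / 3) + 0.
    apply: cvg_at_right_filter; apply: cvgD; last exact: cvg_id.
    apply: cvgMl; apply: cvgD; [exact: cvg_cst|exact: cvg_id].
  have b1 : (x + 0) / (c - 0) < (x / c + 2 * (y / c)) / 3.
    by rewrite addr0 subr0; lra.
  have b2 : (c + 0) * ((2 * (x / c) + y / c) / 3) + 0 < y.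
    rewrite !addr0 (_ : c * _ = (2 * x + y) / 3); first by lra.
    by field; rewrite gt_eqF.
  near (0:R)^'+ => eta; exists eta; split.
  - by near: eta; exact: nbhs_right_gt.
  - by near: eta; exact: nbhs_right_lt.
  - by near: eta; exact: cvgr_le l1 _ b1.
  - by near: eta; exact: cvgr_le l2 _ b2.
have xyc : x / c < y / c by rewrite ltr_pM2r ?invr_gt0.
have i1 : (x / c + 2 * (y / c)) / 3 < y / c by lra.
have i2 : x / c < (2 * (x / c) + y / c) / 3 by lra.
have AB := likely_and (Ac _ eta0) (B0 _ eta0).
apply: filter_app (WV _ _ _ i1 e20); apply: filter_app (WV _ _ _ i2 e20).
apply: filterS2 (AB _ e20) YE => t [D [mD PD Dh]] Yt [_ w2] [w1 _].
have mC := measurableC mD.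
have PC : pr P (~` D) <= e / 2 by rewrite prC//; lra.
have mle (f : T -> R) z := @measurable_le R _ T f z.
have ce : 0 < c - eta by rewrite subr_gt0.
have bnd w : D w -> (c - eta) * W t w - eta <= Y t w <= (c + eta) * W t w + eta.
  move=> /Dh[]; rewrite !ler_norml => /andP[a1 a2] /andP[b1 b2].
  have w0 := W0 t w; rewrite Yt; apply/andP; split.
    by rewrite lerB// ler_wpM2r//; lra.
  by apply: lerD; [rewrite ler_wpM2r//|]; lra.
split.
  have : pr P (Y t @^-1` `]-oo, x]) <= pr P ((W t @^-1` `]-oo, (x / c + 2 * (y / c)) / 3]) `|` ~` D).
    apply: le_pr; [exact: mle|apply: measurableU => //; exact: mle|].
    move=> w /=; rewrite !in_itv/= => Yx; have [wD|] := pselect (D w); last by right.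
    left; apply: le_trans h1; rewrite ler_pdivlMr// mulrC -lerBlDr.
    by have /andP[h _] := bnd w wD; exact: le_trans h Yx.
  have := prU P (mle (W t) ((x / c + 2 * (y / c)) / 3) (mW t)) mC.
  by lra.
have : pr P (W t @^-1` `]-oo, (2 * (x / c) + y / c) / 3]) <= pr P ((Y t @^-1` `]-oo, y]) `|` ~` D).
  apply: le_pr; [exact: mle|apply: measurableU => //; exact: mle|].
  move=> w /=; rewrite !in_itv/= => Wx; have [wD|] := pselect (D w); last by right.
  left; have /andP[_ h] := bnd w wD; apply: (le_trans h); apply: le_trans h2.
  by rewrite lerD2r ler_pM2l// addr_gt0.
have := prU P (mle (Y t) y (mY t)) mC.
by lra.
Unshelve. all: by end_near. Qed.

End slutsky.

(** The limit of the transforms of the sums of squares as functions of N / t; the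
    extension by 1 to the negative reals gives it half-line levels. *)
Definition stretched_exp {R : realType} (k p x : R) : R :=
  expR (- (k * Num.max x 0 `^ p)).

Section stretched.
Context {R : realType}.

Lemma measurable_stretched (k p : R) : measurable_fun setT (stretched_exp k p).
Proof.
apply: measurable_laplace.
apply: (measurableT_comp (@measurable_powR R p)).
exact: measurable_maxr.
Qed.

Lemma stretched01 (k p : R) x : 0 <= k -> 0 <= stretched_exp k p x <= 1.
Proof. by move=> k0; rewrite expRN01// mulr_ge0// powR_ge0. Qed.

Lemma stretched_levels (k p : R) : 0 < k -> 0 < p -> half_line_levels (stretched_exp k p).
Proof.
move=> k0 p0 u /andP[u0 u1].
have v0 : 0 < - ln u / k by rewrite divr_gt0// oppr_gt0 ln_lt0// u0.
pose x := (- ln u / k) `^ p^-1.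
have x0 : 0 < x by rewrite powR_gt0.
have xp : x `^ p = - ln u / k by rewrite -powRrM mulVf ?gt_eqF// powRr1// ltW.
have hx : stretched_exp k p x = u.
  rewrite /stretched_exp max_l ?(ltW x0)// xp mulrCA divff ?gt_eqF// mulr1 opprK.
  by rewrite lnK.
exists x => // y; rewrite -{1}hx /stretched_exp ler_expR lerN2 ler_pM2l//.
have m0 : 0 <= Num.max y 0 by rewrite le_max lexx orbT.
rewrite [Num.max x 0]max_l ?(ltW x0)//; apply/idP/idP => [h|yx].
  rewrite leNgt; apply/negP => xy; move: h; rewrite leNgt => /negP; apply.
  rewrite max_l; last by rewrite ltW// (lt_trans x0).
  by rewrite gt0_ltr_powR// nnegrE ltW// (lt_trans x0).
by rewrite ge0_ler_powR// ?nnegrE ?(ltW p0) ?(ltW x0)// ge_max yx ltW.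
Qed.

End stretched.

Section random_sum_of_squares.
Context {R : realType} {d : measure_display} {T : measurableType d} (P : probability T R).
Context {d' : measure_display} {T' : measurableType d'} (Q : probability T' R).
Variables (X : {RV P >-> R}) (Xs : nat -> {RV P >-> R}) (N : R -> {RV P >-> nat}).
Variable Lam : {RV Q >-> R}.
Hypothesis Xs_indep : mutually_independent P Xs.
Hypothesis XsX : forall i, same_distribution (Xs i) X.
Hypothesis XN_indep : forall t A n, 0 <= t -> generated_sigma_algebra [set: nat] Xs A ->
  P (A `&` N t @^-1` [set n]) = (P A * P (N t @^-1` [set n]))%E.
Hypothesis Lam_gt0 : Q [set w | 0 < Lam w] = 1%E.
Hypothesis N_Lam : cvg_in_distribution P (fun t w => (N t w)%:R / t) Q Lam.
Let G (x : R) : R := pr P [set w | x < `|X w|].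
Variables (alpha : R) (a : R -> R).
Hypothesis alpha_bnd : 0 < alpha < 2.
Hypothesis G_gt0 : forall x, 0 < G x.
Hypothesis G_rv : forall c, 0 < c -> G (c * x) / G x @[x --> +oo] --> c `^ (- alpha).
Hypothesis a_y : a t @[t --> +oo] --> +oo.
Hypothesis a_G : t * G (a t) @[t --> +oo] --> (1 : R).
Let phi (l : R) : R := \int[P]_w expR (- (l * X w ^+ 2)).
Let Gam : R := gamma_fun (1 - alpha / 2).

(** Since t G (a_t) tends to 1, this is laplace_sqr_asymptotics along b = a_t. *)
Lemma phi_tail_cvg (r : R) : 0 < r ->
  t * (1 - phi (r / a t ^+ 2)) @[t --> +oo] --> r `^ (alpha / 2) * Gam.
Proof.
move=> r0; have := laplace_sqr_asymptotics (measurable_funP X) alpha_bnd G_gt0 G_rv r0.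
move=> /(cvg_comp _ _ a_y) h.
have : (t * G (a t)) * ((1 - phi (r / a t ^+ 2)) / G (a t)) @[t --> +oo] -->
    1 * (r `^ (alpha / 2) * Gam) by exact: cvgM.
rewrite mul1r.
apply: cvg_trans; apply: near_eq_cvg; apply: nearW => t /=.
by rewrite mulrACA divff ?gt_eqF// mulr1.
Qed.

Lemma phi01 (l : R) : 0 <= l -> 0 <= phi l <= 1.
Proof.
move=> l0; apply: Ex_unit => [|w]; last by rewrite expRN01// mulr_ge0// sqr_ge0.
by apply: measurable_laplace; apply: measurable_funX; exact: measurable_funP.
Qed.

Lemma bm_phi (l : R) : 0 <= l -> bounded_measurable (fun w => expR (- (l * X w ^+ 2))).
Proof.
move=> l0; apply: bm_laplace => //; last by move=> w; exact: sqr_ge0.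
by apply: measurable_funX; exact: measurable_funP.
Qed.

Lemma phi_noninc (l m : R) : 0 <= l -> l <= m -> phi m <= phi l.
Proof.
move=> l0 lm; apply: Ex_le; [by apply: bm_phi; exact: le_trans lm|exact: bm_phi|].
by move=> w; rewrite ler_expR lerN2 ler_wpM2r// sqr_ge0.
Qed.

Lemma tail_lt1 : exists2 c, 0 <= c & G c < 1.
Proof.
have h : \forall t \near +oo, t * G (a t) < 2.
  by apply: cvgr_lt a_G _ _; rewrite ltr1n.
near (+oo : set_system R) => t; exists `|a t| => //.
have t2 : 2 < t by near: t; apply: nbhs_pinfty_gt; exact: num_real.
have t0 : 0 < t by apply: lt_trans t2.
apply: (@le_lt_trans _ _ (G (a t))).
  by apply: (tail_noninc P (measurable_funP X)); exact: ler_norm.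
rewrite -(ltr_pM2l t0) mulr1; apply: lt_trans t2.
by near: t.
Unshelve. all: by end_near. Qed.

Lemma phi_gt0 (l : R) : 0 <= l -> 0 < phi l.
Proof.
move=> l0; have [c c0 Gc] := tail_lt1.
have mA : measurable [set w | c < `|X w|] by apply: measurable_gt_norm; exact: measurable_funP.
have mC := measurableC mA; have bI := @bm_indic _ T R _ mC.
apply: (@lt_le_trans _ _ (expR (- (l * c ^+ 2)) * pr P (~` [set w | c < `|X w|]))).
  by rewrite mulr_gt0 ?expR_gt0// prC// subr_gt0.
rewrite -Ex_indic// -ExZ//; apply: Ex_le; [exact: bmZ|exact: bm_phi|move=> w].
rewrite indicE; have [/set_mem/= /negP|_] := boolP (w \in _); last first.
  by rewrite mulr0 expR_ge0.
rewrite -leNgt mulr1 => Xc; rewrite ler_expR lerN2 ler_wpM2l//.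
by rewrite -[leLHS]real_normK ?num_real// ler_pXn2r ?nnegrE.
Qed.

Lemma negln_phi_cvg (r : R) : 0 < r ->
  t * - ln (phi (r / a t ^+ 2)) @[t --> +oo] --> r `^ (alpha / 2) * Gam.
Proof.
move=> r0; have ra t : 0 <= r / a t ^+ 2 by rewrite divr_ge0 ?sqr_ge0// ltW.
have tp := phi_tail_cvg r0.
have t0 : \forall t \near +oo, 0 < t :> R by apply: nbhs_pinfty_gt; exact: num_real.
have p01 t : 0 <= 1 - phi (r / a t ^+ 2) < 1.
  have /andP[_ h] := phi01 (ra t).
  by rewrite subr_ge0 h gtrBl phi_gt0.
have p0 : 1 - phi (r / a t ^+ 2) @[t --> +oo] --> 0.
  have : t^-1 * (t * (1 - phi (r / a t ^+ 2))) @[t --> +oo] --> 0 * (r `^ (alpha / 2) * Gam).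
    apply: cvgM tp; apply/cvgrVy; first by apply: filterS t0 => t; rewrite invr_gt0.
    by apply: cvg_trans cvg_id; apply: near_eq_cvg; apply: nearW => t /=; rewrite invrK.
  rewrite mul0r; apply: cvg_trans; apply: near_eq_cvg; apply: filterS t0 => t t0.
  by rewrite mulrA mulVf ?mul1r// gt_eqF.
have h := @cvg_negln _ _ _ _ (fun t => t) (fun t => 1 - phi (r / a t ^+ 2)) _ _ _ p0 tp.
have : t * - ln (1 - (1 - phi (r / a t ^+ 2))) @[t --> +oo] --> r `^ (alpha / 2) * Gam.
  by apply: h; [apply: filterS t0 => t /ltW|exact: nearW].
by under eq_fun do rewrite subKr.
Qed.

(** The limit in laplace_sqr_asymptotics is bounded below, because 1 - exp (- (X / b)^2)
    is at least 1 - 1/e on the event |X| > b. *)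
Lemma Gam_gt0 : 0 < Gam.
Proof.
have := laplace_sqr_asymptotics (measurable_funP X) alpha_bnd G_gt0 G_rv ltr01.
rewrite powR1 mul1r => h.
apply: (@lt_le_trans _ _ (1 - expR (- 1))); first by rewrite subr_gt0 expR_lt1 oppr_lt0.
apply: (cvgr_to_ge h); near=> b.
have b0 : 0 < b by near: b; apply: nbhs_pinfty_gt; exact: num_real.
rewrite ler_pdivlMr; last exact: G_gt0.
have mA : measurable [set w | b < `|X w|] by apply: measurable_gt_norm; exact: measurable_funP.
have bI := @bm_indic _ T R _ mA.
have b20 : 0 <= 1 / b ^+ 2 by rewrite divr_ge0// sqr_ge0.
have bp := bm_phi b20; have b1 := @bm_cst _ T R 1.
rewrite -[X in _ <= X - _](Ex_cst P) /G -Ex_indic// -ExZ// -ExB//.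
apply: Ex_le; [exact: bmZ|exact: bmB|move=> w].
rewrite indicE; have [/set_mem/= bX|_] := boolP (w \in _); last first.
  by rewrite mulr0 subr_ge0 expR_le1 oppr_le0 mulr_ge0// sqr_ge0.
rewrite mulr1 lerD2l lerN2 ler_expR lerN2 mul1r ler_pdivlMl ?exprn_gt0// mulr1.
by rewrite -[leRHS]real_normK ?num_real// ler_pXn2r ?nnegrE// ltW.
Unshelve. all: by end_near. Qed.

(** Conditionally on N the transform is phi ^ N, with phi evaluated at
    r (N/t)^(-g) / a_t^2; this is a function of N/t which converges, locally
    uniformly by monotonicity in the argument of phi. *)
Lemma laplace_random_sum_of_squares (g r : R) : 0 <= g -> g * (alpha / 2) < 1 -> 0 < r ->
  \int[P]_w expR (- (r * (((N t w)%:R / t) `^ (- g) *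
     ((\sum_(i < N t w) Xs i w ^+ 2) / a t ^+ 2)))) @[t --> +oo] -->
  \int[Q]_w stretched_exp (r `^ (alpha / 2) * Gam) (1 - g * (alpha / 2)) (Lam w).
Proof.
move=> g0 gb r0; have /andP[al0 _] := alpha_bnd.
have al20 : 0 < alpha / 2 by rewrite divr_gt0.
pose l t y := r * y `^ (- g) / a t ^+ 2.
have l0 t y : 0 <= l t y by rewrite !mulr_ge0 ?powR_ge0 ?invr_ge0 ?sqr_ge0// ltW.
pose nl t y := - ln (phi (l t y)).
have nl0 t y : 0 <= nl t y.
  by rewrite oppr_ge0 ln_le0//; have /andP[] := phi01 (l0 t y).
(* phi (l t y) ^ (t y), extended by 1 to negative t or y. *)
pose h_ t y := expR (- (Num.max t 0 * Num.max y 0 * nl t (Num.max y 0))).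
have max0 (y : R) : 0 <= Num.max y 0 by rewrite le_max lexx orbT.
have h_01 t y : 0 <= h_ t y <= 1 by rewrite expRN01// !mulr_ge0.
have mmax : measurable_fun setT (fun y : R => Num.max y 0) by exact: measurable_maxr.
have mphi : measurable_fun setT (fun y : R => phi (Num.max y 0)).
  apply: nonincreasing_measurable => // x y xy; apply: phi_noninc => //.
  by rewrite ge_max !le_max xy lexx orbT.
have mh_ t : measurable_fun setT (h_ t).
  rewrite /h_; under eq_fun do rewrite -mulrA.
  apply: measurable_laplace; apply: measurable_funM => //.
  have mnl : measurable_fun setT (nl t).
    apply: measurableT_comp => //; apply: (measurableT_comp (@measurable_ln R)).
    have ml : measurable_fun setT (l t).
      by apply: measurable_funM => //; apply: measurable_funM => //; exact: measurable_powR.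
    have := measurableT_comp mphi ml; apply: eq_measurable_fun => y _ /=.
    by rewrite max_l.
  exact: (measurableT_comp mnl).
have hN : \int[P]_w h_ t ((N t w)%:R / t) @[t --> +oo] -->
    \int[Q]_w stretched_exp (r `^ (alpha / 2) * Gam) (1 - g * (alpha / 2)) (Lam w).
  have mNt t : measurable_fun setT (fun w => (N t w)%:R / t).
    by apply: measurable_funM => //; exact: measurable_natr.
  have k0 : 0 < r `^ (alpha / 2) * Gam by rewrite mulr_gt0 ?powR_gt0// Gam_gt0.
  apply: (interlaced_Ex_locally_uniform mNt (measurable_RV Lam) (N_interlaced N_Lam)
     (pr_Lam_le0 Lam_gt0)) => //.
  - exact: measurable_stretched.
  - by move=> y; rewrite stretched01// ltW.
  - by apply: stretched_levels => //; rewrite subr_gt0.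
  move=> y0 y1 e y00 e0.
  pose f x := r `^ (alpha / 2) * Gam * x `^ (- (g * (alpha / 2))).
  have t0 : \forall t \near +oo, 0 <= t :> R by apply: nbhs_pinfty_ge; exact: num_real.
  have mono : \forall t \near +oo, forall x y, 0 < x -> x <= y -> t * nl t y <= t * nl t x.
    apply: filterS t0 => t t0 x y x0 xy; apply: (ler_wpM2l t0); rewrite lerN2.
    rewrite ler_ln ?posrE; last 2 first; [exact: phi_gt0|exact: phi_gt0|].
    have lxy : l t y <= l t x.
      apply: ler_wpM2r; first by rewrite invr_ge0 sqr_ge0.
      apply: (ler_wpM2l (ltW r0)).
      rewrite !powRN lef_pV2 ?posrE ?powR_gt0// ?(lt_le_trans x0)//.
      by rewrite ge0_ler_powR// nnegrE ltW// (lt_le_trans x0).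
    exact: (phi_noninc (l0 t y) lxy).
  have ptw x : 0 < x -> t * nl t x @[t --> +oo] --> f x.
    move=> x0; have rx : 0 < r * x `^ (- g) by rewrite mulr_gt0// powR_gt0.
    have := negln_phi_cvg rx.
    by rewrite powRM ?powR_ge0 ?(ltW r0)// -powRrM mulNr mulrAC.
  have cf x : 0 < x -> {for x, continuous f}.
    by move=> x0; apply: cvgMr; exact: continuous_powR.
  have b0 : 0 < `|y1| + 1 by rewrite ltr_wpDl.
  have eb : 0 < e / (`|y1| + 1) by rewrite divr_gt0.
  apply: filterS2 t0 (monotone_cvg_locally_uniform mono ptw cf y1 y00 eb) => t t0 H y yy.
  have /andP[yy0 yy1] := yy; have y_gt0 : 0 < y by exact: lt_le_trans yy0.
  rewrite /h_ /stretched_exp !max_l ?(ltW y_gt0)//.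
  apply: le_trans (expRN_lipschitz _ _) _.
  - by rewrite !mulr_ge0// ltW.
  - by rewrite mulr_ge0 ?powR_ge0// ltW.
  have -> : t * y * nl t y - r `^ (alpha / 2) * Gam * y `^ (1 - g * (alpha / 2)) =
      y * (t * nl t y - f y).
    rewrite /f powRD; last by rewrite (gt_eqF y_gt0) implybT.
    by rewrite powRr1 ?(ltW y_gt0)//; ring.
  rewrite normrM (gtr0_norm y_gt0).
  rewrite [leRHS](_ : e = (`|y1| + 1) * (e / (`|y1| + 1))); last first.
    by rewrite mulrCA divff ?mulr1// gt_eqF.
  rewrite ler_pM ?(ltW y_gt0)//; last exact: H.
  by rewrite (le_trans yy1)// (le_trans (ler_norm _))// lerDl.
apply: cvg_trans hN; apply: near_eq_cvg; near=> t.
have t0 : 0 < t by near: t; apply: nbhs_pinfty_gt; exact: num_real.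
pose F n y := expR (- (l t (n%:R / t) * y ^+ 2)).
have F01 n y : 0 <= F n y <= 1 by rewrite expRN01// mulr_ge0// sqr_ge0.
have mF n : measurable_fun setT (F n).
  by apply: measurable_laplace; exact: measurable_funX.
transitivity (\int[P]_w (\prod_(i < N t w) F (N t w) (Xs i w))); last first.
  apply: eq_Rintegral => w _; rewrite -expR_sum sumrN; congr (expR (- _)).
  by rewrite -mulr_sumr /l -!mulrA; congr (_ * (_ * _)); rewrite mulrC.
rewrite (Ex_random_product Xs_indep (fun A n => XN_indep n (ltW t0) (A:=A)) XsX mF F01).
apply: eq_Rintegral => w _.
rewrite /h_ !max_l ?(ltW t0)//; last by rewrite divr_ge0// ltW.
rewrite [t * _]mulrC divfK ?gt_eqF// /nl mulrN opprK expRM_natl lnK//.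
by rewrite posrE phi_gt0.
Unshelve. all: by end_near. Qed.

End random_sum_of_squares.

(** * Construction of a limit *)

Section cumulative.
Context {R : realType}.

Lemma random_variable_of_cdf (F : R -> R) :
  {homo F : x y / x <= y} -> (forall x, F y @[y --> x^'+] --> F x) ->
  F x @[x --> -oo] --> (0 : R) -> F x @[x --> +oo] --> (1 : R) ->
  exists (d : measure_display) (T : measurableType d) (P : probability T R) (S : T -> R),
    measurable_fun setT S /\ forall x, pr P (S @^-1` `]-oo, x]) = F x.
Proof.
move=> nd rc F0 F1.
pose f : cumulativeBounded (0 : R) (1 : R) :=
  HB.pack F (isCumulative.Build R _ R F nd rc) (isCumulativeBounded.Build R 0 1 F F0 F1).
exists _, (measurableTypeR R), (lebesgue_stieltjes_measure f), (fun x : measurableTypeR R => x : R).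
split; first exact: measurable_id.
by move=> x; have := cdf_lebesgue_stieltjes_id f x; rewrite /cdf /distribution /pushforward /pr => ->.
Qed.

End cumulative.

Section laplace_continuity.
Context {R : realType} {d : measure_display} {T : measurableType d} (P : probability T R).
Variables (W : R -> T -> R) (L : R -> R).
Hypothesis mW : forall t, measurable_fun setT (W t).
Hypothesis W0 : forall t w, 0 <= W t w.
Hypothesis WL : forall r, 0 <= r -> \int[P]_w expR (- (r * W t w)) @[t --> +oo] --> L r.
Hypothesis L1 : L r @[r --> 0^'+] --> (1 : R).

(* Eventual upper bounds of the distribution functions to the right of x. *)
Let E (x : R) : set R :=
  [set c | exists2 y, x < y & \forall t \near +oo, pr P (W t @^-1` `]-oo, y]) <= c].
Let F (x : R) : R := inf (E x).

Let E1 x : E x 1.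
Proof.
by exists (x + 1); [rewrite ltrDl|apply: nearW => t; apply: pr_le1; exact: measurable_le].
Qed.

Let E_ge0 x c : E x c -> 0 <= c.
Proof.
move=> [y _ h]; near (+oo : set_system R) => t.
apply: (@le_trans _ _ (pr P (W t @^-1` `]-oo, y]))); first exact: pr_ge0.
by near: t.
Unshelve. all: by end_near. Qed.

Let E_inf x : has_inf (E x).
Proof. by split; [exists 1; exact: E1|exists 0 => c; exact: E_ge0]. Qed.

Let F_le x c : E x c -> F x <= c.
Proof. by move=> Ec; apply: ge_inf => //; exact: (E_inf x).2. Qed.

Let F_adherent x e : 0 < e -> exists2 c, E x c & c < F x + e.
Proof. by move=> e0; exact: inf_adherent. Qed.

Let F_nd : {homo F : x y / x <= y}.
Proof.
move=> x y xy; apply: lb_le_inf; first by exists 1; exact: E1.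
by move=> c [z yz h]; apply: F_le; exists z => //; exact: le_lt_trans yz.
Qed.

Let F_rc x : F y @[y --> x^'+] --> F x.
Proof.
apply/cvgrPdist_le => e e0; have [c [z xz h] ce] := F_adherent x e0.
near=> y; have xy : x <= y by apply: ltW; near: y; exact: nbhs_right_gt.
rewrite distrC ger0_norm ?subr_ge0 ?F_nd// lerBlDl.
have yz : y < z by near: y; exact: nbhs_right_lt.
by apply: le_trans (ltW ce); apply: F_le; exists z.
Unshelve. all: by end_near. Qed.

Let F_Ny : F x @[x --> -oo] --> (0 : R).
Proof.
apply: cvg_near_cst; near=> x; have x0 : x < 0 by near: x; exact: nbhs_ninfty_lt.
apply/eqP; rewrite eq_le; apply/andP; split; last first.
  by apply: lb_le_inf; [exists 1; exact: E1|move=> c; exact: E_ge0].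
apply: F_le; exists (x / 2); first by lra.
by apply: nearW => t; rewrite pr_lt0//; lra.
Unshelve. all: by end_near. Qed.

(** The Laplace transforms near 0 keep the mass from escaping to infinity. *)
Let F_y : F x @[x --> +oo] --> (1 : R).
Proof.
apply/cvgrPdist_le => e e0; have e30 : 0 < e / 3 by rewrite divr_gt0.
have [r r0 Lr] : exists2 r, 0 < r & 1 - e / 3 <= L r.
  near (0 : R)^'+ => r; exists r; first by near: r; exact: nbhs_right_gt.
  by near: r; apply: cvgr_ge L1 _ _; rewrite gtrBl.
near=> x; rewrite ger0_norm ?subr_ge0 ?F_le ?E1// lerBlDl -lerBlDr.
apply: lb_le_inf; first by exists 1; exact: E1.
move=> c [y xy h].
have ex : expR (- (r * x)) <= e / 3.
  by rewrite -[leRHS](@lnK R) ?posrE// ler_expR lerNl -ler_pdivrMl.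
have /cvgrPdist_le/(_ _ e30) hL := WL (ltW r0).
near (+oo : set_system R) => t.
have ht : pr P (W t @^-1` `]-oo, y]) <= c by near: t.
have : `|L r - \int[P]_w expR (- (r * W t w))| <= e / 3 by near: t.
rewrite ler_norml => /andP[_ hLt].
have mI := measurable_le y (mW t); have bI := @bm_indic _ T R _ mI.
suff : \int[P]_w expR (- (r * W t w)) <= pr P (W t @^-1` `]-oo, y]) + expR (- (r * x)) by lra.
have bL : bounded_measurable (fun w => expR (- (r * W t w))) by apply: bm_laplace => //; exact: ltW.
have bc := @bm_cst _ T R (expR (- (r * x))).
rewrite -Ex_indic// -[X in _ + X](Ex_cst P) -ExD//.
apply: Ex_le => //; first exact: bmD.
move=> w; rewrite indicE; have [/set_mem/= wy|/negP wy] := boolP (w \in _).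
  have /andP[_ h1] : 0 <= expR (- (r * W t w)) <= 1.
    by rewrite expRN01// mulr_ge0// ltW.
  by rewrite (le_trans h1)// lerDl expR_ge0.
rewrite add0r ler_expR lerN2 ler_pM2l//; apply: ltW; apply: (lt_trans xy).
rewrite ltNge; apply/negP => wy'; apply: wy; rewrite inE /= in_itv/=.
exact: wy'.
Unshelve. all: by end_near. Qed.

(** Continuity theorem for Laplace transforms. F takes the place of the limit in Helly's
    selection theorem; as laplace_cvg_cdf makes F x an eventual lower bound, up to e, of
    the distribution functions to the right of x, no subsequence has to be extracted. *)
Lemma laplace_limit :
  exists (d1 : measure_display) (T1 : measurableType d1) (P1 : probability T1 R) (S : T1 -> R),
    [/\ measurable_fun setT S, forall w, 0 <= S w &
        forall r, 0 < r -> \int[P1]_w expR (- (r * S w)) = L r].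
Proof.
have [d1 [T1 [P1 [S [mS SF]]]]] := random_variable_of_cdf F_nd F_rc F_Ny F_y.
exists d1, T1, P1, (fun w => Num.max (S w) 0); split.
- exact: measurable_maxr.
- by move=> w; rewrite le_max lexx orbT.
move=> r r0.
have WS : interlaced (fun t x => pr P (W t @^-1` `]-oo, x])) (fun x => pr P1 (S @^-1` `]-oo, x])).
  move=> x y e xy e0; rewrite !SF.
  have e20 : 0 < e / 2 by rewrite divr_gt0.
  have [c [z yz hz] ce] := F_adherent y e0.
  have xm : x < (x + y) / 2 by lra.
  have my : (x + y) / 2 < y by lra.
  have [c' hc'] := laplace_cvg_cdf mW W0 WL my e20.
  have Ec' : E x (c' + e / 2) by exists ((x + y) / 2) => //; apply: filterS hc' => t [].
  apply: filterS2 hz hc' => t zt [_ h2]; split.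
    apply: le_trans (ltW ce); apply: le_trans zt; apply: le_pr; try exact: measurable_le.
    by move=> w /=; rewrite !in_itv/= => h; rewrite (le_trans h)// ltW// (lt_trans xy).
  by apply: (le_trans (F_le Ec')); lra.
have mh := @measurable_stretched R r 1.
have h01 y : 0 <= stretched_exp r 1 y <= 1 by rewrite stretched01// ltW.
have := interlaced_Ex mW mS WS mh h01 (stretched_levels r0 ltr01).
have -> : (fun t => \int[P]_w stretched_exp r 1 (W t w)) =
    (fun t => \int[P]_w expR (- (r * W t w))).
  apply/funext => t; apply: eq_Rintegral => w _.
  by rewrite /stretched_exp max_l// powRr1.
have -> : \int[P1]_w stretched_exp r 1 (S w) = \int[P1]_w expR (- (r * Num.max (S w) 0)).
  apply: eq_Rintegral => w _.
  by rewrite /stretched_exp powRr1// le_max lexx orbT.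
move=> h; apply: (cvg_unique _ h) => //; exact: WL (ltW r0).
Qed.

End laplace_continuity.

Section stable_law.
Context {R : realType} {d : measure_display} {T : measurableType d} (P : probability T R).
Variables (X : {RV P >-> R}) (Xs : nat -> {RV P >-> R}).
Hypothesis Xs_indep : mutually_independent P Xs.
Hypothesis XsX : forall i, same_distribution (Xs i) X.
Let G (x : R) : R := pr P [set w | x < `|X w|].
Variables (alpha : R) (a : R -> R).
Hypothesis alpha_bnd : 0 < alpha < 2.
Hypothesis G_gt0 : forall x, 0 < G x.
Hypothesis G_rv : forall c, 0 < c -> G (c * x) / G x @[x --> +oo] --> c `^ (- alpha).
Hypothesis a_y : a t @[t --> +oo] --> +oo.
Hypothesis a_G : t * G (a t) @[t --> +oo] --> (1 : R).
Let phi (l : R) : R := \int[P]_w expR (- (l * X w ^+ 2)).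
Let Gam : R := gamma_fun (1 - alpha / 2).

Lemma truncn_div_cvg : (Num.truncn t)%:R / t @[t --> +oo] --> (1 : R).
Proof.
apply: (@squeeze_cvgr _ _ _ _ (fun t : R => 1 - t^-1) (fun=> 1)); last 2 first.
- rewrite -[X in _ --> X]subr0; apply: cvgB; first exact: cvg_cst.
  apply/cvgrVy; first by near=> t; rewrite invr_gt0; near: t; apply: nbhs_pinfty_gt; exact: num_real.
  by apply: cvg_trans cvg_id; apply: near_eq_cvg; apply: nearW => t /=; rewrite invrK.
- exact: cvg_cst.
near=> t; have t0 : 0 < t by near: t; apply: nbhs_pinfty_gt; exact: num_real.
have /andP[h1 h2] := truncn_itv (ltW t0).
rewrite ler_pdivrMr// mul1r h1 andbT ler_pdivlMr// mulrBl mul1r mulVf ?gt_eqF//.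
by rewrite lerBlDr -natr1 in h2 *; rewrite ltW.
Unshelve. all: by end_near. Qed.

(** One-sided stable law of index alpha / 2, obtained as the limit of the normalised sums
    of squares of the first t observations. *)
Lemma stable_law :
  exists (d1 : measure_display) (T1 : measurableType d1) (P1 : probability T1 R) (S : T1 -> R),
    [/\ measurable_fun setT S, forall w, 0 <= S w &
        forall r, 0 < r -> \int[P1]_w expR (- (r * S w)) = expR (- (r `^ (alpha / 2) * Gam))].
Proof.
have /andP[al0 _] := alpha_bnd; have al20 : 0 < alpha / 2 by rewrite divr_gt0.
pose W t w := (\sum_(i < Num.truncn t) Xs i w ^+ 2) / a t ^+ 2.
have mW t : measurable_fun setT (W t).
  apply: measurable_funM => //; apply: measurable_sum => i.
  by apply: measurable_funX; exact: measurable_funP.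
have W0 t w : 0 <= W t w.
  by rewrite divr_ge0 ?sqr_ge0// sumr_ge0// => i _; exact: sqr_ge0.
apply: (@laplace_limit _ _ _ P W (fun r => expR (- (r `^ (alpha / 2) * Gam)))) => //.
  move=> r; rewrite le_eqVlt => /orP[/eqP <-|r0].
    rewrite powR0 ?gt_eqF// mul0r oppr0 expR0; apply: cvg_near_cst; apply: nearW => t.
    by under eq_Rintegral do rewrite mul0r oppr0 expR0; exact: Ex_cst.
  have ra t : 0 <= r / a t ^+ 2 by rewrite divr_ge0 ?sqr_ge0// ltW.
  have E t : \int[P]_w expR (- (r * W t w)) = phi (r / a t ^+ 2) ^+ Num.truncn t.
    pose F (n : nat) (y : R) := expR (- (r / a t ^+ 2 * y ^+ 2)).
    have F01 n y : 0 <= F n y <= 1 by rewrite expRN01// mulr_ge0// sqr_ge0.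
    have mF n : measurable_fun setT (F n).
      by apply: measurable_laplace; exact: measurable_funX.
    pose n0 : {RV P >-> nat} := cst (Num.truncn t).
    have n0_indep A n : generated_sigma_algebra [set: nat] Xs A ->
        P (A `&` n0 @^-1` [set n]) = (P A * P (n0 @^-1` [set n]))%E.
      move=> _; rewrite preimage_cst; case: ifP => _.
        by rewrite setIT probability_setT mule1.
      by rewrite setI0 measure0 mule0.
    have := Ex_random_product Xs_indep n0_indep XsX mF F01.
    rewrite /n0 /= Ex_cst => <-; apply: eq_Rintegral => w _; rewrite -expR_sum sumrN.
    by congr (expR (- _)); rewrite /W -mulr_sumr mulrA mulrAC.
  under eq_fun do rewrite E.
  have h := negln_phi_cvg alpha_bnd G_gt0 G_rv a_y a_G r0.
  have h2 : (Num.truncn t)%:R / t * (t * - ln (phi (r / a t ^+ 2))) @[t --> +oo] -->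
      1 * (r `^ (alpha / 2) * Gam) by apply: cvgM => //; exact: truncn_div_cvg.
  rewrite mul1r in h2.
  have : expR (- ((Num.truncn t)%:R / t * (t * - ln (phi (r / a t ^+ 2))))) @[t --> +oo] -->
      expR (- (r `^ (alpha / 2) * Gam)).
    exact: (cvg_comp _ _ (cvgN h2) (@continuous_expR R _)).
  apply: cvg_trans; apply: near_eq_cvg; near=> t.
  have t0 : 0 < t by near: t; apply: nbhs_pinfty_gt; exact: num_real.
  rewrite mulrA divfK ?gt_eqF// mulrN opprK expRM_natl lnK// posrE.
  exact: (phi_gt0 a_G).
have h : - (r `^ (alpha / 2) * Gam) @[r --> 0^'+] --> - (0 * Gam).
  by apply: cvgN; apply: cvgMl; exact: powR_cvg0.
rewrite mul0r oppr0 in h; rewrite -[X in _ --> X]expR0.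
exact: (cvg_comp _ _ h (@continuous_expR R _)).
Unshelve. all: by end_near. Qed.

End stable_law.

Section mixture.
Context {R : realType} {d1 : measure_display} {T1 : measurableType d1} (P1 : probability T1 R).
Context {d2 : measure_display} {T2 : measurableType d2} (P2 : probability T2 R).
Variables (S : T1 -> R) (Lam : {RV P2 >-> R}) (alpha mu1 : R).
Hypothesis alpha_gt0 : 0 < alpha.
Hypothesis mS : measurable_fun setT S.
Hypothesis S0 : forall w, 0 <= S w.
Hypothesis S_laplace : forall r, 0 < r ->
  \int[P1]_w expR (- (r * S w)) = expR (- (r `^ (alpha / 2) * gamma_fun (1 - alpha / 2))).
Hypothesis Lam_gt0 : P2 [set w | 0 < Lam w] = 1%E.

(** For S with transform exp (- Gamma (1 - b) r^b), b = alpha / 2, independent of Lam,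
    and U = Lam^(1 / b) S: conditionally on Lam, E exp (- r U) is the transform of S at
    r Lam^(1 / b), which equals exp (- Gamma (1 - b) r^b Lam). *)
Lemma joint_limit_exists : exists (d : measure_display) (T : measurableType d)
  (P : probability T R) (U Lam1 : {RV P >-> R}),
  same_distribution Lam1 Lam /\ joint_limit_law P alpha mu1 U Lam1.
Proof.
have b0 : 0 < alpha / 2 by rewrite divr_gt0.
have mL := measurable_RV Lam.
pose P := (P1 \x P2)%E.
pose u (w : T1 * T2) := Num.max (Lam w.2) 0 `^ (alpha / 2)^-1 * S w.1.
pose l (w : T1 * T2) := Lam w.2.
have ml : measurable_fun setT l by exact: measurableT_comp.
have mu : measurable_fun setT u.
  apply: measurable_funM; last exact: measurableT_comp.
  apply: (measurableT_comp (@measurable_powR R (alpha / 2)^-1)).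
  exact: measurable_maxr.
pose U : {RV P >-> R} := HB.pack u (@isMeasurableFun.Build _ _ _ _ u mu).
pose Lam1 : {RV P >-> R} := HB.pack l (@isMeasurableFun.Build _ _ _ _ l ml).
exists _, _, P, U, Lam1; split.
  move=> B mB; rewrite /distribution /pushforward /=.
  have -> : l @^-1` B = setT `*` (Lam @^-1` B) by apply/seteqP; split => [w|w []].
  rewrite /P product_measure1E//; last by rewrite -[X in measurable X]setTI; exact: mL.
  by rewrite -[RHS]mul1e; congr (_ * _)%E; exact: probability_setT.
move=> r s r0 s0; rewrite unlock /P.
have mE (f : T1 * T2 -> R) : measurable_fun setT f ->
    measurable_fun setT (fun w => (expR (- f w - s * (mu1 * l w)))%:E).
  move=> mf; apply/measurable_EFinP; apply: measurableT_comp => //.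
  apply: measurable_funB; first exact: measurableT_comp.
  by apply: measurable_funM => //; exact: measurable_funM.
rewrite [LHS]fubini_tonelli2; last 2 first.
- by apply: mE; exact: measurable_funM.
- by move=> w; rewrite lee_fin expR_ge0.
rewrite [RHS]fubini_tonelli2; last 2 first.
- by apply: mE; exact: measurable_funM.
- by move=> w; rewrite lee_fin expR_ge0.
have mA : measurable [set w | 0 < Lam w] by exact: measurable_lt.
apply: ae_eq_integral => //.
- by apply: measurable_fun_fubini_tonelli_G => [|w]; rewrite ?lee_fin ?expR_ge0//;
    apply: mE; exact: measurable_funM.
- by apply: measurable_fun_fubini_tonelli_G => [|w]; rewrite ?lee_fin ?expR_ge0//;
    apply: mE; exact: measurable_funM.
exists (~` [set w | 0 < Lam w]); split; first exact: measurableC.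
  by apply: null_setC => //; exact: pr_seq1.
move=> y /= hy y0; apply: hy => _; rewrite /fubini_G /u /l /=.
have c0 : 0 < r * Lam y `^ (alpha / 2)^-1 by rewrite mulr_gt0// powR_gt0.
have bS : bounded_measurable (fun x => expR (- (r * Lam y `^ (alpha / 2)^-1 * S x))).
  by apply: bm_laplace => //; exact: ltW.
transitivity (expR (- (s * (mu1 * Lam y))) *
    \int[P1]_x expR (- (r * Lam y `^ (alpha / 2)^-1 * S x)))%:E.
  rewrite -ExZ//.
  have <- := bm_expectation P1 (bmZ (expR (- (s * (mu1 * Lam y)))) bS).
  rewrite unlock; apply: eq_integral => x _.
  by rewrite max_l ?(ltW y0)// -expRD [in RHS]addrC -[in RHS]mulrA.
rewrite S_laplace// powRM ?powR_ge0 ?(ltW r0)// -powRrM mulVf ?gt_eqF// powRr1 ?(ltW y0)//.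
rewrite -expRD integral_cst//= probability_setT mule1 addrC.
by rewrite [_ * Lam y * _]mulrAC.
Qed.

End mixture.

(** * Identification of the limits *)

Section nonnegative.
Context {R : realType} {d : measure_display} {T : measurableType d} (P : probability T R).

Lemma expectation_eq_on (A : set T) (f g : T -> R) : measurable A -> P A = 1%E ->
  measurable_fun setT f -> bounded_measurable g -> (forall w, A w -> f w = g w) ->
  ('E_P[f] = (\int[P]_w g w)%:E)%E.
Proof.
move=> mA PA mf bg fg; have mg : measurable_fun setT g by case: bg.
rewrite -bm_expectation// unlock; apply: ae_eq_integral => //.
- exact/measurable_EFinP.
- exact/measurable_EFinP.
exists (~` A); split; first exact: measurableC.
  by apply: null_setC => //; exact: pr_seq1.
by move=> w /= h Aw; apply: h => _; rewrite fg.
Qed.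

(** On the event U < -1/k the variable exp (- r U) exceeds r / k, so that this event has
    probability at most k / r for every r. *)
Lemma laplace_le1_nonneg (U : T -> R) : measurable_fun setT U ->
  (forall r, 0 < r -> ('E_P[fun w => expR (- (r * U w))] <= 1)%E) ->
  P [set w | 0 <= U w] = 1%E.
Proof.
move=> mU U1.
have mlt (c : R) : measurable [set w | U w < c] by exact: measurable_lt.
have null k : P [set w | U w < - k.+1%:R^-1] = 0%E.
  set A := [set w | _]; have mA : measurable A by exact: mlt.
  rewrite (prE P mA); congr (_%:E); apply/eqP; rewrite eq_le pr_ge0 andbT.
  have k0 : 0 < k.+1%:R :> R by rewrite ltr0n.
  have h r : 0 < r -> r * pr P A <= 1.
    move=> r0; have rk0 : 0 < r * k.+1%:R by rewrite mulr_gt0.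
    rewrite -lee_fin; have := U1 _ rk0; apply: le_trans; rewrite EFinM -prE// unlock.
    rewrite -[X in (_ * P X <= _)%E]setIT -integral_indic// -ge0_integralZl//; last 2 first.
    - by apply/measurable_EFinP; exact: measurable_indic.
    - by rewrite lee_fin ltW.
    apply: ge0_le_integral => //.
    - by move=> w _; rewrite -EFinM lee_fin mulr_ge0// ltW.
    - by apply/measurable_EFinP; apply: measurable_funM => //; exact: measurable_indic.
    - by apply/measurable_EFinP; exact: measurable_laplace.
    move=> w _; rewrite -EFinM lee_fin indicE.
    have [/set_mem/= wA|_] := boolP (w \in A); last by rewrite mulr0 expR_ge0.
    rewrite mulr1; apply: le_trans (expR_ge1Dx _).
    apply: (@le_trans _ _ (- (r * k.+1%:R * U w))); last by rewrite lerDr.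
    rewrite -mulrN -mulrA ler_peMr ?(ltW r0)// -ler_pdivrMl// mulr1.
    by rewrite ltW// ltrNr.
  rewrite leNgt; apply/negP => p0.
  have p20 : 0 < 2 / pr P A by rewrite divr_gt0.
  by have := h _ p20; rewrite divfK ?gt_eqF// leNgt ltr1n.
have mN : measurable [set w | U w < 0] by exact: mlt.
have N0 : P [set w | U w < 0] = 0%E.
  apply: (negligibleP P mN).1.
  have -> : [set w | U w < 0] = \bigcup_k [set w | U w < - k.+1%:R^-1].
    apply/seteqP; split => w /=; last first.
      by move=> [k _ /= h]; apply: (lt_trans h); rewrite oppr_lt0 invr_gt0.
    move=> Uw; have Uw' : 0 < - U w by rewrite oppr_gt0.
    exists (Num.truncn (- U w)^-1) => //=; rewrite ltrNr invf_plt ?posrE//.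
    exact: truncnS_gt.
  by apply: negligible_bigcup => k; exact: ((negligibleP P (mlt _)).2 (null k)).
have -> : [set w | 0 <= U w] = ~` [set w | U w < 0].
  by apply/seteqP; split => w /=; rewrite leNgt => /negP.
by rewrite probability_setC// N0 sube0.
Qed.

End nonnegative.

Section marginal.
Context {R : realType} {d1 : measure_display} {T1 : measurableType d1} (P1 : probability T1 R).
Context {d2 : measure_display} {T2 : measurableType d2} (P2 : probability T2 R).
Variables (U : {RV P1 >-> R}) (Lam : {RV P2 >-> R}) (alpha : R).
Hypothesis Gam_ge0 : 0 <= gamma_fun (1 - alpha / 2).
Hypothesis Lam_gt0 : P2 [set w | 0 < Lam w] = 1%E.
Hypothesis U_law : forall r, 0 < r -> ('E_P1[fun w => expR (- (r * U w))] =
   'E_P2[fun w => expR (- (r `^ (alpha / 2) * gamma_fun (1 - alpha / 2) * Lam w))])%E.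

Let kappa_ge0 r : 0 <= r `^ (alpha / 2) * gamma_fun (1 - alpha / 2).
Proof. by rewrite mulr_ge0// powR_ge0. Qed.

Let law_rhs r : ('E_P2[fun w => expR (- (r `^ (alpha / 2) * gamma_fun (1 - alpha / 2) * Lam w))] =
  (\int[P2]_w stretched_exp (r `^ (alpha / 2) * gamma_fun (1 - alpha / 2)) 1 (Lam w))%:E)%E.
Proof.
apply: (@expectation_eq_on _ _ _ _ [set w | 0 < Lam w]) => //.
- by apply: measurable_lt => //; exact: measurable_RV.
- by apply: measurable_laplace; exact: measurable_RV.
- apply: bm_comp_unit; [exact: measurable_stretched| |exact: measurable_RV].
  by move=> y; exact: stretched01.
by move=> w /= w0; rewrite /stretched_exp max_l ?(ltW w0)// powRr1 ?(ltW w0).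
Qed.

Lemma law_nonneg : P1 [set w | 0 <= U w] = 1%E.
Proof.
apply: laplace_le1_nonneg => [|r r0]; first exact: measurable_RV.
rewrite U_law// law_rhs lee_fin.
rewrite -[X in _ <= X](Ex_cst P2); apply: Ex_le; [|exact: bm_cst|].
  apply: bm_comp_unit; [exact: measurable_stretched| |exact: measurable_RV].
  by move=> y; exact: stretched01.
by move=> w; have /andP[_] := @stretched01 R _ 1 (Lam w) (kappa_ge0 r).
Qed.

(** By law_nonneg the positive part does not change U almost surely; it makes the
    transform bounded everywhere. *)
Lemma law_laplace (r : R) : 0 < r -> \int[P1]_w expR (- (r * Num.max (U w) 0)) =
  \int[P2]_w stretched_exp (r `^ (alpha / 2) * gamma_fun (1 - alpha / 2)) 1 (Lam w).
Proof.
move=> r0; apply: EFin_inj; rewrite -law_rhs -U_law//; apply/esym.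
apply: (@expectation_eq_on _ _ _ _ [set w | 0 <= U w]).
- by apply: measurable_nonneg; exact: measurable_RV.
- exact: law_nonneg.
- by apply: measurable_laplace; exact: measurable_RV.
- apply: bm_laplace => //; [|by move=> w; rewrite le_max lexx orbT|exact: ltW].
  by apply: measurable_maxr => //; exact: measurable_RV.
by move=> w /= w0; rewrite max_l.
Qed.

End marginal.

Section quotient.
Context {R : realType} {d1 : measure_display} {T1 : measurableType d1} (P1 : probability T1 R).
Variables (V M : T1 -> R) (beta K : R).
Hypotheses (mV : measurable_fun setT V) (V0 : forall w, 0 <= V w).
Hypotheses (mM : measurable_fun setT M) (M0 : forall w, 0 <= M w).
Hypothesis M_gt0 : P1 [set w | 0 < M w] = 1%E.
Hypotheses (beta0 : 0 < beta) (K0 : 0 <= K).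
Hypothesis VM : forall r s, 0 < r -> 0 <= s ->
  \int[P1]_w (expR (- (r * V w)) * expR (- (s * M w))) =
  \int[P1]_w (expR (- (r `^ beta * K * M w)) * expR (- (s * M w))).

Let cell (n : nat) (w : T1) : nat := `|Num.ceil (n.+1%:R * M w)|%N.

Let cellE n w k : (cell n w == k) = (k%:R - 1 < n.+1%:R * M w <= k%:R).
Proof.
have c0 : (0 <= Num.ceil (n.+1%:R * M w))%R by rewrite ceil_ge0// (@lt_le_trans _ _ 0) ?ltrN10// mulr_ge0.
rewrite -eqz_nat /cell gez0_abs// ceil_eq.
by rewrite -!pmulrn intrD.
Qed.

Let mM_le (x : R) : measurable (M @^-1` `]-oo, x]).
Proof. exact: measurable_le. Qed.

Let cell_set n k : cell n @^-1` [set k] =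
  (M @^-1` `]-oo, k%:R / n.+1%:R]) `\` (M @^-1` `]-oo, (k%:R - 1) / n.+1%:R]).
Proof.
have n0 : 0 < n.+1%:R :> R by rewrite ltr0n.
apply/seteqP; split => w /=; rewrite !in_itv/= !ler_pdivlMr// ![M w * _]mulrC.
  by move=> /eqP; rewrite cellE => /andP[h1 h2]; split => //; apply/negP; rewrite -ltNge.
by move=> [h1 /negP]; rewrite -ltNge => h2; apply/eqP; rewrite cellE h2.
Qed.

Let mcell n k : measurable (cell n @^-1` [set k]).
Proof. by rewrite cell_set; apply: measurableD; exact: mM_le. Qed.

Let kappa_ge0 r : 0 <= r `^ beta * K.
Proof. by rewrite mulr_ge0// powR_ge0. Qed.

Let mexpV r : measurable_fun setT (fun w => expR (- (r * V w))).
Proof. exact: measurable_laplace. Qed.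

Let mexpM r : measurable_fun setT (fun w => expR (- (r `^ beta * K * M w))).
Proof. exact: measurable_laplace. Qed.

Let expV01 r w : 0 <= r -> 0 <= expR (- (r * V w)) <= 1.
Proof. by move=> r0; rewrite expRN01// mulr_ge0. Qed.

Let expM01 r w : 0 <= expR (- (r `^ beta * K * M w)) <= 1.
Proof. by rewrite expRN01// mulr_ge0. Qed.

Let cell_eq n k r : 0 <= r ->
  \int[P1]_w (\1_(cell n @^-1` [set k]) w * expR (- (r * V w))) =
  \int[P1]_w (\1_(cell n @^-1` [set k]) w * expR (- (r `^ beta * K * M w))).
Proof.
rewrite le_eqVlt => /orP[/eqP <-|r0].
  apply: eq_Rintegral => w _.
  by rewrite powR0 ?gt_eqF// !mul0r.
have n0 : 0 < n.+1%:R :> R by rewrite ltr0n.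
set B := M @^-1` `]-oo, k%:R / n.+1%:R]; set A := M @^-1` `]-oo, (k%:R - 1) / n.+1%:R].
have AB : A `<=` B.
  move=> w; rewrite /A /B /= !in_itv/= => h; apply: (le_trans h).
  by rewrite ler_pM2r ?invr_gt0// gerBl.
have E (Z : T1 -> R) : measurable_fun setT Z -> (forall w, 0 <= Z w <= 1) ->
    \int[P1]_w (\1_(cell n @^-1` [set k]) w * Z w) =
    \int[P1]_w (Z w * \1_B w) - \int[P1]_w (Z w * \1_A w).
  move=> mZ Z01; have bZ : bounded_measurable Z by exact: bm_unit.
  have bA := @bm_indic _ T1 R A (mM_le _); have bB := @bm_indic _ T1 R B (mM_le _).
  rewrite -ExB; [|exact: bmM|exact: bmM].
  apply: eq_Rintegral => w _; rewrite -mulrBr mulrC cell_set -/A -/B; congr (_ * _).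
  rewrite !indicE in_setD; have [wA|wA] := boolP (w \in A).
    by rewrite mem_set; [rewrite subrr|apply: AB; exact: set_mem].
  by rewrite andbT subr0.
have eV w := expV01 w (ltW r0).
rewrite (E _ (mexpV r) eV) (E _ (mexpM r) (expM01 r)).
have VMr s : 0 <= s -> _ := VM r0 (s := s).
have H x := weighted_laplace_eq x (mexpV r) eV (mexpM r) (expM01 r) mM M0 VMr.
by rewrite /A /B !H.
Qed.

(** Rounding M up to a multiple of 1/(n + 1) makes it constant on the events cell n = k,
    where the joint transform can be applied with r replaced by r (n + 1) / k. This
    quotient tends to r / M as n tends to infinity. *)
Lemma quotient_laplace (r : R) : 0 < r ->
  \int[P1]_w expR (- (r * (V w / M w))) = \int[P1]_w stretched_exp (r `^ beta * K) (1 - beta) (M w).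
Proof.
move=> r0.
(* On the cell k = 0 the variable M vanishes and the quotient is 0 by convention. *)
pose q n k : R := r * (n.+1%:R / k%:R).
have q0 n k : 0 <= q n k by rewrite mulr_ge0 ?divr_ge0// ltW.
pose f n w := expR (- (q n (cell n w) * V w)).
pose g n w := expR (- (q n (cell n w) `^ beta * K * M w)).
have mf n : measurable_fun setT (f n).
  exact: (measurable_random_index (mcell n) (F := fun k w => expR (- (q n k * V w)))).
have mg n : measurable_fun setT (g n).
  exact: (measurable_random_index (mcell n) (F := fun k w => expR (- (q n k `^ beta * K * M w)))).
have fg n : \int[P1]_w f n w = \int[P1]_w g n w.
  have f01 w : 0 <= f n w <= 1 by exact: expV01.
  have g01 w : 0 <= g n w <= 1 by exact: expM01.
  apply: (Ex_partition (mcell n) (mf n) f01 (mg n) g01) => k.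
  transitivity (\int[P1]_w (\1_(cell n @^-1` [set k]) w * expR (- (q n k * V w)))).
    apply: eq_Rintegral => w _; rewrite indicE.
    by have [/set_mem/= <-|_] := boolP (w \in _); rewrite ?mul0r.
  rewrite (cell_eq n k (q0 n k)); apply: eq_Rintegral => w _; rewrite indicE.
  by have [/set_mem/= <-|_] := boolP (w \in _); [|rewrite !mul0r].
have mG : measurable [set w | 0 < M w] by exact: measurable_lt.
have G1 := pr_seq1 mG M_gt0.
have qM w : 0 < M w -> q n (cell n w) @[n --> \oo] --> r / M w.
  move=> w0; apply: cvgMr.
  have cM : (cell n w)%:R / n.+1%:R @[n --> \oo] --> M w.
    apply: (@squeeze_cvgr _ _ _ _ (fun=> M w) (fun n => M w + n.+1%:R^-1)).
    - apply: nearW => n; have n0 : 0 < n.+1%:R :> R by rewrite ltr0n.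
      have := eqxx (cell n w); rewrite cellE => /andP[h1 h2].
      rewrite ler_pdivlMr// mulrC h2/= ler_pdivrMr// mulrDl mulVf ?gt_eqF// mulrC.
      by rewrite -lerBlDr ltW.
    - exact: cvg_cst.
    - rewrite -[X in _ --> X]addr0; apply: cvgD; first exact: cvg_cst.
      exact: cvg_harmonic.
  have : ((cell n w)%:R / n.+1%:R)^-1 @[n --> \oo] --> (M w)^-1.
    by apply: cvgV => //; exact: lt0r_neq0.
  by apply: cvg_trans; apply: near_eq_cvg; apply: nearW => n; rewrite invf_div.
have lf : \int[P1]_w f n w @[n --> \oo] --> \int[P1]_w expR (- (r * (V w / M w))).
  apply: (@Ex_dct _ _ _ P1 _ _ 1 [set w | 0 < M w]) => //.
  - apply: measurable_laplace; apply: measurable_funM => //.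
    have := measurableT_comp (@measurable_powR R (- 1)) mM.
    by apply: eq_measurable_fun => w _ /=; rewrite powR_inv1.
  - by move=> n w; apply: norm01; exact: expV01.
  move=> w w0; have : - (q n (cell n w) * V w) @[n --> \oo] --> - (r * (V w / M w)).
    by rewrite [V w / _]mulrC mulrA; apply: cvgN; apply: cvgMl; exact: qM.
  by move=> h; exact: (cvg_comp _ _ h (@continuous_expR R _)).
have lg : \int[P1]_w g n w @[n --> \oo] -->
    \int[P1]_w stretched_exp (r `^ beta * K) (1 - beta) (M w).
  apply: (@Ex_dct _ _ _ P1 _ _ 1 [set w | 0 < M w]) => //.
  - by apply: measurableT_comp => //; exact: measurable_stretched.
  - by move=> n w; apply: norm01; exact: expM01.
  move=> w /= w0; have rM : 0 < r / M w by rewrite divr_gt0.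
  have h : - (q n (cell n w) `^ beta * K * M w) @[n --> \oo] --> - ((r / M w) `^ beta * K * M w).
    apply: cvgN; apply: cvgMl; apply: cvgMl.
    exact: (cvg_comp _ _ (qM w w0) (@continuous_powR R beta _ rM)).
  have -> : stretched_exp (r `^ beta * K) (1 - beta) (M w) = expR (- ((r / M w) `^ beta * K * M w)).
    rewrite /stretched_exp max_l ?(ltW w0)//; congr (expR (- _)).
    rewrite powRD; last by rewrite (gt_eqF w0) implybT.
    rewrite powRr1 ?(ltW w0)// powRM ?invr_ge0 ?(ltW r0) ?(ltW w0)//.
    by rewrite -(powR_inv1 (ltW w0)) -powRrM mulN1r; ring.
  exact: (cvg_comp _ _ h (@continuous_expR R _)).
have fgE : (fun n => \int[P1]_w f n w) = (fun n => \int[P1]_w g n w) by apply/funext.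
rewrite fgE in lf; exact: (cvg_unique _ lf lg).
Qed.

End quotient.

Section joint.
Context {R : realType} {d1 : measure_display} {T1 : measurableType d1} (P1 : probability T1 R).
Variables (U Lam : {RV P1 >-> R}) (alpha mu1 : R).
Hypothesis alpha_gt0 : 0 < alpha.
Hypothesis mu1_gt0 : 0 < mu1.
Hypothesis Gam_ge0 : 0 <= gamma_fun (1 - alpha / 2).
Hypothesis Lam_gt0 : P1 [set w | 0 < Lam w] = 1%E.
Hypothesis UL : joint_limit_law P1 alpha mu1 U Lam.

Lemma joint_law_nonneg : P1 [set w | 0 <= U w] = 1%E.
Proof.
apply: (law_nonneg Gam_ge0 Lam_gt0) => r r0; have := UL r0 (lexx 0).
by under eq_fun do rewrite mul0r subr0; under [in X in _ = X]eq_fun do rewrite mul0r subr0.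
Qed.

Let A := [set w | 0 <= U w] `&` [set w | 0 < Lam w].

Let m1 : measurable [set w | 0 <= U w].
Proof. by apply: measurable_nonneg; exact: measurable_RV. Qed.

Let m2 : measurable [set w | 0 < Lam w].
Proof. by apply: measurable_lt => //; exact: measurable_RV. Qed.

Let A1 : P1 A = 1%E.
Proof.
have mA : measurable A by exact: measurableI.
rewrite (prE P1 mA) /A pr_pred1I//; last exact: pr_seq1.
by rewrite -(prE P1 m1) joint_law_nonneg.
Qed.

Let V w := Num.max (U w) 0.
Let M w := Num.max (Lam w) 0.

Let mV : measurable_fun setT V.
Proof. by apply: measurable_maxr => //; exact: measurable_RV. Qed.

Let mM : measurable_fun setT M.
Proof. by apply: measurable_maxr => //; exact: measurable_RV. Qed.

Let V0 w : 0 <= V w. Proof. by rewrite le_max lexx orbT. Qed.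

Let M0 w : 0 <= M w. Proof. by rewrite le_max lexx orbT. Qed.

Let VM r s : 0 < r -> 0 <= s ->
  \int[P1]_w (expR (- (r * V w)) * expR (- (s * M w))) =
  \int[P1]_w (expR (- (r `^ (alpha / 2) * gamma_fun (1 - alpha / 2) * M w)) * expR (- (s * M w))).
Proof.
move=> r0 s0; have smu : 0 <= s / mu1 by rewrite divr_ge0// ltW.
have mA : measurable A by exact: measurableI.
have bM : bounded_measurable (fun w => expR (- (s * M w))) by exact: bm_laplace.
have mUL (f : T1 -> R) : measurable_fun setT f ->
    measurable_fun setT (fun w => expR (- f w - s / mu1 * (mu1 * Lam w))).
  move=> mf; apply: measurableT_comp => //; apply: measurable_funB; first exact: measurableT_comp.
  by apply: measurable_funM => //; apply: measurable_funM => //; exact: measurable_RV.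
have sM w : 0 < Lam w -> s / mu1 * (mu1 * Lam w) = s * M w.
  by move=> w0; rewrite mulrA divfK ?gt_eqF// /M max_l// ltW.
apply: EFin_inj.
rewrite -(@expectation_eq_on _ _ _ P1 A (fun w => expR (- (r * U w) - s / mu1 * (mu1 * Lam w))))//.
- rewrite UL//; apply: (@expectation_eq_on _ _ _ P1 A) => //.
  + by apply: mUL; apply: measurable_funM => //; exact: measurable_RV.
  + by apply: bmM => //; apply: bm_laplace => //; rewrite mulr_ge0// powR_ge0.
  + move=> w [_ /= w0]; rewrite sM// expRD.
    by have -> : Lam w = M w by rewrite /M max_l// ltW.
- by apply: mUL; apply: measurable_funM => //; exact: measurable_RV.
- by apply: bmM => //; apply: bm_laplace => //; exact: ltW.
- by move=> w [/= u0 w0]; rewrite sM// expRD /V max_l.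
Qed.

Lemma joint_law_quotient (r : R) : 0 < r ->
  \int[P1]_w expR (- (r * (Num.max (U w) 0 / Num.max (Lam w) 0))) =
  \int[P1]_w stretched_exp (r `^ (alpha / 2) * gamma_fun (1 - alpha / 2)) (1 - alpha / 2) (Lam w).
Proof.
move=> r0; have b0 : 0 < alpha / 2 by rewrite divr_gt0.
have MgtE : [set w | 0 < M w] = [set w | 0 < Lam w].
  by apply/seteqP; split => w /=; rewrite /M lt_max ltxx orbF.
rewrite (quotient_laplace mV V0 mM M0 _ b0 Gam_ge0 VM r0); last by rewrite MgtE.
have sE k p (x : R) : stretched_exp k p (Num.max x 0) = stretched_exp k p x.
  by rewrite /stretched_exp [Num.max (Num.max x 0) 0]max_l// le_max lexx orbT.
by under eq_Rintegral do rewrite /M sE.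
Qed.

End joint.

(** * Sample statistics *)

Section sample_identities.
Context {R : realType}.
Implicit Types (x : nat -> R) (n : nat) (a c t : R).

(** As quotients by 0 are 0, this identity and the next one also cover samples that are
    empty or have sum 0. *)
Lemma sample_C_scaled x n a : n%:R / a ^+ 2 * sample_C x n =
  n%:R / (\sum_(i < n) x i) * ((\sum_(i < n) x i ^+ 2) / a ^+ 2).
Proof.
rewrite /sample_C; case: eqP => [->|_]; first by rewrite !mul0r.
by rewrite mulrACA [in RHS]mulrACA; congr (_ * _); rewrite mulrC.
Qed.

Lemma sample_dispersion_scaled x n c : c * sample_dispersion x n =
  c / (\sum_(i < n) x i) * (\sum_(i < n) x i ^+ 2) - c * ((\sum_(i < n) x i) / n%:R).
Proof.
rewrite /sample_dispersion; case: eqP => [->|/eqP n0].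
  by rewrite !big_ord0 !mul0r !mulr0 subrr.
have n1 : n%:R != 0 :> R by rewrite pnatr_eq0.
rewrite /sample_mean; set s := \sum_(i < n) x i.
have [->|s0] := eqVneq s 0; first by rewrite !(mulr0, mul0r, invr0) subrr.
rewrite /sample_variance /sample_mean -/s.
rewrite (eq_bigr (fun i : 'I_n => x i ^+ 2 - 2 * (n%:R^-1 * s) * x i + (n%:R^-1 * s) ^+ 2)).
  rewrite big_split/= sumrB -mulr_sumr -/s sumr_const card_ord -[_ *+ n]mulr_natl.
  by field; rewrite s0 n1.
by move=> i _; ring.
Qed.

End sample_identities.

(** * The tail of a Pareto-type variable *)

Section regular_tail.
Context {R : realType}.
Variables (G ell : R -> R) (alpha : R).
Hypothesis G_noninc : forall x y, x <= y -> G y <= G x.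
Hypothesis ell_sv : slowly_varying ell.
Hypothesis G_ell : G x / (x `^ (- alpha) * ell x) @[x --> +oo] --> (1 : R).

Let den_gt0 : \forall x \near +oo, 0 < x `^ (- alpha) * ell x.
Proof.
have [[A _ ellA] _] := ell_sv; near=> x; rewrite mulr_gt0//.
  by rewrite powR_gt0//; near: x; apply: nbhs_pinfty_gt; exact: num_real.
by apply: ellA; near: x; apply: nbhs_pinfty_ge; exact: num_real.
Unshelve. all: by end_near. Qed.

Lemma regular_tail_gt0 x : 0 < G x.
Proof.
near (+oo : set_system R) => y.
apply: (@lt_le_trans _ _ (G y)); last first.
  by apply: G_noninc; near: y; apply: nbhs_pinfty_ge; exact: num_real.
have d0 : 0 < y `^ (- alpha) * ell y by near: y.
have : 0 < G y / (y `^ (- alpha) * ell y) by near: y; exact: cvgr_gt G_ell _ ltr01.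
by rewrite pmulr_lgt0// invr_gt0.
Unshelve. all: by end_near. Qed.

Lemma regular_tail_ratio c : 0 < c -> G (c * x) / G x @[x --> +oo] --> c `^ (- alpha).
Proof.
move=> c0; have [_ /(_ c c0) ellc] := ell_sv.
have cy : c * x @[x --> +oo] --> +oo by exact: gt0_cvgMry.
have h1 : G (c * x) / ((c * x) `^ (- alpha) * ell (c * x)) @[x --> +oo] --> (1 : R).
  exact: (cvg_comp _ _ cy G_ell).
have h2 : (G x / (x `^ (- alpha) * ell x))^-1 @[x --> +oo] --> (1^-1 : R).
  by apply: cvgV => //; exact: oner_neq0.
have h3 : G (c * x) / ((c * x) `^ (- alpha) * ell (c * x)) * (ell (c * x) / ell x) *
    (G x / (x `^ (- alpha) * ell x))^-1 * c `^ (- alpha) @[x --> +oo] -->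
    1 * 1 * 1^-1 * c `^ (- alpha).
  by apply: cvgMl; apply: cvgM => //; exact: cvgM.
rewrite invr1 !mul1r in h3; apply: cvg_trans h3; apply: near_eq_cvg.
have den_c : \forall x \near +oo, 0 < (c * x) `^ (- alpha) * ell (c * x) by exact: cy den_gt0.
near=> x; have x0 : 0 < x by near: x; apply: nbhs_pinfty_gt; exact: num_real.
have d1 : 0 < x `^ (- alpha) * ell x by near: x.
have d2 : 0 < (c * x) `^ (- alpha) * ell (c * x) by near: x.
have p1 : 0 < x `^ (- alpha) by rewrite powR_gt0.
have p2 : 0 < c `^ (- alpha) by rewrite powR_gt0.
have pc : (c * x) `^ (- alpha) = c `^ (- alpha) * x `^ (- alpha) by rewrite powRM// ltW.
have l1 : 0 < ell x by rewrite -(pmulr_rgt0 _ p1).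
have l2 : 0 < ell (c * x).
  by move: d2; rewrite pc pmulr_rgt0// mulr_gt0.
rewrite pc; have Gx := regular_tail_gt0 x.
by field; rewrite !gt_eqF.
Unshelve. all: by end_near. Qed.

(** The equivalence of G (x) and x^(- alpha) ell (x) is evaluated at x = a_t. *)
Lemma regular_tail_norming (a : R -> R) : a t @[t --> +oo] --> +oo ->
  t * a t `^ (- alpha) * ell (a t) @[t --> +oo] --> (1 : R) ->
  t * G (a t) @[t --> +oo] --> (1 : R).
Proof.
move=> ay aell.
have h : t * a t `^ (- alpha) * ell (a t) *
    (G (a t) / (a t `^ (- alpha) * ell (a t))) @[t --> +oo] --> (1 * 1 : R).
  by apply: cvgM => //; exact: (cvg_comp _ _ ay G_ell).
rewrite mulr1 in h; apply: cvg_trans h; apply: near_eq_cvg.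
have den_a : \forall t \near +oo, 0 < a t `^ (- alpha) * ell (a t) by exact: ay den_gt0.
apply: filterS den_a => t d0.
by rewrite -[t * _ * _]mulrA mulrA -[_ * _ * G _]mulrA [_ * G _]mulrC mulrA mulfK// gt_eqF.
Qed.

End regular_tail.

(** * Limits of the statistics *)

(** 1 / x = x (x^2)^(-1), a product of measurable functions. *)
Lemma measurable_inv {R : realType} : measurable_fun setT (fun x : R => x^-1).
Proof.
have -> : (fun x : R => x^-1) = (fun x => x * (x ^+ 2) `^ (- 1)).
  apply/funext => x; rewrite powR_inv1 ?sqr_ge0//.
  by have [->|x0] := eqVneq x 0; [rewrite invr0 mul0r|field].
apply: measurable_funM => //; apply: (measurableT_comp (@measurable_powR R (- 1))).
exact: measurable_funX.
Qed.

Lemma cvg_in_distribution_eq_on {R : realType}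
    {d} {T : measurableType d} (P : probability T R)
    {d'} {T' : measurableType d'} (Q : probability T' R)
    (Y : R -> T -> R) (Z Z' : T' -> R) (A : set T') :
  measurable A -> Q A = 1%E -> measurable_fun setT Z -> measurable_fun setT Z' ->
  (forall w, A w -> Z w = Z' w) ->
  cvg_in_distribution P Y Q Z -> cvg_in_distribution P Y Q Z'.
Proof.
move=> mA QA mZ mZ' ZZ'.
suff E x : Q (Z' @^-1` `]-oo, x]) = Q (Z @^-1` `]-oo, x]).
  move=> h x; rewrite E; have -> : (fun y => Q (Z' @^-1` `]-oo, y])) =
    (fun y => Q (Z @^-1` `]-oo, y])) by apply/funext.
  exact: h.
rewrite !prE; try exact: measurable_le.
congr (_%:E); apply: (pr_eq_on mA); try exact: measurable_le; first exact: pr_seq1.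
by move=> w Aw; rewrite /= ZZ'.
Qed.

Section dispersion.
Context {R : realType} {d : measure_display} {T : measurableType d} (P : probability T R).
Context {d' : measure_display} {T' : measurableType d'} (Q : probability T' R).
Variables (X : {RV P >-> R}) (Xs : nat -> {RV P >-> R}) (N : R -> {RV P >-> nat}).
Variable Lam : {RV Q >-> R}.
Hypothesis X_gt0 : P [set w | 0 < X w] = 1%E.
Hypothesis Xs_indep : mutually_independent P Xs.
Hypothesis XsX : forall i, same_distribution (Xs i) X.
Hypothesis XN_indep : forall t A n, 0 <= t -> generated_sigma_algebra [set: nat] Xs A ->
  P (A `&` N t @^-1` [set n]) = (P A * P (N t @^-1` [set n]))%E.
Hypothesis Lam_gt0 : Q [set w | 0 < Lam w] = 1%E.
Hypothesis N_Lam : cvg_in_distribution P (fun t w => (N t w)%:R / t) Q Lam.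
Let G (x : R) : R := pr P [set w | x < `|X w|].
Variables (alpha : R) (a : R -> R).
Hypothesis alpha_bnd : 0 < alpha < 2.
Hypothesis G_gt0 : forall x, 0 < G x.
Hypothesis G_rv : forall c, 0 < c -> G (c * x) / G x @[x --> +oo] --> c `^ (- alpha).
Hypothesis a_y : a t @[t --> +oo] --> +oo.
Hypothesis a_G : t * G (a t) @[t --> +oo] --> (1 : R).
Hypothesis X_int : (\int[P]_w `|X w|%:E < +oo)%E.
Let mu1 : R := \int[P]_w `|X w|.
Let Gam : R := gamma_fun (1 - alpha / 2).

Let sum1 t w := \sum_(i < N t w) Xs i w.
Let sum2 t w := \sum_(i < N t w) Xs i w ^+ 2.

Lemma mean_gt0 : 0 < mu1.
Proof.
have mA : measurable [set w | 1 < `|X w|].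
  by apply: measurable_gt_norm; exact: measurable_RV.
apply: (lt_le_trans (G_gt0 1)); rewrite /G -Ex_indic//.
apply: le_Rintegral => //.
- by apply: bm_integrable; exact: bm_indic.
- by have := integrable_scaled_norm X_int 1; under eq_fun do rewrite mul1r.
move=> w _; rewrite indicE; have [/set_mem/= h|_] := boolP (w \in _); last exact: normr_ge0.
exact: ltW h.
Qed.

Let all_pos := [set w | forall i, 0 < Xs i w].

Let all_posE : all_pos = \bigcap_i [set w | 0 < Xs i w].
Proof. by apply/seteqP; split => [w h i _|w h i]; [exact: h|exact: h]. Qed.

Let m_pos i : measurable [set w | 0 < Xs i w].
Proof. by apply: measurable_lt => //; exact: measurable_RV. Qed.

Let m_all_pos : measurable all_pos.
Proof. by rewrite all_posE; exact: bigcap_measurable. Qed.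

Let pr_all_pos : pr P all_pos = 1.
Proof.
have X1 i : P [set w | 0 < Xs i w] = 1%E.
  rewrite -X_gt0; have := XsX i (measurable_itv `]0, +oo[).
  rewrite /distribution /pushforward.
  by congr (P _ = P _); apply/seteqP; split => w /=; rewrite in_itv/= andbT.
suff : P (~` all_pos) = 0%E.
  by move=> h; have := prC P m_all_pos; rewrite /pr h /= -/(pr P all_pos); lra.
apply: (negligibleP P (measurableC m_all_pos)).1.
rewrite all_posE setC_bigcap.
apply: negligible_bigcup => i; apply: (negligibleP P (measurableC (m_pos i))).2.
by apply: null_setC => //; exact: pr_seq1.
Qed.

Let pos_norm t w : all_pos w -> \sum_(i < N t w) `|Xs i w| = sum1 t w.
Proof. by move=> h; apply: eq_bigr => i _; rewrite gtr0_norm. Qed.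

Lemma likely_mean (e : R) : 0 < e -> likely P (fun t w => `|sum1 t w / (N t w)%:R - mu1| < e).
Proof.
move=> e0.
have h1 := likely_random_mean X_int Xs_indep XsX XN_indep Lam_gt0 N_Lam e0.
have h2 : likely P (fun (t : R) w => all_pos w).
  by apply: likely_sure m_all_pos pr_all_pos _; exact: nearW.
by apply: likely_imp (likely_and h1 h2) _; apply: nearW => t w [+ h]; rewrite pos_norm.
Qed.

Lemma likely_inv_mean (e : R) : 0 < e ->
  likely P (fun t w => `|(N t w)%:R / sum1 t w - mu1^-1| <= e).
Proof.
move=> e0.
have /cvgrPdist_le/(_ _ e0)/nbhs_ballP[r /= r0 hr] :
    z^-1 @[z --> mu1] --> mu1^-1 by apply: cvgV; [exact: lt0r_neq0 mean_gt0|exact: cvg_id].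
apply: likely_imp (likely_mean r0) _; apply: nearW => t w h.
by rewrite distrC -[_ / sum1 t w]invf_div; apply: hr; rewrite /ball/= distrC.
Qed.

Lemma likely_mean_bounded : likely P (fun t w => `|sum1 t w / (N t w)%:R| <= mu1 + 1).
Proof.
apply: likely_imp (likely_mean ltr01) _; apply: nearW => t w h.
have m0 := mean_gt0; move: h; rewrite ltr_norml => /andP[h1 h2].
by rewrite ler_norml; apply/andP; split; lra.
Qed.

Lemma t_sqr_cvg0 : t / a t ^+ 2 @[t --> +oo] --> (0 : R).
Proof.
have /andP[al0 al2] := alpha_bnd.
have tn := tail_noninc P (measurable_RV X).
have := regular_sqr_cvgy tn G_gt0 G_rv al0 al2.
move=> /(cvg_comp _ _ a_y) h.
have h2 : (a t ^+ 2 * G (a t))^-1 @[t --> +oo] --> (0 : R).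
  apply/cvgrVy; last by apply: cvg_trans h; apply: near_eq_cvg; apply: nearW => t /=; rewrite invrK.
  near=> t; rewrite invr_gt0 mulr_gt0// exprn_gt0//.
  by near: t; have /cvgryPgt := a_y; exact.
have : t * G (a t) * (a t ^+ 2 * G (a t))^-1 @[t --> +oo] --> (1 * 0 : R) by exact: cvgM.
rewrite mulr0; apply: cvg_trans; apply: near_eq_cvg; apply: nearW => t.
by rewrite invfM mulrACA divff ?mulr1// gt_eqF.
Unshelve. all: by end_near. Qed.

Let msum1 t : measurable_fun setT (sum1 t).
Proof.
apply: (measurable_random_index (measurable_RV_nat (N t)) (F := fun n w => \sum_(i < n) Xs i w)).
by move=> n; apply: measurable_sum => i; exact: measurable_RV.
Qed.

Let msum2 t : measurable_fun setT (sum2 t).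
Proof.
apply: (measurable_random_index (measurable_RV_nat (N t)) (F := fun n w => \sum_(i < n) Xs i w ^+ 2)).
by move=> n; apply: measurable_sum => i; apply: measurable_funX; exact: measurable_RV.
Qed.

Let mN t : measurable_fun setT (fun w => (N t w)%:R : R).
Proof. exact: measurable_natr. Qed.

Let sum2_ge0 t w : 0 <= sum2 t w.
Proof. by apply: sumr_ge0 => i _; exact: sqr_ge0. Qed.

Let W (g t : R) w := ((N t w)%:R / t) `^ (- g) * (sum2 t w / a t ^+ 2).

Let mW g t : measurable_fun setT (W g t).
Proof.
apply: measurable_funM; last exact: measurable_funM.
by apply: (measurableT_comp (@measurable_powR R (- g))); exact: measurable_funM.
Qed.

Let W_ge0 g t w : 0 <= W g t w.
Proof. by rewrite mulr_ge0 ?powR_ge0// divr_ge0 ?sqr_ge0. Qed.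

Let mA t : measurable_fun setT (fun w => (N t w)%:R / sum1 t w).
Proof.
by apply: measurable_funM => //; exact: (measurableT_comp measurable_inv).
Qed.

Section limit.
Context {d1 : measure_display} {T1 : measurableType d1} (P1 : probability T1 R).
Variables (V : T1 -> R) (g : R).
Hypotheses (mV : measurable_fun setT V) (V0 : forall w, 0 <= V w).
Hypotheses (g0 : 0 <= g) (g1 : g * (alpha / 2) < 1).
Hypothesis V_laplace : forall r, 0 < r -> \int[P1]_w expR (- (r * V w)) =
  \int[Q]_w stretched_exp (r `^ (alpha / 2) * Gam) (1 - g * (alpha / 2)) (Lam w).

(** The factor W carries the randomness that survives in the limit; N / S1 tends to
    1 / mu1 and B to 0 in probability. *)
Lemma statistic_cvg (Y B : R -> T -> R) :
  (forall t, measurable_fun setT (B t)) ->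
  (forall e, 0 < e -> likely P (fun t w => `|B t w| <= e)) ->
  (forall t, measurable_fun setT (Y t)) ->
  (\forall t \near +oo, forall w, Y t w = (N t w)%:R / sum1 t w * W g t w - B t w) ->
  cvg_in_distribution P Y P1 (fun w => mu1^-1 * V w).
Proof.
move=> mB Bsmall mY YE.
apply: (slutsky (mW g) (W_ge0 g) mY mV _ _ likely_inv_mean Bsmall YE).
  apply: laplace_cvg_interlaced => // r r0; rewrite V_laplace//.
  exact: (laplace_random_sum_of_squares Xs_indep XsX XN_indep Lam_gt0 N_Lam alpha_bnd
    G_gt0 G_rv a_y a_G g0 g1 r0).
by rewrite invr_gt0 mean_gt0.
Qed.

End limit.

Section limit_N.
Context {d1 : measure_display} {T1 : measurableType d1} (P1 : probability T1 R).
Variable V : T1 -> R.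
Hypotheses (mV : measurable_fun setT V) (V0 : forall w, 0 <= V w).
Hypothesis V_laplace : forall r, 0 < r -> \int[P1]_w expR (- (r * V w)) =
  \int[Q]_w stretched_exp (r `^ (alpha / 2) * Gam) 1 (Lam w).

Let V_laplace0 r : 0 < r -> \int[P1]_w expR (- (r * V w)) =
  \int[Q]_w stretched_exp (r `^ (alpha / 2) * Gam) (1 - 0 * (alpha / 2)) (Lam w).
Proof. by move=> r0; rewrite mul0r subr0 V_laplace. Qed.

Let W0E t w : W 0 t w = sum2 t w / a t ^+ 2.
Proof. by rewrite /W oppr0 powRr0 mul1r. Qed.

Let g1 : 0 * (alpha / 2) < 1.
Proof. by rewrite mul0r. Qed.

Lemma scaled_C_cvg : cvg_in_distribution P
  (fun t w => (N t w)%:R / a t ^+ 2 * sample_C (fun i => Xs i w) (N t w))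
  P1 (fun w => mu1^-1 * V w).
Proof.
have E t w : (N t w)%:R / a t ^+ 2 * sample_C (fun i => Xs i w) (N t w) =
    (N t w)%:R / sum1 t w * W 0 t w by rewrite sample_C_scaled W0E.
apply: (statistic_cvg mV V0 (lexx 0) g1 V_laplace0 (B := fun _ _ => 0)) => [//|e e0|t|].
- by apply: (likely_sure measurableT (prT P)); apply: nearW => t w _; rewrite normr0 ltW.
- by rewrite (funext (E t)); exact: measurable_funM.
- by apply: nearW => t w; rewrite subr0 E.
Qed.

Lemma scaled_dispersion_cvg : cvg_in_distribution P
  (fun t w => (N t w)%:R / a t ^+ 2 * sample_dispersion (fun i => Xs i w) (N t w))
  P1 (fun w => mu1^-1 * V w).
Proof.
pose B t w := (N t w)%:R / a t ^+ 2 * (sum1 t w / (N t w)%:R).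
have E t w : (N t w)%:R / a t ^+ 2 * sample_dispersion (fun i => Xs i w) (N t w) =
    (N t w)%:R / sum1 t w * W 0 t w - B t w.
  rewrite sample_dispersion_scaled W0E -/(sum1 t w) -/(sum2 t w) -/(B t w); congr (_ - _).
  by move: (sum1 t w)^-1 (sum2 t w) (a t ^+ 2)^-1 => x y z; ring.
have mB t : measurable_fun setT (B t).
  apply: measurable_funM; first exact: measurable_funM.
  by apply: measurable_funM => //; exact: (measurableT_comp measurable_inv).
apply: (statistic_cvg mV V0 (lexx 0) g1 V_laplace0 mB) => [e e0|t|].
- have m1 : 0 < mu1 + 1 by rewrite addr_gt0// mean_gt0.
  have em : 0 < e / (mu1 + 1) by rewrite divr_gt0.
  have h := likely_N_small N_Lam t_sqr_cvg0 em.
  apply: likely_imp (likely_and h likely_mean_bounded) _.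
  near=> t => w [h1 h2]; have t0 : 0 < t by near: t; apply: nbhs_pinfty_gt; exact: num_real.
  rewrite /B -[X in X * _](_ : (N t w)%:R / t * (t / a t ^+ 2) = _); last first.
    by rewrite mulrA divfK// gt_eqF.
  by rewrite normrM -[leRHS](divfK (lt0r_neq0 m1)) ler_pM.
- rewrite (funext (E t)); apply: measurable_funB => //; exact: measurable_funM.
- by apply: nearW => t w; rewrite E.
Unshelve. all: by end_near. Qed.

End limit_N.

Section limit_t.
Context {d1 : measure_display} {T1 : measurableType d1} (P1 : probability T1 R).
Variable V : T1 -> R.
Hypotheses (mV : measurable_fun setT V) (V0 : forall w, 0 <= V w).
Hypothesis V_laplace : forall r, 0 < r -> \int[P1]_w expR (- (r * V w)) =
  \int[Q]_w stretched_exp (r `^ (alpha / 2) * Gam) (1 - alpha / 2) (Lam w).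

Let V_laplace1 r : 0 < r -> \int[P1]_w expR (- (r * V w)) =
  \int[Q]_w stretched_exp (r `^ (alpha / 2) * Gam) (1 - 1 * (alpha / 2)) (Lam w).
Proof. by move=> r0; rewrite mul1r V_laplace. Qed.

Let g1 : 1 * (alpha / 2) < 1.
Proof. by rewrite mul1r; have /andP[_ h] := alpha_bnd; lra. Qed.

Lemma time_scaled_dispersion_cvg : cvg_in_distribution P
  (fun t w => t / a t ^+ 2 * sample_dispersion (fun i => Xs i w) (N t w))
  P1 (fun w => mu1^-1 * V w).
Proof.
pose B t w := t / a t ^+ 2 * (sum1 t w / (N t w)%:R).
have E t w : t / a t ^+ 2 * sample_dispersion (fun i => Xs i w) (N t w) =
    t / a t ^+ 2 / sum1 t w * sum2 t w - B t w by rewrite sample_dispersion_scaled.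
have mB t : measurable_fun setT (B t).
  apply: measurable_funM => //.
  by apply: measurable_funM => //; exact: (measurableT_comp measurable_inv).
apply: (statistic_cvg mV V0 ler01 g1 V_laplace1 mB) => [e e0|t|].
- have m1 : 0 < mu1 + 1 by rewrite addr_gt0// mean_gt0.
  have em : 0 < e / (mu1 + 1) by rewrite divr_gt0.
  have /cvgrPdist_le/(_ _ em) := t_sqr_cvg0 => h.
  apply: likely_imp likely_mean_bounded _; apply: filterS h => t.
  rewrite sub0r normrN => h1 w h2.
  by rewrite /B normrM -[leRHS](divfK (lt0r_neq0 m1)) ler_pM.
- rewrite (funext (E t)); apply: measurable_funB => //; apply: measurable_funM => //.
  by apply: measurable_funM => //; exact: (measurableT_comp measurable_inv).
near=> t => w; rewrite E; congr (_ - _).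
have t0 : 0 < t by near: t; apply: nbhs_pinfty_gt; exact: num_real.
rewrite /W powR_inv1; last by rewrite divr_ge0// ltW.
have [N0|N0] := eqVneq (N t w) 0%N.
  by rewrite /sum2 N0 big_ord0 !(mul0r, mulr0).
have n0 : (N t w)%:R != 0 :> R by rewrite pnatr_eq0.
rewrite invf_div; move: (sum1 t w)^-1 (sum2 t w) (a t ^+ 2)^-1 => x y z.
by field.
Unshelve. all: by end_near. Qed.

End limit_t.

End dispersion.

Theorem mainTheorem15 (R : realType)
  (d : measure_display) (T : measurableType d) (P : probability T R)
  (X : {RV P >-> R}) (Xs : nat -> {RV P >-> R}) (N : R -> {RV P >-> nat})
  (d' : measure_display) (T' : measurableType d') (P' : probability T' R)
  (Lam : {RV P' >-> R})
  (alpha : R) (ell a : R -> R) :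
  P [set w | 0 < X w] = 1%E ->
  (forall i, same_distribution (Xs i) X) ->
  mutually_independent P Xs ->
  counting_process N ->
  independent_classes P
    (generated_sigma_algebra [set: nat] Xs)
    (generated_sigma_algebra [set t : R | 0 <= t] N) ->
  (1 < alpha < 2) \/ (alpha = 1 /\ ('E_P[X] < +oo)%E) ->
  pareto_type X alpha ell ->
  D_averages_in_time P N P' Lam ->
  a t @[t --> +oo] --> +oo ->
  t * a t `^ (- alpha) * ell (a t) @[t --> +oo] --> (1 : R) ->
  let mu1 := fine ('E_P[X])%E in
  let C := fun t w => sample_C (fun i => Xs i w) (N t w) in
  let D := fun t w => sample_dispersion (fun i => Xs i w) (N t w) in
  [/\ (* a random vector (U, Lam1) with the required law exists *)
      exists (d1 : measure_display) (T1 : measurableType d1)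
        (P1 : probability T1 R) (U Lam1 : {RV P1 >-> R}),
        same_distribution Lam1 Lam /\ joint_limit_law P1 alpha mu1 U Lam1,
      forall (d1 : measure_display) (T1 : measurableType d1)
        (P1 : probability T1 R) (U : {RV P1 >-> R}),
        limit_law P1 alpha U P' Lam ->
        cvg_in_distribution P (fun t w => (N t w)%:R / a t ^+ 2 * C t w)
          P1 (fun w => mu1^-1 * U w) /\
        cvg_in_distribution P (fun t w => (N t w)%:R / a t ^+ 2 * D t w)
          P1 (fun w => mu1^-1 * U w)
    & forall (d1 : measure_display) (T1 : measurableType d1)
        (P1 : probability T1 R) (U Lam1 : {RV P1 >-> R}),
        same_distribution Lam1 Lam ->
        joint_limit_law P1 alpha mu1 U Lam1 ->
        cvg_in_distribution P (fun t w => t / a t ^+ 2 * D t w)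
          P1 (fun w => mu1^-1 * (U w / Lam1 w))].
Proof.
move=> X_gt0 XsX Xs_indep _ XN alpha_mu [ell_sv X_ell] [Lam_gt0 N_Lam] a_y a_ell mu1 C D.
have mX := measurable_RV X.
have alpha_bnd : 0 < alpha < 2 by case: alpha_mu => [|[]]; lra.
have /andP[alpha_gt0 _] := alpha_bnd.
have m_pos : measurable [set w | 0 < X w] by exact: measurable_lt.
pose G x := pr P [set w | x < `|X w|].
have GE x : G x = 1 - fine (cdf X x).
  have mle := measurable_le x mX.
  rewrite /cdf /distribution /pushforward -/(pr P (X @^-1` `]-oo, x])) -prC//.
  apply: (pr_eq_on m_pos).
  - exact: measurable_gt_norm.
  - exact: measurableC.
  - exact: pr_seq1.
  move=> w /= w0; rewrite in_itv/= gtr0_norm//.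
  by rewrite ltNge; split => /negP.
have G_noninc x y : x <= y -> G y <= G x by exact: tail_noninc.
have G_ell : G x / (x `^ (- alpha) * ell x) @[x --> +oo] --> (1 : R).
  by under eq_fun do rewrite GE.
have G_gt0 := regular_tail_gt0 G_noninc ell_sv G_ell.
have G_rv := regular_tail_ratio G_noninc ell_sv G_ell.
have a_G := regular_tail_norming ell_sv G_ell a_y a_ell.
have EX : 'E_P[X]%E = (\int[P]_w `|X w|%:E)%E.
  rewrite unlock; apply: ae_eq_integral => //.
  - exact/measurable_EFinP.
  - by apply/measurable_EFinP; exact: measurableT_comp.
  exists (~` [set w | 0 < X w]); split; first exact: measurableC.
    by apply: null_setC => //; exact: pr_seq1.
  by move=> w /= h Xw; apply: h => _; rewrite gtr0_norm.
have X_int : (\int[P]_w `|X w|%:E < +oo)%E.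
  case: alpha_mu => [/andP[alpha_gt1 _]|[_]]; last by rewrite EX.
  exact: regular_integrable alpha_gt1 G_gt0 G_rv.
have mu1E : mu1 = \int[P]_w `|X w| by rewrite /mu1 EX.
have mu1_gt0 : 0 < mu1 by rewrite mu1E; exact: mean_gt0 X_int.
have XN_indep t A n : 0 <= t -> generated_sigma_algebra [set: nat] Xs A ->
    P (A `&` N t @^-1` [set n]) = (P A * P (N t @^-1` [set n]))%E.
  by move=> t0 XA; apply: XN => //; apply: sub_sigma_algebra; exists t, [set n].
have Gam0 := Gam_gt0 alpha_bnd G_gt0 G_rv.
split.
- have [d0 [T0 [P0 [S [mS S0 SL]]]]] :=
    stable_law Xs_indep XsX alpha_bnd G_gt0 G_rv a_y a_G.
  exact: joint_limit_exists mu1 alpha_gt0 mS S0 SL Lam_gt0.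
- move=> d1 T1 P1 U UL.
  have U_law r : 0 < r -> _ := fun r0 => UL r (ltW r0).
  have mV : measurable_fun setT (fun w => Num.max (U w) 0).
    by apply: measurable_maxr => //; exact: measurable_RV.
  have V0 w : 0 <= Num.max (U w) 0 by rewrite le_max lexx orbT.
  have m0 : measurable [set w | 0 <= U w].
    by apply: measurable_nonneg; exact: measurable_RV.
  have VL := law_laplace (ltW Gam0) Lam_gt0 U_law.
  have U0 := law_nonneg (ltW Gam0) Lam_gt0 U_law.
  have transfer Y : cvg_in_distribution P Y P1 (fun w => mu1^-1 * Num.max (U w) 0) ->
      cvg_in_distribution P Y P1 (fun w => mu1^-1 * U w).
    apply: cvg_in_distribution_eq_on m0 U0 _ _ _; first exact: measurable_funM.
      by apply: measurable_funM => //; exact: measurable_RV.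
    by move=> w /= w0; rewrite max_l.
  split; apply: transfer; rewrite mu1E.
    exact: (scaled_C_cvg X_gt0 Xs_indep XsX XN_indep Lam_gt0 N_Lam alpha_bnd
      G_gt0 G_rv a_y a_G X_int mV V0 VL).
  exact: (scaled_dispersion_cvg X_gt0 Xs_indep XsX XN_indep Lam_gt0 N_Lam alpha_bnd
    G_gt0 G_rv a_y a_G X_int mV V0 VL).
move=> d1 T1 P1 U Lam1 LL UL.
have Lam1_gt0 : P1 [set w | 0 < Lam1 w] = 1%E.
  rewrite -Lam_gt0; have := LL _ (measurable_itv `]0, +oo[).
  rewrite /distribution /pushforward.
  by congr (P1 _ = P' _); apply/seteqP; split => w /=; rewrite in_itv/= andbT.
pose V w := Num.max (U w) 0 / Num.max (Lam1 w) 0.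
have max0 (x : R) : 0 <= Num.max x 0 by rewrite le_max lexx orbT.
have V0 w : 0 <= V w by rewrite divr_ge0.
have mmax (Z : T1 -> R) : measurable_fun setT Z -> measurable_fun setT (fun w => Num.max (Z w) 0).
  by move=> mZ; exact: measurable_maxr.
have mV : measurable_fun setT V.
  apply: measurable_funM; first by apply: mmax; exact: measurable_RV.
  by apply: (measurableT_comp measurable_inv); apply: mmax; exact: measurable_RV.
have VL r : 0 < r -> \int[P1]_w expR (- (r * V w)) =
    \int[P']_w stretched_exp (r `^ (alpha / 2) * gamma_fun (1 - alpha / 2)) (1 - alpha / 2) (Lam w).
  move=> r0; rewrite /V (joint_law_quotient alpha_gt0 mu1_gt0 (ltW Gam0) Lam1_gt0 UL)//.
  apply: (Ex_same_distribution LL); first exact: measurable_stretched.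
  by move=> x; exact: expR_ge0.
have mle0 (Z : {RV P1 >-> R}) : measurable [set w | 0 <= Z w].
  by apply: measurable_nonneg; exact: measurable_RV.
have mlt0 : measurable [set w | 0 < Lam1 w].
  by apply: measurable_lt => //; exact: measurable_RV.
have U0 := joint_law_nonneg (ltW Gam0) Lam1_gt0 UL.
apply: (@cvg_in_distribution_eq_on _ _ _ _ _ _ _ _ (fun w => mu1^-1 * V w) _
  ([set w | 0 <= U w] `&` [set w | 0 < Lam1 w])).
- exact: measurableI.
- rewrite (prE P1); last exact: measurableI.
  by rewrite pr_pred1I//; [rewrite -(prE P1)|exact: pr_seq1].
- exact: measurable_funM.
- apply: measurable_funM => //; apply: measurable_funM; first exact: measurable_RV.
  by apply: (measurableT_comp measurable_inv); exact: measurable_RV.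
- by move=> w [/= u0 l0]; rewrite /V !max_l// ltW.
rewrite mu1E.
exact: (time_scaled_dispersion_cvg X_gt0 Xs_indep XsX XN_indep Lam_gt0 N_Lam alpha_bnd
  G_gt0 G_rv a_y a_G X_int mV V0 VL).
Qed.
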